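(* Let $(K,\Omega+\Theta)$ be a 2-shifted symplectic Lie group with corresponding quadratic Lie algebra $\mathfrak{k}$. Suppose that $(\mathcal{H}_i,\Phi_i,\sigma_i+\eta_i)$, $i=1,2$, are lagrangian morphisms into $K$, with $\mathcal{H}_i\rightrightarrows N_i$, such that $\Phi_1$ and $\Phi_2$ are transverse maps, and let $\mathbf{L}_i=(\mathtt{a}_{\mathcal{H}_i},\lambda_{\sigma_i},\mathrm{Lie}(\Phi_i))(A_{\mathcal{H}_i})\subseteq\mathbb{T}_{\eta_i}N_i\times\mathfrak{k}$ be the corresponding Dirac structures. Then: (a) the subbundle of $T(N_1\times N_2)\oplus T^*(N_1\times N_2)$ given by $$\{((X_1,X_2),(\alpha_1,\alpha_2))\ |\ \exists\,k\in\mathfrak{k}\text{ with }(X_1,\alpha_1,k)\in\mathbf{L}_1,\ (X_2,-\alpha_2,k)\in\mathbf{L}_2\}$$ is a Dirac structure in $\mathbb{T}_\eta(N_1\times N_2)$, where $\eta=\mathrm{pr}_1^*\eta_1-\mathrm{pr}_2^*\eta_2$. (b) The Lie groupoid $\mathcal{H}_1\times_K\mathcal{H}_2\rightrightarrows N_1\times N_2$ together with $\sigma=\mathrm{pr}_1^*\sigma_1-\mathrm{pr}_2^*\sigma_2$ is a quasi-symplectic groupoid (with respect to $\eta$) integrating the $\eta$-twisted Dirac structure in (a).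
   Context: Everything is real and $C^\infty$. For a Lie groupoid $\mathcal{H}\rightrightarrows N$, $\mathtt{s},\mathtt{t}$ are source and target, $\mathtt{m}:\mathcal{H}_{(2)}=\{(g,h):\mathtt{s}(g)=\mathtt{t}(h)\}\to\mathcal{H}$ the multiplication, $\epsilon$ the unit map ($N$ identified with its image). $A_{\mathcal{H}}=\ker(T\mathtt{s})|_N$ with anchor $\mathtt{a}_{\mathcal{H}}=T\mathtt{t}$ and bracket induced by right-invariant vector fields (same convention for Lie groups). For a 2-form $\sigma$ on $\mathcal{H}$, $\lambda_\sigma:A_{\mathcal{H}}\to T^*N$, $\lambda_\sigma(u)=(i_u\sigma)|_{TN}$. 2-shifted symplectic Lie group: a Lie group $K$ with $\Omega\in\Omega^2(K\times K)$, whose pullbacks along $k\mapsto(1,k)$ and $k\mapsto(k,1)$ vanish, and $\Theta\in\Omega^3(K)$, such that $\delta\Omega=0$, $\delta\Theta=\mathrm{pr}_1^*\Theta+\mathrm{pr}_2^*\Theta-\mathtt{m}^*\Theta=-d\Omega$, $d\Theta=0$, where $\delta\Omega=(k_2,k_3)^*\Omega-(k_1k_2,k_3)^*\Omega+(k_1,k_2k_3)^*\Omega-(k_1,k_2)^*\Omega$, and such that $\langle u,v\rangle=-\Omega_{(1,1)}((u,0),(0,v))+\Omega_{(1,1)}((0,u),(v,0))$ is nondegenerate on $\mathfrak{k}$; this is the pairing of the corresponding quadratic Lie algebra. A lagrangian morphism $(\mathcal{H},\Phi,\sigma+\eta)$ into $(K,\Omega+\Theta)$ is a Lie groupoid morphism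 $\Phi:\mathcal{H}\to K$ with $\sigma\in\Omega^2(\mathcal{H})$, $\epsilon^*\sigma=0$, and a closed $\eta\in\Omega^3(N)$ satisfying $\mathrm{pr}_1^*\sigma+\mathrm{pr}_2^*\sigma-\mathtt{m}^*\sigma=\Phi^*\Omega$, $\mathtt{s}^*\eta-\mathtt{t}^*\eta-d\sigma=\Phi^*\Theta$, $\dim\mathcal{H}-2\dim N=\frac12\dim K$, $\ker(\sigma)_h\cap\ker(T\Phi)_h\cap\ker(T\mathtt{s})_h\cap\ker(T\mathtt{t})_h=\{0\}$ for all $h$. $\mathbb{T}_\eta M$ ($\eta$ a closed 3-form on $M$) is the Courant algebroid $TM\oplus T^*M$ with pairing $i_Y\alpha+i_X\beta$ of $X+\alpha$ and $Y+\beta$, anchor the projection to $TM$, bracket $[X,Y]+\mathcal{L}_X\beta-i_Yd\alpha+i_Yi_X\eta$. $\mathbb{T}_\eta M\times\mathfrak{k}$ is the product Courant algebroid. Dirac structure: lagrangian subbundle whose sections are closed under the bracket. A quasi-symplectic groupoid is a Lie groupoid $\mathcal{G}\rightrightarrows M$ with $\omega\in\Omega^2(\mathcal{G})$, $\eta\in\Omega^3(M)$ such that $\mathtt{m}^*\omega=\mathrm{pr}_1^*\omega+\mathrm{pr}_2^*\omega$, $d\omega=\mathtt{s}^*\eta-\mathtt{t}^*\eta$, $d\eta=0$, $\dim\mathcal{G}=2\dim M$, and $\ker(T\mathtt{s})_x\cap\ker(\omega)_x\cap\ker(T\mathtt{t})_x=0$ for $x\in M$. It integrates the $\eta$-twisted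 Dirac structure $(\mathtt{a}_{\mathcal{G}},\lambda_\omega)(A_{\mathcal{G}})\subset\mathbb{T}_\eta M$. $\mathcal{H}_1\times_K\mathcal{H}_2=\{(h_1,h_2):\Phi_1(h_1)=\Phi_2(h_2)\}$ with componentwise groupoid structure. *)

(* Defs.v *)
From HB Require Import structures.
From mathcomp Require Import all_boot all_order all_algebra.
From mathcomp Require Import mathcomp_extra boolp classical_sets functions.
From mathcomp Require Import reals topology normedtype derive.

Set Implicit Arguments.
Unset Strict Implicit.
Unset Printing Implicit Defensive.

Import Order.TTheory GRing.Theory Num.Theory.
Import numFieldNormedType.Exports.

Local Open Scope classical_set_scope.
Local Open Scope ring_scope.

(******************************************************************************)
(* Smooth structures are handled through their algebras of smooth functions.  *)
(* A [space] is a type with a distinguished set of real functions; it is a    *)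
(* manifold when these are the smooth functions of a smooth atlas.  Products  *)
(* and subsets carry the induced structure (for an embedded submanifold this  *)
(* is the submanifold structure).  Tangent vectors are derivations, so that   *)
(* tangent maps and Lie brackets need no charts.                              *)
(******************************************************************************)

Section SmoothSpaces.
Variable R : realType.

Fixpoint Ck (k n : nat) (V : set 'rV[R]_n) (F : 'rV[R]_n -> R) : Prop :=
  (forall x, V x -> {for x, continuous F}) /\
  if k is k'.+1 then
    forall i : 'I_n, (forall x, V x -> derivable F x (delta_mx 0 i)) /\
      Ck k' V (fun x => 'D_(delta_mx 0 i) F x)
  else True.

Definition smooth_on (n : nat) (V : set 'rV[R]_n) (F : 'rV[R]_n -> R) : Prop :=
  forall k, Ck k V F.

Record space := Space { car :> Type; smooth : set (car -> R) }.

Definition smooth_map (M N : space) (f : M -> N) : Prop :=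
  forall g : N -> R, smooth g -> smooth (fun x : M => g (f x)).

(* The differential structure generated by G: functions that are locally      *)
(* smooth functions of finitely many elements of G.                           *)
Definition gen_smooth (X : Type) (G : set (X -> R)) : set (X -> R) :=
  fun g => forall p : X, exists (k : nat) (f : 'I_k -> X -> R)
      (V : set 'rV[R]_k) (F : 'rV[R]_k -> R),
    [/\ forall i, G (f i), open V, V (\row_i f i p), smooth_on V F &
        forall q, V (\row_i f i q) -> g q = F (\row_i f i q)].

Definition prod_space (M N : space) : space :=
  @Space (M * N)%type (gen_smooth (fun g =>
    (exists2 f : M -> R, smooth f & g = (fun x => f x.1)) \/
    (exists2 f : N -> R, smooth f & g = (fun x => f x.2)))).

Definition sub_space (M : space) (P : M -> Prop) : space :=
  @Space {x : M | P x} (gen_smooth (fun g =>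
    exists2 f : M -> R, smooth f & g = (fun x => f (sval x)))).

Record chart (n : nat) (M : Type) := Chart {
  cdom : set M;
  cmap : M -> 'rV[R]_n;
  cinv : 'rV[R]_n -> M }.

Definition cimg n M (c : chart n M) : set 'rV[R]_n := cmap c @` cdom c.

Record smooth_atlas n M (A : set (chart n M)) : Prop := SmoothAtlas {
  atlas_cover : forall p : M, exists2 c, A c & cdom c p;
  atlas_open : forall c, A c -> open (cimg c);
  atlas_inv : forall c, A c -> forall p, cdom c p -> cinv c (cmap c p) = p;
  atlas_overlap : forall c d, A c -> A d ->
    open (cmap c @` (cdom c `&` cdom d));
  atlas_transition : forall c d, A c -> A d -> forall j : 'I_n,
    smooth_on (cmap c @` (cdom c `&` cdom d)) (fun x => cmap d (cinv c x) 0 j) }.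

Definition atlas_topology n M (A : set (chart n M)) : set (set M) :=
  fun U => forall c, A c -> open (cmap c @` (U `&` cdom c)).

Definition manifold (n : nat) (M : space) : Prop :=
  exists A : set (chart n M),
  [/\ smooth_atlas A,
      forall p q : M, p <> q -> exists U W,
        [/\ atlas_topology A U, atlas_topology A W, U p, W q &
            U `&` W = set0],
      exists B : nat -> set M, (forall i, atlas_topology A (B i)) /\
        forall U p, atlas_topology A U -> U p -> exists2 i, B i p & B i `<=` U &
      forall f : M -> R,
        smooth f <-> forall c, A c -> smooth_on (cimg c) (fun x => f (cinv c x))].

Definition vec (M : space) : Type := (M -> R) -> R.

Definition vec0 (M : space) : vec M := fun _ => 0.

Definition comb (M : space) (a : R) (u v : vec M) : vec M :=
  fun f => a * u f + v f.

(* Vanishing on non-smooth functions is a normalisation: it makes equality of *)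
(* derivations of the algebra of smooth functions coincide with [=].          *)
Record tangent (M : space) (p : M) (v : vec M) : Prop := Tangent {
  tangent_junk : forall f, ~ smooth f -> v f = 0;
  tangent_lin : forall a f g, smooth f -> smooth g ->
    v (fun x => a * f x + g x) = a * v f + v g;
  tangent_leibniz : forall f g, smooth f -> smooth g ->
    v (fun x => f x * g x) = f p * v g + v f * g p }.

(* The tangent map; the base point is not needed.                             *)
Definition push (M N : space) (f : M -> N) (v : vec M) : vec N :=
  fun g => if `[< smooth g >] then v (fun x => g (f x)) else 0.

Definition submersion (M N : space) (f : M -> N) : Prop :=
  forall (p : M) (w : vec N), tangent (f p) w ->
    exists2 u : vec M, tangent p u & push f u = w.

Definition transverse (M1 M2 N : space) (f1 : M1 -> N) (f2 : M2 -> N) : Prop :=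
  forall (p1 : M1) (p2 : M2), f1 p1 = f2 p2 ->
  forall w : vec N, tangent (f1 p1) w ->
    exists (u1 : vec M1) (u2 : vec M2),
      [/\ tangent p1 u1, tangent p2 u2 & w = comb 1 (push f1 u1) (push f2 u2)].

Record vfield (M : space) (X : M -> vec M) : Prop := VField {
  vfield_tangent : forall p, tangent p (X p);
  vfield_smooth : forall f, smooth f -> smooth (fun p => X p f) }.

Definition lie (M : space) (X Y : M -> vec M) : M -> vec M :=
  fun p f => X p (fun q => Y q f) - Y p (fun q => X q f).

(******************************************************************************)
(* Covectors and differential forms.  Only their values on vectors tangent at *)
(* the base point are meaningful, and all predicates below depend only on     *)
(* these values.  Linearity in the first argument and alternation give full   *)
(* multilinearity.                                                            *)
(******************************************************************************)

Definition covec (M : space) : Type := vec M -> R.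

Definition covector (M : space) (p : M) (a : covec M) : Prop :=
  forall c u v, tangent p u -> tangent p v ->
    a (comb c u v) = c * a u + a v.

Record form1 (M : space) (a : M -> covec M) : Prop := Form1 {
  form1_covector : forall p, covector p (a p);
  form1_smooth : forall X, vfield X -> smooth (fun p => a p (X p)) }.

Record form2 (M : space) (s : M -> vec M -> vec M -> R) : Prop := Form2 {
  form2_lin : forall p c u v w, tangent p u -> tangent p v -> tangent p w ->
    s p (comb c u v) w = c * s p u w + s p v w;
  form2_alt : forall p u, tangent p u -> s p u u = 0;
  form2_smooth : forall X Y, vfield X -> vfield Y ->
    smooth (fun p => s p (X p) (Y p)) }.

Record form3 (M : space) (h : M -> vec M -> vec M -> vec M -> R) : Prop := Form3 {
  form3_lin : forall p c u v w z,
    tangent p u -> tangent p v -> tangent p w -> tangent p z ->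
    h p (comb c u v) w z = c * h p u w z + h p v w z;
  form3_altl : forall p u v, tangent p u -> tangent p v -> h p u u v = 0;
  form3_altr : forall p u v, tangent p u -> tangent p v -> h p u v v = 0;
  form3_smooth : forall X Y Z, vfield X -> vfield Y -> vfield Z ->
    smooth (fun p => h p (X p) (Y p) (Z p)) }.

Definition pull2 (M N : space) (f : M -> N) (s : N -> vec N -> vec N -> R) :
    M -> vec M -> vec M -> R :=
  fun p u v => s (f p) (push f u) (push f v).

Definition pull3 (M N : space) (f : M -> N)
    (h : N -> vec N -> vec N -> vec N -> R) : M -> vec M -> vec M -> vec M -> R :=
  fun p u v w => h (f p) (push f u) (push f v) (push f w).

Definition zero2 (M : space) (s : M -> vec M -> vec M -> R) : Prop :=
  forall p u v, tangent p u -> tangent p v -> s p u v = 0.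

Definition d1 (M : space) (a : M -> covec M) (X Y : M -> vec M) (p : M) : R :=
  X p (fun q => a q (Y q)) - Y p (fun q => a q (X q)) - a p (lie X Y p).

Definition d2 (M : space) (s : M -> vec M -> vec M -> R)
    (X Y Z : M -> vec M) (p : M) : R :=
  X p (fun q => s q (Y q) (Z q)) - Y p (fun q => s q (X q) (Z q))
  + Z p (fun q => s q (X q) (Y q))
  - s p (lie X Y p) (Z p) + s p (lie X Z p) (Y p) - s p (lie Y Z p) (X p).

Definition d3 (M : space) (h : M -> vec M -> vec M -> vec M -> R)
    (X Y Z W : M -> vec M) (p : M) : R :=
  X p (fun q => h q (Y q) (Z q) (W q)) - Y p (fun q => h q (X q) (Z q) (W q))
  + Z p (fun q => h q (X q) (Y q) (W q)) - W p (fun q => h q (X q) (Y q) (Z q))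
  - h p (lie X Y p) (Z p) (W p) + h p (lie X Z p) (Y p) (W p)
  - h p (lie X W p) (Y p) (Z p) - h p (lie Y Z p) (X p) (W p)
  + h p (lie Y W p) (X p) (Z p) - h p (lie Z W p) (X p) (Y p).

Definition closed_form3 (M : space) (h : M -> vec M -> vec M -> vec M -> R) :
    Prop :=
  form3 h /\ forall X Y Z W, vfield X -> vfield Y -> vfield Z -> vfield W ->
    forall p, d3 h X Y Z W p = 0.

(******************************************************************************)
(* The Courant algebroid TM + T*M twisted by a closed 3-form, and its Dirac   *)
(* structures.  A family of subsets of the fibres is a predicate E, where     *)
(* [E p X a] means X + a \in E_p.                                             *)
(******************************************************************************)

Definition bigtangent (M : space) (p : M) (X : vec M) (a : covec M) : Prop :=
  tangent p X /\ covector p a.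

Definition bigsection (M : space) (X : M -> vec M) (a : M -> covec M) : Prop :=
  vfield X /\ form1 a.

(* E is locally spanned by r pointwise independent smooth sections e_j = (X_j,*)
(* a_j).  On a manifold the sets {h <> 0} with h smooth form a basis of the   *)
(* topology, and requiring the e_j to be defined on all of M is no            *)
(* restriction since they need to lie in E only near p.                       *)
Definition subbundle (M : space) (E : M -> vec M -> covec M -> Prop) : Prop :=
  exists r : nat, forall p : M,
  exists (h : M -> R) (X : 'I_r -> M -> vec M) (a : 'I_r -> M -> covec M),
  [/\ smooth h, h p <> 0, forall j, bigsection (X j) (a j) &
    forall q, h q <> 0 ->
      (forall c : 'I_r -> R,
         (forall f, \sum_j c j * X j q f = 0) ->
         (forall v, tangent q v -> \sum_j c j * a j q v = 0) ->
         forall j, c j = 0) /\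
      forall Y b, E q Y b <->
        exists c : 'I_r -> R,
          Y = (fun f => \sum_j c j * X j q f) /\
          forall v, tangent q v -> b v = \sum_j c j * a j q v].

Definition lagrangian (M : space) (E : M -> vec M -> covec M -> Prop) : Prop :=
  forall p X a, E p X a <->
    bigtangent p X a /\ forall Y b, E p Y b -> a Y + b X = 0.

(* g is the T*M-component L_X b - i_Y da + i_Y i_X h of the bracket of X + a  *)
(* and Y + b, whose TM-component is [X, Y].                                   *)
Definition courant_form (M : space) (h : M -> vec M -> vec M -> vec M -> R)
    (X : M -> vec M) (a : M -> covec M) (Y : M -> vec M) (b : M -> covec M)
    (g : M -> covec M) : Prop :=
  form1 g /\ forall Z, vfield Z -> forall p,
    g p (Z p) = (X p (fun q => b q (Z q)) - b p (lie X Z p))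
                - d1 a Y Z p + h p (X p) (Y p) (Z p).

Definition dirac (M : space) (h : M -> vec M -> vec M -> vec M -> R)
    (E : M -> vec M -> covec M -> Prop) : Prop :=
  [/\ closed_form3 h, subbundle E, lagrangian E &
    forall X a Y b, bigsection X a -> bigsection Y b ->
      (forall p, E p (X p) (a p)) -> (forall p, E p (Y p) (b p)) ->
      exists2 g, courant_form h X a Y b g &
        forall p, E p (lie X Y p) (g p)].

Record groupoid := Groupoid {
  arr : space;
  obj : space;
  gs : arr -> obj;
  gt : arr -> obj;
  gunit : obj -> arr;
  ginv : arr -> arr;
  gmul : forall g h : arr, gs g = gt h -> arr;
  gs_unit : forall x, gs (gunit x) = x;
  gt_unit : forall x, gt (gunit x) = x;
  gs_inv : forall g, gs (ginv g) = gt g;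
  gt_inv : forall g, gt (ginv g) = gs g;
  gs_mul : forall g h (e : gs g = gt h), gs (gmul e) = gs h;
  gt_mul : forall g h (e : gs g = gt h), gt (gmul e) = gt g;
  gmulA : forall g h k (e1 : gs h = gt k) (e2 : gs g = gt (gmul e1))
      (e3 : gs g = gt h) (e4 : gs (gmul e3) = gt k),
    gmul e2 = gmul e4;
  gmul1 : forall g (e : gs (gunit (gt g)) = gt g), gmul e = g;
  gmulr1 : forall g (e : gs g = gt (gunit (gs g))), gmul e = g;
  gmulV : forall g (e : gs (ginv g) = gt g), gmul e = gunit (gs g);
  gmulrV : forall g (e : gs g = gt (ginv g)), gmul e = gunit (gt g) }.

Definition comp_space (G : groupoid) : space :=
  sub_space (fun x : prod_space (arr G) (arr G) => gs x.1 = gt x.2).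

Definition comp_pr1 (G : groupoid) (x : comp_space G) : arr G := (sval x).1.
Definition comp_pr2 (G : groupoid) (x : comp_space G) : arr G := (sval x).2.
Definition comp_mul (G : groupoid) (x : comp_space G) : arr G :=
  gmul (svalP x).

Record lie_groupoid (m n : nat) (G : groupoid) : Prop := LieGroupoid {
  lie_arr : manifold m (arr G);
  lie_obj : manifold n (obj G);
  lie_gs : smooth_map (@gs G);
  lie_gt : smooth_map (@gt G);
  lie_gunit : smooth_map (@gunit G);
  lie_ginv : smooth_map (@ginv G);
  lie_gmul : smooth_map (@comp_mul G);
  lie_gs_subm : submersion (@gs G);
  lie_gt_subm : submersion (@gt G) }.

Record algebroid (G : groupoid) (x : obj G) (u : vec (arr G)) : Prop := Algebroid {
  algebroid_tangent : tangent (gunit x) u;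
  algebroid_ker : push (@gs G) u = @vec0 (obj G) }.

Definition lambda (G : groupoid) (s : arr G -> vec (arr G) -> vec (arr G) -> R)
    (x : obj G) (u : vec (arr G)) : covec (obj G) :=
  fun v => s (gunit x) u (push (@gunit G) v).

Record quasi_symplectic (G : groupoid)
    (w : arr G -> vec (arr G) -> vec (arr G) -> R)
    (h : obj G -> vec (obj G) -> vec (obj G) -> vec (obj G) -> R) : Prop :=
  QuasiSymplectic {
  qs_lie : exists m n : nat, lie_groupoid m n G /\ m = (2 * n)%N;
  qs_form : form2 w;
  qs_closed : closed_form3 h;
  qs_mul : zero2 (fun (x : comp_space G) u v =>
    pull2 (@comp_mul G) w x u v -
    (pull2 (@comp_pr1 G) w x u v + pull2 (@comp_pr2 G) w x u v));
  qs_d : forall X Y Z, vfield X -> vfield Y -> vfield Z -> forall g,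
    d2 w X Y Z g =
      pull3 (@gs G) h g (X g) (Y g) (Z g) - pull3 (@gt G) h g (X g) (Y g) (Z g);
  qs_ker : forall (x : obj G) u, tangent (gunit x) u ->
    push (@gs G) u = @vec0 (obj G) ->
    (forall v, tangent (gunit x) v -> w (gunit x) u v = 0) ->
    push (@gt G) u = @vec0 (obj G) -> u = @vec0 (arr G) }.

Definition integrates (G : groupoid)
    (w : arr G -> vec (arr G) -> vec (arr G) -> R)
    (E : obj G -> vec (obj G) -> covec (obj G) -> Prop) : Prop :=
  forall x X a, E x X a <->
    exists2 u, algebroid x u &
      X = push (@gt G) u /\ forall v, tangent x v -> a v = lambda w x u v.

Record sgroup := SGroup { sg_car :> groupType; sg_smooth : set (sg_car -> R) }.

Definition sgs (K : sgroup) : space := Space (@sg_smooth K).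

Definition lie_group (n : nat) (K : sgroup) : Prop :=
  [/\ manifold n (sgs K),
      @smooth_map (prod_space (sgs K) (sgs K)) (sgs K)
        (fun x : K * K => x.1 * x.2)%g &
      @smooth_map (sgs K) (sgs K) (fun x : K => x^-1)%g].

Section TwoShifted.
Variable K : sgroup.
Local Notation K1 := (sgs K).
Local Notation K2 := (prod_space K1 K1).
Local Notation K3 := (prod_space K2 K1).
Variables (Omega : K2 -> vec K2 -> vec K2 -> R)
          (Theta : K1 -> vec K1 -> vec K1 -> vec K1 -> R).

Definition one_K : K1 := (1%g : K).
Definition inl_K (k : K1) : K2 := (k, one_K).
Definition inr_K (k : K1) : K2 := (one_K, k).
Definition mul_K (x : K2) : K1 := ((x.1 : K) * (x.2 : K))%g.
Definition pr1_K (x : K2) : K1 := x.1.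
Definition pr2_K (x : K2) : K1 := x.2.

Definition delta_Omega (x : K3) (u v : vec K3) : R :=
  @pull2 K3 K2 (fun y => (y.1.2, y.2)) Omega x u v
  - @pull2 K3 K2 (fun y => (mul_K y.1, y.2)) Omega x u v
  + @pull2 K3 K2 (fun y => (y.1.1, mul_K (y.1.2, y.2))) Omega x u v
  - @pull2 K3 K2 (fun y => y.1) Omega x u v.

Definition pairing (u v : vec K1) : R :=
  - Omega (one_K, one_K) (push inl_K u) (push inr_K v)
  + Omega (one_K, one_K) (push inr_K u) (push inl_K v).

Record two_shifted (n : nat) : Prop := TwoShifted {
  ts_lie : lie_group n K;
  ts_Omega : form2 Omega;
  ts_Theta : closed_form3 Theta;
  ts_unitr : zero2 (pull2 inr_K Omega);
  ts_unitl : zero2 (pull2 inl_K Omega);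
  ts_delta_Omega : zero2 delta_Omega;
  ts_delta_Theta : forall X Y Z, vfield X -> vfield Y -> vfield Z -> forall x,
    pull3 pr1_K Theta x (X x) (Y x) (Z x) + pull3 pr2_K Theta x (X x) (Y x) (Z x)
    - pull3 mul_K Theta x (X x) (Y x) (Z x) = - d2 Omega X Y Z x;
  ts_nondeg : forall u, tangent one_K u ->
    (forall v, tangent one_K v -> pairing u v = 0) -> u = @vec0 K1 }.

Definition functor (H : groupoid) (Phi : arr H -> K1) : Prop :=
  forall g h (e : gs g = gt h), Phi (gmul e) = mul_K (Phi g, Phi h).

Record lagrangian_morphism (k : nat) (H : groupoid) (m n : nat)
    (Phi : arr H -> K1) (s : arr H -> vec (arr H) -> vec (arr H) -> R)
    (h : obj H -> vec (obj H) -> vec (obj H) -> vec (obj H) -> R) : Prop :=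
  LagrangianMorphism {
  lag_functor : functor Phi;
  lag_lie : lie_groupoid m n H;
  lag_smooth : smooth_map Phi;
  lag_form : form2 s;
  lag_unit : zero2 (pull2 (@gunit H) s);
  lag_closed : closed_form3 h;
  lag_mul : forall (x : comp_space H) u v, tangent x u -> tangent x v ->
    pull2 (@comp_pr1 H) s x u v + pull2 (@comp_pr2 H) s x u v
    - pull2 (@comp_mul H) s x u v =
    @pull2 (comp_space H) K2
      (fun y => (Phi (comp_pr1 y), Phi (comp_pr2 y))) Omega x u v;
  lag_d : forall X Y Z, vfield X -> vfield Y -> vfield Z -> forall g,
    pull3 (@gs H) h g (X g) (Y g) (Z g) - pull3 (@gt H) h g (X g) (Y g) (Z g)
    - d2 s X Y Z g = pull3 Phi Theta g (X g) (Y g) (Z g);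
  lag_dim : m%:R - 2 * n%:R = k%:R / 2 :> R;
  lag_ker : forall g u, tangent g u ->
    (forall v, tangent g v -> s g u v = 0) ->
    push Phi u = @vec0 K1 ->
    push (@gs H) u = @vec0 (obj H) ->
    push (@gt H) u = @vec0 (obj H) -> u = @vec0 (arr H) }.

(* [morphism_dirac x X a k] : (X, a, k) lies in the fibre at x of             *)
(* (a_H, lambda_s, Lie Phi)(A_H), a subset of T_xN + T*_xN + T_1K.            *)
Definition morphism_dirac (H : groupoid) (Phi : arr H -> K1)
    (s : arr H -> vec (arr H) -> vec (arr H) -> R)
    (x : obj H) (X : vec (obj H)) (a : covec (obj H)) (k : vec K1) : Prop :=
  exists2 u, algebroid x u &
    [/\ X = push (@gt H) u,
        forall v, tangent x v -> a v = lambda s x u v &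
        k = push Phi u].

Section FibreProduct.
Variables (H1 H2 : groupoid) (Phi1 : arr H1 -> K1) (Phi2 : arr H2 -> K1).
Local Notation N := (prod_space (obj H1) (obj H2)).

Definition composed_dirac
    (L1 : obj H1 -> vec (obj H1) -> covec (obj H1) -> vec K1 -> Prop)
    (L2 : obj H2 -> vec (obj H2) -> covec (obj H2) -> vec K1 -> Prop)
    (x : N) (X : vec N) (a : covec N) : Prop :=
  tangent x X /\
  exists (a1 : covec (obj H1)) (a2 : covec (obj H2)),
    [/\ covector x.1 a1, covector x.2 a2,
      forall v, tangent x v ->
        a v = a1 (@push N (obj H1) fst v) + a2 (@push N (obj H2) snd v) &
      exists k : vec K1, [/\ tangent one_K k,
        L1 x.1 (@push N (obj H1) fst X) a1 k &
        L2 x.2 (@push N (obj H2) snd X) (fun v => - a2 v) k]].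

Definition eta_diff
    (h1 : obj H1 -> vec (obj H1) -> vec (obj H1) -> vec (obj H1) -> R)
    (h2 : obj H2 -> vec (obj H2) -> vec (obj H2) -> vec (obj H2) -> R) :
    N -> vec N -> vec N -> vec N -> R :=
  fun x u v w => @pull3 N (obj H1) fst h1 x u v w
                 - @pull3 N (obj H2) snd h2 x u v w.

Definition fib_arr : space :=
  sub_space (fun x : prod_space (arr H1) (arr H2) => Phi1 x.1 = Phi2 x.2).

Definition fib_pr1 (x : fib_arr) : arr H1 := (sval x).1.
Definition fib_pr2 (x : fib_arr) : arr H2 := (sval x).2.

Definition sigma_diff (s1 : arr H1 -> vec (arr H1) -> vec (arr H1) -> R)
    (s2 : arr H2 -> vec (arr H2) -> vec (arr H2) -> R) :
    fib_arr -> vec fib_arr -> vec fib_arr -> R :=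
  fun x u v => pull2 fib_pr1 s1 x u v - pull2 fib_pr2 s2 x u v.

Definition fib_gs (x : fib_arr) : N := (gs (fib_pr1 x), gs (fib_pr2 x)).
Definition fib_gt (x : fib_arr) : N := (gt (fib_pr1 x), gt (fib_pr2 x)).

Lemma functor_unit (H : groupoid) (Phi : arr H -> K1) (x : obj H) :
  functor Phi -> Phi (gunit x) = one_K.
Proof.
move=> F; have e : gs (gunit x) = gt (gunit x) by rewrite gs_unit gt_unit.
have E : gmul e = gunit x.
  have aux g y (ey : y = gs g) (ef : gs g = gt (gunit y)) : gmul ef = g.
    by subst y; apply: gmulr1.
  by apply: aux; rewrite gs_unit.
have := F _ _ e; rewrite E /mul_K /= => Hm.
apply: (@mulgI _ (Phi (gunit x) : K)).
by rewrite mulg1 -[LHS]Hm.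
Qed.

Lemma functor_inv (H : groupoid) (Phi : arr H -> K1) (g : arr H) :
  functor Phi -> Phi (ginv g) = ((Phi g : K)^-1)%g.
Proof.
move=> F; have e : gs (ginv g) = gt g by rewrite gs_inv.
have := F _ _ e; rewrite gmulV functor_unit // /mul_K /= => Hm.
by apply: (@mulIg _ (Phi g : K)); rewrite mulVg -Hm.
Qed.

Hypotheses (F1 : functor Phi1) (F2 : functor Phi2).

Lemma fib_unit_subproof (x : N) :
  Phi1 (gunit x.1) = Phi2 (gunit x.2).
Proof. by rewrite !functor_unit. Qed.

Lemma fib_inv_subproof (x : fib_arr) :
  Phi1 (ginv (fib_pr1 x)) = Phi2 (ginv (fib_pr2 x)).
Proof. by rewrite !functor_inv // (svalP x). Qed.

Lemma fib_mul_subproof (x y : fib_arr) (e : fib_gs x = fib_gt y) :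
  Phi1 (gmul (f_equal fst e)) = Phi2 (gmul (f_equal snd e)).
Proof.
by rewrite F1 F2 (svalP x) (svalP y).
Qed.

Definition fib_unit (x : N) : fib_arr :=
  exist _ (gunit x.1, gunit x.2) (fib_unit_subproof x).

Definition fib_inv (x : fib_arr) : fib_arr :=
  exist _ (ginv (fib_pr1 x), ginv (fib_pr2 x)) (fib_inv_subproof x).

Definition fib_mul (x y : fib_arr) (e : fib_gs x = fib_gt y) : fib_arr :=
  exist _ (gmul (f_equal fst e), gmul (f_equal snd e)) (fib_mul_subproof e).

Lemma fib_eq (x y : fib_arr) :
  fib_pr1 x = fib_pr1 y -> fib_pr2 x = fib_pr2 y -> x = y.
Proof.
move=> e1 e2; apply: eq_sig_hprop => [? ? ?|]; first exact: Prop_irrelevance.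
by move: e1 e2; rewrite /fib_pr1 /fib_pr2; case: (sval x) (sval y)
  => [? ?] [? ?] /= -> ->.
Qed.

Definition fibre_groupoid : groupoid.
Proof.
apply: (@Groupoid fib_arr N fib_gs fib_gt fib_unit fib_inv fib_mul).
- by case=> x y; rewrite /fib_gs /= !gs_unit.
- by case=> x y; rewrite /fib_gt /= !gt_unit.
- by move=> x; rewrite /fib_gs /= !gs_inv.
- by move=> x; rewrite /fib_gt /= !gt_inv.
- by move=> x y e; rewrite /fib_gs /= !gs_mul.
- by move=> x y e; rewrite /fib_gt /= !gt_mul.
- by move=> x y z e1 e2 e3 e4; apply: fib_eq; apply: gmulA.
- by move=> x e; apply: fib_eq; apply: gmul1.
- by move=> x e; apply: fib_eq; apply: gmulr1.
- by move=> x e; apply: fib_eq; apply: gmulV.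
- by move=> x e; apply: fib_eq; apply: gmulrV.
Defined.

End FibreProduct.
End TwoShifted.
End SmoothSpaces.

(* Main.v *)
(* Evaluating the multiplicativity of sigma on (u, 0) and (eps_* t_* v, v) over the
   pair (1_x, 1_x) gives, for u in the Lie algebroid and v tangent at 1_x,
     sigma(u, v) = lambda(u)(t_* v) - Omega((Phi u, 0), (0, Phi v)).
   Alternation then yields lambda(u)(t_* v) + lambda(v)(t_* u) = - <Phi u, Phi v>.
   On the fibre product the Omega-terms cancel.  A vector u = (u1, u2) in the kernel of
   all the data has <Phi u1, .> = 0 on the images of both algebroids, which span the Lie
   algebra by transversality at the units; so Phi u1 = 0 and the lagrangian condition on
   each factor gives u = 0.  Right translation reduces submersivity of the source map to
   the same transversality at units, and dim K is the sum of the two defects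
   dim H_i - 2 dim N_i, which gives the dimension.

   Part (a) follows from (b), because the image of (t_*, lambda) of any quasi-symplectic
   groupoid is a Dirac structure: it is isotropic by the identity above, of rank n by
   nondegeneracy, hence lagrangian; and for right-invariant fields R1, R2 one has
   w(R_i, v) = a_i(t_* v), so that dw = s^*eta - t^*eta becomes the formula for the
   Courant bracket.

   Since manifolds are given by their algebras of smooth functions, all of this is made
   local by bump functions: a manifold is a space with global functions and vector
   fields that restrict to coordinates and coordinate fields near any given point. *)
From HB Require Import structures.
From mathcomp Require Import all_boot all_order all_algebra.
From mathcomp Require Import boolp classical_sets functions reals.
From mathcomp Require Import interval_inference topology normedtype landau.
From mathcomp Require Import ereal sequences derive realfun exp measure.
From mathcomp Require Import lebesgue_measure lebesgue_integral ftc.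
From mathcomp Require Import ring lra.
Require Import Defs.

Set Implicit Arguments.
Unset Strict Implicit.
Unset Printing Implicit Defensive.
Import Order.TTheory GRing.Theory Num.Theory.
Import numFieldNormedType.Exports.
Local Open Scope classical_set_scope.
Local Open Scope ring_scope.

(** * Calculus of several variables *)

(** The form of the definitions shapes much of the work. A 2-form is only required to be linear in
    its first slot and zero on the diagonal, which at a point does not imply bilinearity. This is
    recovered from the hypotheses: [Omega] and the sigma_i have exterior derivatives prescribed by
    pullbacks of 3-forms, hence depending only on the values of the vector fields at a point;
    replacing a field Y by Y + f W, with f zero at that point, then forces antisymmetry. Closedness
    does the same for 3-forms. Tangent vectors are derivations, and products and subsets carry
    generated algebras of functions. A derivation is controlled by its values on generators, which
    rests on Hadamard's lemma; charts on fibre products come from the inverse function theorem.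
    Involutivity concerns arbitrary smooth sections of the Dirac structure, which must be lifted to
    smooth sections of the Lie algebroid. The lift is unique fibrewise, and its coefficients in a
    local frame solve a linear system of full rank. Adjugates replace inverse matrices there, so
    that the functions obtained are globally smooth. *)

Section RowVectors.
Variable R : realType.

Lemma rV_coord_le n (x : 'rV[R]_n) i : `|x 0 i| <= `|x|.
Proof.
rewrite [leRHS]/Num.Def.normr /= mx_normrE.
exact: (le_bigmax _ (fun ij : 'I_1 * 'I_n => `|x ij.1 ij.2|) (0, i)).
Qed.

Lemma rV_norm_le n (x : 'rV[R]_n) (M : R) :
  0 <= M -> (forall i, `|x 0 i| <= M) -> `|x| <= M.
Proof.
move=> M0 h; rewrite [leLHS]/Num.Def.normr /= mx_normrE.
by apply/bigmax_leP; split => // -[i j] _ /=; rewrite (ord1 i).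
Qed.

Lemma rV_ballP n (x y : 'rV[R]_n) (r : R) : ball x r y <-> `|y - x| < r.
Proof. by rewrite -ball_normE /ball_ /= distrC. Qed.

Lemma rV_open_ball n (V : set 'rV[R]_n) x : open V -> V x ->
  exists2 r : R, 0 < r & forall y, `|y - x| < r -> V y.
Proof.
move=> oV Vx; have /nbhs_ballP [r /= r0 sV] := open_nbhs_nbhs (conj oV Vx).
by exists r => // y yr; apply: sV; apply/rV_ballP.
Qed.

Lemma rV_openP n (V : set 'rV[R]_n) :
  (forall x, V x -> exists2 r : R, 0 < r & forall y, `|y - x| < r -> V y) ->
  open V.
Proof.
move=> h; rewrite openE => x /h [r r0 hr]; rewrite /interior /=.
by apply/nbhs_ballP; exists r => //= y /rV_ballP; apply: hr.
Qed.

Lemma sum_continuous_at (T : topologicalType) (I : Type) (r : seq I)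
  (f : I -> T -> R) (x : T) :
  (forall i, {for x, continuous (f i)}) ->
  {for x, continuous (fun y => \sum_(i <- r) f i y)}.
Proof.
move=> cf; elim: r => [|i r IH].
  rewrite (_ : (fun _ => _) = cst 0); last by apply: funext => y; rewrite big_nil.
  exact: cst_continuous.
rewrite (_ : (fun _ => _) = f i \+ (fun y => \sum_(i <- r) f i y)).
  exact: continuousD.
by apply: funext => y; rewrite big_cons.
Qed.

Lemma norm_between (a b s c : R) : Num.min a b <= s -> s <= Num.max a b ->
  `|s - c| <= Num.max `|a - c| `|b - c|.
Proof.
move=> h1 h2; rewrite ler_norml; apply/andP; split.
  rewrite lerNl opprB [`|a - c|]distrC [`|b - c|]distrC.
  move: h1; rewrite ge_min => /orP[] h; rewrite le_max.
    by rewrite (le_trans _ (ler_norm _)) // lerD2l lerN2.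
  by rewrite [X in _ || X](le_trans _ (ler_norm _)) ?orbT // lerD2l lerN2.
move: h2; rewrite le_max => /orP[] h; rewrite le_max.
  by rewrite (le_trans _ (ler_norm _)) // lerD2r.
by rewrite [X in _ || X](le_trans _ (ler_norm _)) ?orbT // lerD2r.
Qed.

Lemma line_derive n (F : 'rV[R]_n -> R) (z v : 'rV[R]_n) (t : R) :
  derivable F (z + t *: v) v ->
  is_derive t 1 (fun s : R => F (z + s *: v)) ('D_v F (z + t *: v)).
Proof.
have E : (fun h : R => h^-1 *: ((F \o shift (z + t *: v)) (h *: v)
              - F (z + t *: v))) =
         (fun h : R => h^-1 *: (((fun s : R => F (z + s *: v)) \o shift t) (h *: 1)
              - F (z + t *: v))).
  apply: funext => h /=; congr (_ *: (F _ - _)).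
  by rewrite [h *: 1]mulr1 scalerDl addrCA.
by move=> dF; split; rewrite /derivable /derive -E.
Qed.

Lemma mvt_abs (g g' : R -> R) (a b M : R) :
  (forall s, Num.min a b <= s <= Num.max a b -> is_derive s 1 g (g' s)) ->
  (forall s, Num.min a b <= s <= Num.max a b -> `|g' s| <= M) ->
  `|g b - g a| <= M * `|b - a|.
Proof.
wlog ab : a b / a <= b.
  move=> W; case/orP: (le_total a b) => [/W//|ba].
  rewrite minC maxC distrC [X in _ * X]distrC.
  by move=> h1 h2; apply: W.
rewrite min_l // max_r // => dg bg.
have [||c cab ->] := MVT_segment (f := g) (df := g') ab.
- move=> x; rewrite in_itv /= => /andP[h1 h2]; apply: dg; by rewrite !ltW.
- apply: derivable_within_continuous => x; rewrite in_itv /= => /dg h.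
  exact: ex_derive.
- by rewrite normrM ler_wpM2r // bg //; move: cab; rewrite in_itv.
Qed.

(** Pass from y to x by changing one coordinate at a time and use the one-variable mean value
    theorem on each segment. The norm is the maximum of the coordinates, so the intermediate points
    stay in the ball. *)
Lemma partials_lipschitz n (F : 'rV[R]_n -> R) (x0 : 'rV[R]_n) (r M : R) :
  (forall x, `|x - x0| < r -> forall i, derivable F x (delta_mx 0 i)) ->
  (forall x, `|x - x0| < r -> forall i, `|'D_(delta_mx 0 i) F x| <= M) ->
  forall x y, `|x - x0| < r -> `|y - x0| < r ->
    `|F x - F y| <= n%:R * M * `|x - y|.
Proof.
move=> dF bF x y xr yr.
have r0 : 0 < r by apply: le_lt_trans xr.
pose w (k : nat) : 'rV[R]_n := \row_j (if (j < k)%N then x 0 j else y 0 j).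
have -> : F x - F y = \sum_(0 <= k < n) (F (w k.+1) - F (w k)).
  rewrite telescope_sumr //; congr (F _ - F _); apply/rowP => j; rewrite mxE //.
  by rewrite ltn_ord.
have -> : n%:R * M * `|x - y| = \sum_(0 <= k < n) (M * `|x - y|).
  by rewrite sumr_const_nat subn0 -mulrA mulr_natl.
rewrite !big_mkord; apply: (le_trans (ler_norm_sum _ _ _)); apply: ler_sum => k _.
(* [w k] with its k-th coordinate set to zero: both [w k] and [w k.+1] lie on the line through z in
   the k-th direction. *)
pose z : 'rV[R]_n := \row_j (if j == k then 0 else w k 0 j).
have wE (s : R) : z + s *: delta_mx 0 k = \row_j (if j == k then s else w k 0 j).
  apply/rowP => j; rewrite !mxE eqxx /=.
  by case: eqVneq => _; rewrite ?(mulr1, mulr0, add0r, addr0).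
have E1 : w k.+1 = z + x 0 k *: delta_mx 0 k.
  rewrite wE; apply/rowP => j; rewrite !mxE.
  case: eqVneq => [->|jk]; first by rewrite leqnn.
  by rewrite ltnS leq_eqVlt -[_ == _]/(j == k) (negbTE jk).
have E0 : w k = z + y 0 k *: delta_mx 0 k.
  by rewrite wE; apply/rowP => j; rewrite !mxE; case: eqVneq => [->|//]; rewrite ltnn.
have Br (s : R) : Num.min (y 0 k) (x 0 k) <= s <= Num.max (y 0 k) (x 0 k) ->
    `|(z + s *: delta_mx 0 k) - x0| < r.
  move=> /andP[s1 s2]; rewrite wE.
  apply: (@le_lt_trans _ _ (Num.max `|x - x0| `|y - x0|)); last first.
    by rewrite gt_max xr yr.
  apply: rV_norm_le; first by rewrite le_max normr_ge0.
  move=> j; rewrite !mxE; case: eqVneq => [->|_]; last first.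
    rewrite le_max; case: ifP => _.
      by have := rV_coord_le (x - x0) j; rewrite !mxE => ->.
    by have := rV_coord_le (y - x0) j; rewrite !mxE => ->; rewrite orbT.
  apply: (le_trans (norm_between (x0 0 k) s1 s2)).
  have := rV_coord_le (x - x0) k; have := rV_coord_le (y - x0) k; rewrite !mxE.
  by move=> hy hx; rewrite ge_max !le_max hx hy orbT.
rewrite E1 E0.
apply: (@le_trans _ _ (M * `|x 0 k - y 0 k|)).
  apply: (@mvt_abs (fun s => F (z + s *: delta_mx 0 k))
    (fun s => 'D_(delta_mx 0 k) F (z + s *: delta_mx 0 k))) => s sb.
    by apply: line_derive; apply: dF; apply: Br.
  by apply: bF; apply: Br.
have M0 : 0 <= M by apply: le_trans (bF x xr k); exact: normr_ge0.
by rewrite ler_wpM2l //; have := rV_coord_le (x - y) k; rewrite !mxE.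
Qed.

End RowVectors.

(** * Differentiability from continuous partial derivatives *)

Section PartialDerivatives.
Variable R : realType.

(** With L the candidate differential, the partial derivatives of [F - L] are small near x0, so
    [partials_lipschitz] bounds its increment by a small multiple of the distance to x0. *)
Lemma partials_differentiable n (F : 'rV[R]_n -> R) (x0 : 'rV[R]_n) (r : R) :
  0 < r ->
  (forall x, `|x - x0| < r -> forall i, derivable F x (delta_mx 0 i)) ->
  (forall i, {for x0, continuous (fun x => 'D_(delta_mx 0 i) F x)}) ->
  differentiable F x0.
Proof.
move=> r0 dF cF.
pose c : 'cV[R]_n := \col_i 'D_(delta_mx 0 i) F x0.
pose L (y : 'rV[R]_n) : R := (y *m c) 0 0.
have Ladd : linear L by move=> a u v; rewrite /L mulmxDl -scalemxAl !mxE.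
pose LL := HB.pack_for {linear 'rV[R]_n -> R} L
  (GRing.isLinear.Build _ _ _ _ L Ladd).
have Ldir i x : 'D_(delta_mx 0 i) L x = c i 0 /\ derivable L x (delta_mx 0 i).
  have dL : is_derive x (delta_mx 0 i) L (c i 0).
    have E : (fun h : R => h^-1 *: ((L \o shift x) (h *: delta_mx 0 i) - L x))
        @ 0^' --> c i 0.
      apply: cvg_near_cst; near=> h.
      have hn0 : h != 0 by near: h; exact: nbhs_dnbhs_neq.
      rewrite /L /= mulmxDl -scalemxAl -rowE !mxE addrK.
      by rewrite [_ *: _]mulrA mulVf // mul1r.
    split; last by apply: cvg_lim.
    by apply/cvg_ex; exists (c i 0).
  by split; [exact: derive_val | exact: ex_derive].
have Lcont : continuous L.
  have -> : L = fun y => \sum_i y 0 i * c i 0.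
    by apply: funext => y; rewrite /L mxE.
  move=> y; apply: sum_continuous_at => i.
  by apply: continuousM; [exact: coord_continuous | exact: cst_continuous].
have key : (F : _ -> R^o) \o shift x0 =
    cst (F x0 : R^o) + (LL : _ -> R^o) +o_ (0 : 'rV[R]_n) id.
  apply/eqaddoP => _/posnumP[e].
  (* With this M the Lipschitz constant [n * M] of [F - L] is at most e; n + 1 keeps the denominator
     nonzero when n = 0. *)
  pose M := e%:num / (n.+1%:R).
  have M0 : 0 < M by rewrite divr_gt0.
  have [d d0 hd] : exists2 d : R, 0 < d & forall x, `|x - x0| < d -> forall i,
       `|'D_(delta_mx 0 i) F x - c i 0| <= M.
    have /nbhs_ballP [d /= d0 hd] : \forall x \near x0, forall i,
       `|'D_(delta_mx 0 i) F x - c i 0| <= M.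
      apply: (@filter_forall _ _ (fun i x => `|'D_(delta_mx 0 i) F x - c i 0| <= M)
        (nbhs x0)) => i.
      have /cvgrPdist_le /(_ _ M0) := cF i.
      by apply: filterS => x; rewrite distrC mxE.
    by exists d => // x xd; apply: hd; apply/rV_ballP.
  pose d' := Num.min d r.
  have d'0 : 0 < d' by rewrite lt_min d0.
  have D x : `|x - x0| < d' -> forall i, is_derive x (delta_mx 0 i) (fun z => F z - L z)
      ('D_(delta_mx 0 i) F x - c i 0).
    rewrite lt_min => /andP[_ xr] i; have [<- dL] := Ldir i x.
    have dFx := derivableP (dF x xr i).
    exact: (@is_deriveB _ _ _ F L x _ _ _ dFx (derivableP dL)).
  have lip x : `|x - x0| < d' ->
      `|(F x - L x) - (F x0 - L x0)| <= n%:R * M * `|x - x0|.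
    move=> xd.
    have H := @partials_lipschitz R n (fun z => F z - L z) x0 d' M.
    apply: H; [ | | exact: xd | by rewrite subrr normr0].
      by move=> z zd i; have [] := D z zd i.
    move=> z zd i; have [_ ->] := D z zd i.
    by apply: hd; move: zd; rewrite lt_min => /andP[].
  have nh : nbhs (0 : 'rV[R]_n) (fun h => `|h| < d').
    by apply/nbhs_ballP; exists d' => //= h /rV_ballP; rewrite subr0.
  apply: (filterS (F := nbhs (0 : 'rV[R]_n)) _ nh) => h hd' /=.
  have := lip (h + x0); rewrite addrK => /(_ hd').
  have -> : L (h + x0) = L h + L x0 by have := Ladd 1 h x0; rewrite !scale1r.
  rewrite !fctE /= -/(L h).
  have -> : F (h + x0) - (L h + L x0) - (F x0 - L x0) = F (h + x0) - (F x0 + L h).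
    by move: (F (h + x0)) (L h) (L x0) (F x0) => a b e' f; ring.
  move=> H; apply: (le_trans H).
  rewrite ler_wpM2r // /M mulrCA ger_pMr //.
  by rewrite ler_pdivrMr // mul1r ler_nat.
have dE : 'd F x0 = LL :> (_ -> _) by apply: diff_unique.
by apply/diff_locallyP; rewrite dE.
Unshelve. all: by end_near.
Qed.

End PartialDerivatives.

(** * Functions of class C^k and their calculus *)

Section CkFunctions.
Variable R : realType.

Lemma diff_sum_partials m (F : 'rV[R]_m -> R) (y w : 'rV[R]_m) :
  differentiable F y -> 'd F y w = \sum_j w 0 j * 'D_(delta_mx 0 j) F y.
Proof.
move=> dF; rewrite {1}[w]row_sum_delta linear_sum; apply: eq_bigr => j _.
by rewrite linearZ deriveE.
Qed.

Lemma derive_line n (H : 'rV[R]_n -> R) (x v : 'rV[R]_n) :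
  'D_v H x = 'D_1 (fun h : R => H (h *: v + x)) 0.
Proof.
rewrite /derive; set b := fun h : R => h^-1 *: ((H \o shift x) _ - _).
set c := fun h : R => h^-1 *: ((_ \o shift 0) _ - _).
suff -> : b = c by []; apply: funext => h; rewrite /b /c /=.
by rewrite addr0 scale0r add0r [_%:A]mulr1.
Qed.

(** On the line through x in direction v the map G becomes a curve, and for curves derivability is
    differentiability. Hence the chain rule holds with G derivable in the single direction v. *)
Lemma derive_comp n m (G : 'rV[R]_n -> 'rV[R]_m) (F : 'rV[R]_m -> R)
    (x v : 'rV[R]_n) :
  differentiable F (G x) -> (forall j, derivable (fun z => G z 0 j) x v) ->
  derivable (fun z => F (G z)) x v /\
  'D_v (fun z => F (G z)) x =
    \sum_j 'D_v (fun z => G z 0 j) x * 'D_(delta_mx 0 j) F (G x).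
Proof.
move=> dF dG.
have dGm : derivable G x v by apply/derivable_mxP => i j; rewrite (ord1 i).
pose g (h : R) := G (h *: v + x).
have g0 : g 0 = G x by rewrite /g scale0r add0r.
have dg : derivable g 0 1 by exact: (derivable1P G x v).1.
have dg' : differentiable g 0 by exact: (derivable1_diffP g 0).1 dg.
have dF' : differentiable F (g 0) by rewrite g0.
have dc : differentiable (F \o g) 0 by apply: differentiable_comp.
split.
  exact: (derivable1P (fun z => F (G z)) x v).2 ((derivable1_diffP _ _).2 dc).
rewrite (derive_line (fun z => F (G z))) -/(F \o g) deriveE // diff_comp // /=.
rewrite -(deriveE _ dg') derive_mx // diff_sum_partials // g0.
by apply: eq_bigr => j _; rewrite mxE; congr (_ * _); rewrite derive_line.
Qed.

Lemma continuous_comp_rV n m (G : 'rV[R]_n -> 'rV[R]_m) (F : 'rV[R]_m -> R)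
    (x : 'rV[R]_n) :
  (forall j, {for x, continuous (fun z => G z 0 j)}) ->
  {for G x, continuous F} -> {for x, continuous (fun z => F (G z))}.
Proof.
move=> cG cF; apply: (continuous_comp (f := G)) => //.
apply/(@cvgrPdist_le _ _ _ (nbhs x) (nbhs_filter x)) => /= e e0.
have : \forall z \near x, forall j, `|G x 0 j - G z 0 j| <= e.
  apply: (@filter_forall _ _ (fun j z => `|G x 0 j - G z 0 j| <= e) (nbhs x)).
  by move=> j; have /cvgrPdist_le /(_ _ e0) := cG j.
apply: filterS => z hz; apply: rV_norm_le; first exact: ltW.
by move=> j; rewrite !mxE.
Qed.

Lemma Ck_sub k n (V W : set 'rV[R]_n) (F : 'rV[R]_n -> R) :
  W `<=` V -> Ck k V F -> Ck k W F.
Proof.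
move=> WV; elim: k F => [|k IH] F /= [cF dF]; split => //.
- by move=> x /WV; apply: cF.
- by move=> x /WV; apply: cF.
by move=> i; have [d1 d2] := dF i; split => [x /WV|]; [apply: d1 | apply: IH].
Qed.

Lemma CkW k n (V : set 'rV[R]_n) (F : 'rV[R]_n -> R) : Ck k.+1 V F -> Ck k V F.
Proof.
elim: k F => [|k IH] F [cF dF]; split => // i.
by have [d1 d2] := dF i; split => //; apply: IH.
Qed.

Lemma Ck0 k n (V : set 'rV[R]_n) (F : 'rV[R]_n -> R) x :
  Ck k V F -> V x -> {for x, continuous F}.
Proof. by case: k => [|k] [cF _]; apply: cF. Qed.

Lemma near_eq_continuous n (F G : 'rV[R]_n -> R) (x : 'rV[R]_n) :
  {near x, F =1 G} -> {for x, continuous F} -> {for x, continuous G}.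
Proof.
move=> FG; rewrite /prop_for /continuous_at -(nbhs_singleton FG) => cF.
apply: cvg_trans cF; apply: (@near_eq_cvg _ _ (nbhs x) (nbhs_filter x)).
exact: FG.
Qed.

Lemma Ck_ext k n (V : set 'rV[R]_n) (F G : 'rV[R]_n -> R) : open V ->
  (forall x, V x -> F x = G x) -> Ck k V F -> Ck k V G.
Proof.
move=> oV; elim: k F G => [|k IH] F G FG /= [cF dF].
  split=> // x Vx; apply: near_eq_continuous (cF x Vx).
  by apply: (filterS _ (open_nbhs_nbhs (conj oV Vx))) => z; apply: FG.
have nFG x : V x -> {near x, F =1 G}.
  by move=> Vx; apply: (filterS _ (open_nbhs_nbhs (conj oV Vx))) => z; apply: FG.
split=> [x Vx|i]; first exact: near_eq_continuous (nFG x Vx) (cF x Vx).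
have [d1 d2] := dF i; split=> [x Vx|].
  exact: near_eq_derivable (nFG x Vx) (d1 x Vx).
apply: IH d2 => x Vx; exact: near_eq_derive (nFG x Vx).
Qed.

(** [Ck] is a condition on ambient derivatives at each point of V, so it can be checked one point at
    a time. *)
Lemma Ck_local k n (V : set 'rV[R]_n) (F : 'rV[R]_n -> R) :
  (forall x, V x -> exists2 W, W x & Ck k W F) -> Ck k V F.
Proof.
elim: k F => [|k IH] F h; split.
- by move=> x /h [W Wx [+ _]]; apply.
- by [].
- by move=> x /h [W Wx [+ _]]; apply.
move=> i; split; first by move=> x /h [W Wx [_ /(_ i) [+ _]]]; apply.
by apply: IH => x /h [W Wx [_ /(_ i) [_ d]]]; exists W.
Qed.

Lemma Ck_differentiable k n (V : set 'rV[R]_n) (F : 'rV[R]_n -> R) x :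
  open V -> Ck k.+1 V F -> V x -> differentiable F x.
Proof.
move=> oV [cF dF] Vx; have [r r0 hr] := rV_open_ball oV Vx.
apply: (partials_differentiable r0).
  by move=> z /hr Vz i; have [+ _] := dF i; apply.
by move=> i; have [_ d] := dF i; apply: Ck0 d Vx.
Qed.

Lemma Ck_cst k n (V : set 'rV[R]_n) (c : R) : Ck k V (fun=> c).
Proof.
elim: k c => [|k IH] c; split => //; try by move=> x _; exact: cst_continuous.
move=> i; split=> [x _|]; first exact: derivable_cst.
have -> : 'D_(delta_mx 0 i) (fun _ : 'rV[R]_n => c) = fun=> 0.
  by apply: funext => x; exact: derive_cst.
exact: IH.
Qed.

Lemma CkD k n (V : set 'rV[R]_n) (F G : 'rV[R]_n -> R) : open V ->
  Ck k V F -> Ck k V G -> Ck k V (fun x => F x + G x).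
Proof.
move=> oV; elim: k F G => [|k IH] F G [cF dF] [cG dG].
  by split=> // x Vx; apply: continuousD; [apply: cF | apply: cG].
split=> [x Vx|i]; first by apply: continuousD; [apply: cF | apply: cG].
have [f1 f2] := dF i; have [g1 g2] := dG i; split=> [x Vx|].
  by apply: derivableD; [apply: f1 | apply: g1].
apply: Ck_ext (IH _ _ f2 g2) => // x Vx.
by rewrite -deriveD //; [apply: f1 | apply: g1].
Qed.

Lemma CkM k n (V : set 'rV[R]_n) (F G : 'rV[R]_n -> R) : open V ->
  Ck k V F -> Ck k V G -> Ck k V (fun x => F x * G x).
Proof.
move=> oV; elim: k F G => [|k IH] F G CF CG; move: (CF) (CG) => [cF dF] [cG dG].
  by split=> // x Vx; apply: continuousM; [apply: cF | apply: cG].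
split=> [x Vx|i]; first by apply: continuousM; [apply: cF | apply: cG].
have [f1 f2] := dF i; have [g1 g2] := dG i; split=> [x Vx|].
  by apply: derivableM; [apply: f1 | apply: g1].
have := CkD oV (IH _ _ (CkW CF) g2) (IH _ _ (CkW CG) f2).
by apply: Ck_ext => // x Vx; rewrite -deriveM //; [apply: f1 | apply: g1].
Qed.

Lemma Ck_sum k n (V : set 'rV[R]_n) (I : Type) (r : seq I)
    (F : I -> 'rV[R]_n -> R) : open V ->
  (forall i, Ck k V (F i)) -> Ck k V (fun x => \sum_(i <- r) F i x).
Proof.
move=> oV h; elim: r => [|i r IH].
  by apply: Ck_ext (Ck_cst k V 0) => // x _; rewrite big_nil.
by apply: Ck_ext (CkD oV (h i) IH) => // x _; rewrite big_cons.
Qed.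

Lemma Ck_prod k n (V : set 'rV[R]_n) (I : Type) (r : seq I)
    (F : I -> 'rV[R]_n -> R) : open V ->
  (forall i, Ck k V (F i)) -> Ck k V (fun x => \prod_(i <- r) F i x).
Proof.
move=> oV h; elim: r => [|i r IH].
  by apply: Ck_ext (Ck_cst k V 1) => // x _; rewrite big_nil.
by apply: Ck_ext (CkM oV (h i) IH) => // x _; rewrite big_cons.
Qed.

Lemma linear_is_derive n (c : 'cV[R]_n) (x v : 'rV[R]_n) :
  is_derive x v (fun y : 'rV[R]_n => (y *m c) 0 0) ((v *m c) 0 0).
Proof.
have E : (fun h : R => h^-1 *: (((fun y : 'rV[R]_n => (y *m c) 0 0) \o shift x)
  (h *: v) - (x *m c) 0 0)) @ 0^' --> (v *m c) 0 0.
  apply: cvg_near_cst; near=> h.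
  have hn0 : h != 0 by near: h; exact: nbhs_dnbhs_neq.
  rewrite /= mulmxDl -scalemxAl [X in X - _]mxE addrK mxE.
  by rewrite [_ *: _]mulrA mulVf // mul1r.
by split; [apply/cvg_ex; exists ((v *m c) 0 0) | apply: cvg_lim].
Unshelve. all: by end_near. Qed.

Lemma Ck_linear k n (V : set 'rV[R]_n) (c : 'cV[R]_n) :
  Ck k V (fun y : 'rV[R]_n => (y *m c) 0 0).
Proof.
have cc x : {for x, continuous (fun y : 'rV[R]_n => (y *m c) 0 0)}.
  rewrite (_ : (fun y => _) = fun y : 'rV[R]_n => \sum_i y 0 i * c i 0); last first.
    by apply: funext => y; rewrite mxE.
  apply: sum_continuous_at => i.
  by apply: continuousM; [exact: coord_continuous | exact: cst_continuous].
case: k => [|k]; split => // i; split=> [x _|].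
  by have [] := linear_is_derive c x (delta_mx 0 i).
have -> : 'D_(delta_mx 0 i) (fun y : 'rV[R]_n => (y *m c) 0 0) =
    fun=> ((delta_mx 0 i : 'rV[R]_n) *m c) 0 0.
  by apply: funext => x; have [] := linear_is_derive c x (delta_mx 0 i).
exact: Ck_cst.
Qed.

Lemma Ck_coord k n (V : set 'rV[R]_n) i : open V ->
  Ck k V (fun y : 'rV[R]_n => y 0 i).
Proof.
move=> oV; apply: Ck_ext (Ck_linear k V (delta_mx i 0)) => // x _.
by rewrite -colE mxE.
Qed.

Lemma Ck_comp k n m (V : set 'rV[R]_n) (W : set 'rV[R]_m)
    (G : 'rV[R]_n -> 'rV[R]_m) (F : 'rV[R]_m -> R) :
  open V -> open W -> (forall x, V x -> W (G x)) ->
  (forall j, Ck k V (fun x => G x 0 j)) -> Ck k W F ->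
  Ck k V (fun x => F (G x)).
Proof.
move=> oV oW VW; elim: k F => [|k IH] F CG CF.
  split=> // x Vx; apply: continuous_comp_rV.
    by move=> j; apply: Ck0 (CG j) Vx.
  by apply: Ck0 CF (VW _ Vx).
have D x v : V x -> (forall j, derivable (fun z => G z 0 j) x v) ->
   derivable (fun z => F (G z)) x v /\
  'D_v (fun z => F (G z)) x =
    \sum_j 'D_v (fun z => G z 0 j) x * 'D_(delta_mx 0 j) F (G x).
  by move=> Vx h; apply: derive_comp => //; apply: Ck_differentiable CF _ => //; apply: VW.
have dG x i j : V x -> derivable (fun z => G z 0 j) x (delta_mx 0 i).
  by move=> Vx; have [_ /(_ i) [+ _]] := CG j; apply.
split=> [x Vx|i].
  apply: continuous_comp_rV; first by move=> j; apply: Ck0 (CG j) Vx.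
  by apply: Ck0 CF (VW _ Vx).
split=> [x Vx|]; first by have [] := D x (delta_mx 0 i) Vx (fun j => dG x i j Vx).
apply: (@Ck_ext _ _ _ (fun x => \sum_j 'D_(delta_mx 0 i) (fun z => G z 0 j) x *
   'D_(delta_mx 0 j) F (G x))) => //.
  by move=> x Vx; have [_ ->] := D x (delta_mx 0 i) Vx (fun j => dG x i j Vx).
apply: Ck_sum => // j; apply: CkM => //.
  by have [_ /(_ i) []] := CG j.
apply: (IH (fun y => 'D_(delta_mx 0 j) F y)) => [l|]; first exact: CkW.
by have [_ /(_ j) []] := CF.
Qed.

Lemma CkV k n (V : set 'rV[R]_n) (F : 'rV[R]_n -> R) : open V ->
  (forall x, V x -> F x != 0) -> Ck k V F -> Ck k V (fun x => (F x)^-1).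
Proof.
move=> oV F0; elim: k F F0 => [|k IH] F F0 CF; move: (CF) => [cF dF].
  by split=> // x Vx; apply: continuousV; [exact: F0 | apply: cF].
split=> [x Vx|i]; first by apply: continuousV; [exact: F0 | apply: cF].
have [f1 f2] := dF i; split=> [x Vx|].
  by apply: derivableV; [exact: F0 | apply: f1].
have CV := IH _ F0 (CkW CF).
have := CkM oV (Ck_cst k V (-1)) (CkM oV (CkM oV CV CV) f2).
apply: Ck_ext => // x Vx; rewrite deriveV; [|exact: F0|exact: f1].
by rewrite mulN1r -exprVn expr2 scaleNr.
Qed.

End CkFunctions.

(** * Smooth bump functions built from exp(-1/t) *)

Section Bump.
Variable R : realType.

Lemma derive_comp1 n (g : R -> R) (F : 'rV[R]_n -> R) (x v : 'rV[R]_n) :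
  derivable F x v -> derivable g (F x) 1 ->
  derivable (fun z => g (F z)) x v /\
  'D_v (fun z => g (F z)) x = 'D_1 g (F x) * 'D_v F x.
Proof.
move=> dF dg.
pose f (h : R) := F (h *: v + x).
have f0 : f 0 = F x by rewrite /f scale0r add0r.
have df : derivable f 0 1 by exact: (derivable1P F x v).1.
have dgf : derivable g (f 0) 1 by rewrite f0.
have dc : differentiable (g \o f) 0.
  apply: differentiable_comp; first exact: (derivable1_diffP f 0).1 df.
  exact: (derivable1_diffP g (f 0)).1 dgf.
split; first exact: (derivable1P (fun z => g (F z)) x v).2 ((derivable1_diffP _ _).2 dc).
rewrite (derive_line (fun z => g (F z))) (derive_line F) -!derive1E -/(g \o f) -/f.
by rewrite (derive1_comp df dgf) f0.
Qed.

(* The powers t^-m make the family closed under differentiation. *)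
Definition flat (m : nat) (t : R) : R :=
  if 0 < t then (t ^+ m)^-1 * expR (- t^-1) else 0.

Lemma flat_ge0 m t : 0 <= flat m t.
Proof.
rewrite /flat; case: ifP => // t0.
by rewrite mulr_ge0 ?expR_ge0 // invr_ge0 exprn_ge0 // ltW.
Qed.

Lemma flat_gt0 m t : 0 < t -> 0 < flat m t.
Proof. by move=> t0; rewrite /flat t0 mulr_gt0 ?expR_gt0 // invr_gt0 exprn_gt0. Qed.

Lemma flat_eq0 m t : t <= 0 -> flat m t = 0.
Proof. by rewrite /flat leNgt => /negbTE ->. Qed.

(** One term of the exponential series gives exp(1/t) >= (1/t)^(m+1) / (m+1)!. A bound linear in t
    is what the derivative at 0 requires. *)
Lemma flat_le m t : flat m t <= (m.+1)`!%:R * `|t|.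
Proof.
have [t0|t0] := ltP 0 t; last by rewrite flat_eq0 // mulr_ge0.
rewrite /flat t0 gtr0_norm //.
have h := @expR_ge1Dxn R t^-1 m (ltac:(by rewrite invr_ge0 ltW)).
have f0 : 0 < (m.+1)`!%:R :> R by rewrite ltr0n fact_gt0.
have tm0 : 0 < t ^+ m by rewrite exprn_gt0.
have {}h : t^-1 ^+ m.+1 / (m.+1)`!%:R <= expR t^-1 by apply: le_trans h; rewrite lerDr.
rewrite expRN ler_pdivrMl // -[leLHS]mul1r ler_pdivrMr ?expR_gt0 //.
apply: le_trans (ler_wpM2l _ h); last by rewrite !mulr_ge0 // ltW.
rewrite exprVn exprS invfM.
have -> : t ^+ m * ((m.+1)`!%:R * t) * (t^-1 / t ^+ m / (m.+1)`!%:R) = 1 :> R.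
  by field; rewrite !lt0r_neq0.
by [].
Qed.

Lemma flat_derive m (t : R) :
  is_derive t 1 (flat m) (flat m.+2 t - m%:R * flat m.+1 t).
Proof.
have [t0|t0|->] := ltgtP t 0.
- rewrite !flat_eq0 ?ltW // mulr0 subrr.
  have dc : is_derive t 1 (fun _ : R => 0 : R) 0.
    by split; [exact: derivable_cst | exact: derive_cst].
  apply: near_eq_is_derive dc.
  near=> s; rewrite flat_eq0 // ltW //; near: s; exact: lt_nbhsl.
- have tn0 : t != 0 by rewrite gt_eqF.
  have d1 : is_derive t 1 (fun s : R => (s ^+ m)^-1)
      (- (t ^+ m)^-2 * (m%:R * t ^+ m.-1)).
    have dX : is_derive t 1 (fun s : R => s ^+ m) (m%:R * t ^+ m.-1).
      split; first exact: exprn_derivable.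
      by rewrite exp_derive [_ *: _]mulr1.
    have tm : t ^+ m != 0 by rewrite expf_neq0.
    split; first by apply: derivableV => //; case: dX.
    by rewrite deriveV //; case: dX => _ ->.
  have d2 : is_derive t 1 (fun s : R => - s^-1) (t ^- 2).
    have dV : is_derive t 1 (fun s : R => s^-1) (- t ^- 2).
      split; first by apply: derivableV => //; exact: derivable_id.
      by rewrite (deriveV (f := id)) // derive_id [_ *: _]mulr1.
    by have := is_deriveN dV; rewrite opprK.
  have d3 : is_derive t 1 (fun s : R => expR (- s^-1)) (expR (- t^-1) * t ^- 2).
    have dc := @derive1_comp R (fun s => - s^-1) expR t
       (ltac:(by case: d2)) (@derivable_expR R (- t^-1)).
    split; last first.
      by rewrite -derive1E -[(fun _ => _)]/(expR \o (fun s => - s^-1)) dc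
        !derive1E derive_val (derive_val (is_derive := d2)).
    apply/derivable1_diffP.
    apply: (@differentiable_comp _ _ _ _ (fun s : R => - s^-1) expR).
      by apply/derivable1_diffP; case: d2.
    by apply/derivable1_diffP; exact: derivable_expR.
  have d4 := is_deriveM d1 d3.
  have nr : {near t, (fun s : R => (s ^+ m)^-1) * (fun s : R => expR (- s^-1)) =1 flat m}.
    near=> s; rewrite /flat ifT //; near: s; exact: lt_nbhsr.
  apply: is_derive_eq (near_eq_is_derive nr d4) _.
  rewrite /flat t0 /GRing.scale /=; set e := expR _.
  case: m d1 d4 nr => [|m] d1 d4 nr /=; rewrite ?exprS ?expr0.
    by field.
  by field; rewrite tn0 expf_neq0.
rewrite !flat_eq0 // mulr0 subrr.
have E : (fun h : R => h^-1 *: ((flat m \o shift 0) (h *: 1) - flat m 0)) @ 0^' --> (0 : R).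
  apply/cvgrPdist_le => e e0; near=> h.
  have h0 : h != 0 by near: h; exact: nbhs_dnbhs_neq.
  rewrite /= [_%:A]mulr1 addr0 [flat m 0]flat_eq0 // subr0 sub0r normrN.
  (* The difference quotient at 0 is again a member of the family, so [flat_le] makes it tend to
     0. *)
  have -> : h^-1 *: flat m h = flat m.+1 h.
    rewrite /flat; case: ifP => _; last by rewrite scaler0.
    by rewrite [_ *: _]mulrA -invfM -exprS.
  rewrite ger0_norm ?flat_ge0 // (le_trans (flat_le _ _)) //.
  rewrite -ler_pdivlMl ?ltr0n ?fact_gt0 //.
  near: h; apply: dnbhs0_le.
  by rewrite mulr_gt0 // invr_gt0 ltr0n fact_gt0.
by split; [apply/cvg_ex; exists 0 | exact: cvg_lim E].
Unshelve. all: by end_near. Qed.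

Lemma Ck_flat k n (V : set 'rV[R]_n) m (F : 'rV[R]_n -> R) : open V ->
  Ck k V F -> Ck k V (fun x => flat m (F x)).
Proof.
move=> oV.
have cflat j t : {for t, continuous (flat j)}.
  apply: differentiable_continuous; apply/derivable1_diffP.
  by have [] := flat_derive j t.
elim: k m F => [|k IH] m F CF; move: (CF) => [cF dF]; split=> //.
- by move=> x Vx; apply: continuous_comp (cF x Vx) _; exact: cflat.
- by move=> x Vx; apply: continuous_comp (cF x Vx) _; exact: cflat.
have D x i : V x -> derivable (fun z => flat m (F z)) x (delta_mx 0 i) /\
    'D_(delta_mx 0 i) (fun z => flat m (F z)) x =
    (flat m.+2 (F x) + (- m%:R) * flat m.+1 (F x)) * 'D_(delta_mx 0 i) F x.
  move=> Vx; have [f1 _] := dF i.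
  have [d1 d2] := flat_derive m (F x).
  by have [h1 ->] := derive_comp1 (f1 x Vx) d1; rewrite d2 mulNr.
move=> i; have [f1 f2] := dF i; split=> [x Vx|]; first by have [] := D x i Vx.
apply: (@Ck_ext _ _ _ _ (fun x => (flat m.+2 (F x) + (- m%:R) * flat m.+1 (F x))
   * 'D_(delta_mx 0 i) F x)) => //.
  by move=> x Vx; have [_ ->] := D x i Vx.
apply: CkM => //; apply: CkD => //; first by apply: IH; exact: CkW.
by apply: CkM => //; [exact: Ck_cst | apply: IH; exact: CkW].
Qed.

(** The standard smooth transition from 0 for t <= 0 to 1 for t >= 1; the denominator is positive
    everywhere. *)
Definition step (t : R) : R := flat 0 t / (flat 0 t + flat 0 (1 - t)).

Lemma step_den t : 0 < flat 0 t + flat 0 (1 - t).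
Proof.
have [t0|t0] := ltP 0 t; first by rewrite ltr_pwDl ?flat_gt0 ?flat_ge0.
by rewrite ltr_wpDl ?flat_ge0 // flat_gt0 // subr_gt0 (le_lt_trans t0).
Qed.

Lemma step0 t : t <= 0 -> step t = 0.
Proof. by move=> t0; rewrite /step flat_eq0 // mul0r. Qed.

Lemma step1 t : 1 <= t -> step t = 1.
Proof.
move=> t1; have := step_den t; rewrite /step [flat 0 (1 - t)]flat_eq0 ?subr_le0 //.
by rewrite addr0 => h; rewrite mulfV // gt_eqF.
Qed.

Lemma Ck_step k n (V : set 'rV[R]_n) (F : 'rV[R]_n -> R) : open V ->
  Ck k V F -> Ck k V (fun x => step (F x)).
Proof.
move=> oV CF; have C1 : Ck k V (fun x => 1 - F x).
  apply: Ck_ext (CkD oV (Ck_cst k V 1) (CkM oV (Ck_cst k V (-1)) CF)) => // x _.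
  by rewrite mulN1r.
apply: CkM => //; first exact: Ck_flat.
apply: CkV => //; first by move=> x _; rewrite gt_eqF // step_den.
by apply: CkD => //; exact: Ck_flat.
Qed.

End Bump.

(** * Integrals with a parameter and Hadamard's lemma *)

Section Hadamard.
Variable R : realType.
Let mu := @lebesgue_measure R.
Local Notation I01 := (`[0, 1]%classic : set (measurableTypeR R)).

Lemma unit_measure : mu I01 = 1%E.
Proof.
have := @lebesgue_measure_itv R `[0, 1]; rewrite /= lte_fin ltr01 oppr0 adde0.
exact.
Qed.

Lemma unit_integral_cst (C : R) : (\int[mu]_(t in I01) C)%R = C.
Proof.
transitivity (C * fine (mu I01)); last by rewrite unit_measure mulr1.
by apply: Rintegral_cst; exact: measurable_itv.
Qed.

Lemma unit_integrable (g : R -> R) : continuous g ->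
  mu.-integrable I01 (EFin \o g).
Proof.
move=> cg; apply: continuous_compact_integrable; first exact: segment_compact.
exact: continuous_subspaceT.
Qed.

Lemma unit_integral_le (g : R -> R) (C : R) : continuous g ->
  (forall t, 0 <= t <= 1 -> `|g t| <= C) ->
  `|(\int[mu]_(t in I01) g t)%R| <= C.
Proof.
move=> cg gC.
have m01 : measurable I01 by exact: measurable_itv.
apply: (le_trans (le_normr_Rintegral m01 (unit_integrable cg))).
rewrite -[leRHS]unit_integral_cst.
apply: le_Rintegral => //.
  apply: (unit_integrable (g := fun t => `|g t|)) => t.
  by apply: (@continuous_comp _ _ _ g Num.norm); [exact: cg | exact: norm_continuous].
by apply: (unit_integrable (g := fun=> C)) => t; exact: cst_continuous.
Qed.

Lemma bounded_on_ball n (F : 'rV[R]_n -> R) (r : R) : continuous F ->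
  exists C : R, forall y, `|y| <= r -> `|F y| <= C.
Proof.
move=> cF; have [r0|r0] := ltP r 0.
  by exists 0 => y yr; have := le_lt_trans yr r0; rewrite ltNge normr_ge0.
pose A : set 'rV[R]_n := [set y | `|y| <= r].
have cA : compact A.
  apply: bounded_closed_compact.
    by exists r; split => [|M rM y /= /le_trans]; [exact: num_real | apply; exact: ltW].
  apply: (@closed_comp _ _ (fun y : 'rV[R]_n => `|y|) [set s | s <= r]).
    by move=> y _; exact: norm_continuous.
  exact: closed_le.
have [||c _ hc] := @EVT_max_rV R n (fun y => `|F y|) A _ cA.
- by exists 0; rewrite /A /= normr0.
- apply: continuous_subspaceT => y.
  by apply: (@continuous_comp _ _ _ F Num.norm); [exact: cF | exact: norm_continuous].
- by exists `|F c| => y yr; apply: hc; rewrite inE.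
Qed.

(* The weights t^k make the family closed under differentiation in x. *)
Definition wint n (k : nat) (F : 'rV[R]_n -> R) (x : 'rV[R]_n) : R :=
  (\int[mu]_(t in I01) (t ^+ k * F (t *: x)))%R.

Lemma wint_cont n k (F : 'rV[R]_n -> R) (x : 'rV[R]_n) : continuous F ->
  continuous (fun t : R => t ^+ k * F (t *: x)).
Proof.
move=> cF t; apply: (@continuousM _ _ (fun t : R => t ^+ k) (fun t => F (t *: x))).
  exact: exprn_continuous.
apply: (@continuous_comp _ _ _ (fun t : R => t *: x) F); last exact: cF.
exact: scalel_continuous.
Qed.

Lemma wint_derive n k (F : 'rV[R]_n -> R) (x v : 'rV[R]_n) :
  (forall y, differentiable F y) -> continuous ('D_v F) ->
  derivable (wint k F) x v /\ 'D_v (wint k F) x = wint k.+1 ('D_v F) x.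
Proof.
move=> dF cDF.
have cF : continuous F by move=> y; exact: differentiable_continuous.
pose f (s t : R) : R := t ^+ k * F (t *: (s *: v + x)).
(* All points [t *: (s *: v + x)] with t in [0,1] and |s| < 1 lie in this ball, so C dominates the
   derivative of the integrand in s. *)
have [C hC] := @bounded_on_ball n ('D_v F) (`|v| + `|x|) cDF.
have m01 : measurable I01 by exact: measurable_itv.
have df (s t : R) : is_derive s 1 (f^~ t) (t ^+ k.+1 * 'D_v F (t *: (s *: v + x))).
  pose g (s : R) := F (t *: x + s *: (t *: v)).
  have dg : is_derive s 1 g ('D_(t *: v) F (t *: x + s *: (t *: v))).
    by apply: line_derive; apply: diff_derivable.
  have E : f^~ t = (fun s => t ^+ k * g s).
    by apply: funext => s'; rewrite /f /g scalerDr addrC !scalerA [t * s']mulrC.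
  have -> : t ^+ k.+1 * 'D_v F (t *: (s *: v + x)) =
            t ^+ k * 'D_(t *: v) F (t *: x + s *: (t *: v)).
    have -> : t *: (s *: v + x) = t *: x + s *: (t *: v).
      by rewrite scalerDr addrC !scalerA [t * s]mulrC.
    set z := _ + _; rewrite (deriveE v (dF z)) (deriveE (t *: v) (dF z)).
    by rewrite (linearZ_LR ('d F z)) exprSr -mulrA.
  by rewrite E; exact: (is_deriveZ (t ^+ k) dg).
have I0 : `]-1, 1[%classic (0 : R) by rewrite /= in_itv /= ltrN10 ltr01.
have intf s : `]-1, 1[%classic s -> mu.-integrable I01 (EFin \o f s).
  by move=> _; apply: unit_integrable; apply: wint_cont.
have derf s t : `]-1, 1[%classic s -> I01 t -> derivable (f^~ t) s 1.
  by move=> _ _; case: (df s t).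
have C0 : 0 <= C.
  by apply: le_trans (hC 0 _); rewrite ?normr_ge0 // normr0 addr_ge0.
have intG : mu.-integrable I01 (EFin \o (fun _ : R => C)).
  by apply: (unit_integrable (g := fun=> C)) => t; exact: cst_continuous.
have ub s t : `]-1, 1[%classic s -> I01 t -> `|partial1of2 f s t| <= C.
  rewrite /= !in_itv /= => /andP[s1 s2] /andP[t0 t1].
  rewrite partial1of2E; have [_ ->] := df s t.
  rewrite normrM -[leRHS]mul1r ler_pM //.
    by rewrite ger0_norm ?exprn_ge0 // exprn_ile1.
  apply: hC; rewrite normrZ (ger0_norm t0) -[leRHS]mul1r ler_pM //.
  apply: (le_trans (ler_normD _ _)); rewrite lerD2r normrZ -[leRHS]mul1r ler_pM //.
  by rewrite ler_norml !ltW.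
have D1 := @derivable_under_integral R _ _ mu f I01 m01 0 (-1) 1 I0 intf derf
  (fun=> C) (fun=> C0) intG ub.
have D2 := @differentiation_under_integral R _ _ mu f I01 m01 0 (-1) 1 I0 intf derf
  (fun=> C) (fun=> C0) intG ub.
split; first exact: (derivable1P (wint k F) x v).2 D1.
rewrite derive_line -derive1E [LHS]D2; apply: eq_Rintegral => t _.
by rewrite partial1of2E; have [_ ->] := df 0 t; rewrite scale0r add0r.
Qed.

Lemma smooth_partial n (V : set 'rV[R]_n) (F : 'rV[R]_n -> R) i :
  smooth_on V F -> smooth_on V ('D_(delta_mx 0 i) F).
Proof. by move=> sF k; have [_ /(_ i) []] := sF k.+1. Qed.

Lemma smooth_differentiable n (V : set 'rV[R]_n) (F : 'rV[R]_n -> R) x :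
  open V -> smooth_on V F -> V x -> differentiable F x.
Proof. by move=> oV sF; apply: (@Ck_differentiable _ 0) => //; apply: sF. Qed.

(** By [wint_derive] the partial derivatives are integrals of continuous functions, hence bounded
    near x, and bounded partial derivatives make the function Lipschitz there. *)
Lemma wint_continuous n k (F : 'rV[R]_n -> R) :
  smooth_on setT F -> continuous (wint k F).
Proof.
move=> sF x.
have dif y : differentiable F y.
  by apply: smooth_differentiable sF _ => //; exact: openT.
have cD i : continuous ('D_(delta_mx 0 i) F).
  by move=> y; apply: (Ck0 (smooth_partial i sF 0%N)).
have D i y := @wint_derive n k F y (delta_mx 0 i) dif (cD i).
have [C hC] : exists C : R, forall y i, `|y| <= `|x| + 1 ->
    `|'D_(delta_mx 0 i) F y| <= C.
  have /choice [C hC] : forall i, exists C : R, forall y, `|y| <= `|x| + 1 ->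
       `|'D_(delta_mx 0 i) F y| <= C by move=> i; apply: bounded_on_ball.
  exists (\sum_i `|C i|) => y i yr; rewrite (bigD1 i) //=.
  by apply: (le_trans (hC i y yr)); rewrite (le_trans (ler_norm _)) // lerDl sumr_ge0.
have lip y : `|y - x| < 1 -> `|wint k F y - wint k F x| <= n%:R * C * `|y - x|.
  move=> y1; apply: (@partials_lipschitz _ _ _ x 1 C); [| | exact: y1 | by rewrite subrr normr0].
    by move=> z _ i; have [] := D i z.
  move=> z z1 i; have [_ ->] := D i z.
  apply: (unit_integral_le (@wint_cont n k.+1 _ z (cD i))).
  move=> t /andP[t0 t1]; rewrite normrM -[leRHS]mul1r ler_pM //.
    by rewrite ger0_norm ?exprn_ge0 // exprn_ile1.
  apply: hC; rewrite normrZ (ger0_norm t0) -[leRHS]mul1r ler_pM //.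
  by rewrite -[z](subrK x) addrC (le_trans (ler_normD _ _)) // lerD2l ltW.
apply/(@cvgrPdist_le _ _ _ (nbhs x) (nbhs_filter x)) => /= e e0.
have M0 : 0 < `|n%:R * C| + 1 by rewrite ltr_wpDl.
apply/nbhs_ballP; exists (Num.min 1 (e / (`|n%:R * C| + 1))).
  by rewrite /= lt_min ltr01 divr_gt0.
move=> y /rV_ballP; rewrite lt_min => /andP[y1 ye]; rewrite distrC.
apply: (le_trans (lip y y1)).
rewrite ltr_pdivlMr // in ye; apply: le_trans (ltW ye).
rewrite mulrC ler_wpM2l // (le_trans (ler_norm _)) // lerDl //.
Qed.

Lemma wint_smooth n k (F : 'rV[R]_n -> R) :
  smooth_on setT F -> smooth_on setT (wint k F).
Proof.
move=> + j; elim: j k F => [|j IH] k F sF; split=> //.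
- by move=> x _; exact: wint_continuous.
- by move=> x _; exact: wint_continuous.
have dif y : differentiable F y.
  by apply: smooth_differentiable sF _ => //; exact: openT.
move=> i; have cD : continuous ('D_(delta_mx 0 i) F).
  by move=> y; apply: (Ck0 (smooth_partial i sF 0%N)).
split=> [x _|]; first by have [] := @wint_derive n k F x (delta_mx 0 i) dif cD.
have -> : 'D_(delta_mx 0 i) (wint k F) = wint k.+1 ('D_(delta_mx 0 i) F).
  by apply: funext => x; have [] := @wint_derive n k F x (delta_mx 0 i) dif cD.
by apply: IH; exact: smooth_partial.
Qed.

(** Integrate d/dt F(x0 + t (x - x0)) over [0,1]. This factorisation lets an abstract derivation be
    computed from partial derivatives: by the Leibniz rule at x0 only the terms in which a factor
    [x 0 i - x0 0 i] is differentiated survive. *)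
Lemma hadamard n (F : 'rV[R]_n -> R) (x0 : 'rV[R]_n) :
  smooth_on setT F -> exists G : 'I_n -> 'rV[R]_n -> R,
  (forall i, smooth_on setT (G i)) /\
  (forall i, G i x0 = 'D_(delta_mx 0 i) F x0) /\
  forall x, F x = F x0 + \sum_i (x 0 i - x0 0 i) * G i x.
Proof.
move=> sF.
pose F0 (x : 'rV[R]_n) := F (x + x0).
have trans (a : 'rV[R]_n) (H : 'rV[R]_n -> R) : smooth_on setT H ->
    smooth_on setT (fun x => H (x + a)).
  move=> sH k; apply: (Ck_comp (G := fun x => x + a)) (sH k) => //; try exact: openT.
  move=> j; have := CkD openT (Ck_coord k (V := setT) j openT) (Ck_cst k setT (a 0 j)).
  by apply: Ck_ext; [exact: openT | move=> x _; rewrite mxE].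
have sF0 : smooth_on setT F0 by exact: trans.
have dif y : differentiable F0 y.
  by apply: smooth_differentiable sF0 _ => //; exact: openT.
have cD i : continuous ('D_(delta_mx 0 i) F0).
  by move=> y; apply: (Ck0 (smooth_partial i sF0 0%N)).
exists (fun i x => wint 0 ('D_(delta_mx 0 i) F0) (x - x0)); split; [|split].
- by move=> i; apply: trans; apply: wint_smooth; exact: smooth_partial.
- move=> i; rewrite subrr /wint.
  under eq_Rintegral do rewrite expr0 mul1r scaler0.
  rewrite unit_integral_cst derive_line.
  rewrite [RHS]derive_line.
  have -> // : (fun h : R => F0 (h *: delta_mx 0 i + 0)) =
      (fun h => F (h *: delta_mx 0 i + x0)).
  by apply: funext => h; rewrite /F0 addr0.
move=> x; set y := x - x0.
have -> : F x = F0 y by rewrite /F0 subrK.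
have -> : F x0 = F0 0 by rewrite /F0 add0r.
pose g (t : R) := F0 (0 + t *: y).
have dg (t : R) : is_derive t 1 g ('D_y F0 (0 + t *: y)).
  by apply: line_derive; exact: diff_derivable.
have g'E (t : R) : derive1 g t = \sum_i y 0 i * (t ^+ 0 * 'D_(delta_mx 0 i) F0 (t *: y)).
  rewrite derive1E; have [_ ->] := dg t; rewrite deriveE // diff_sum_partials //.
  by apply: eq_bigr => i _; rewrite expr0 mul1r add0r.
have cy (i : 'I_n) (t : R) :
    {for t, continuous (fun t : R => y 0 i * (t ^+ 0 * 'D_(delta_mx 0 i) F0 (t *: y)))}.
  by apply: continuousM; [exact: cst_continuous | exact: (@wint_cont n 0 _ y (cD i))].
have cg' : continuous (derive1 g).
  rewrite (_ : derive1 g = fun t => \sum_i y 0 i * (t ^+ 0 * 'D_(delta_mx 0 i) F0 (t *: y))).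
    by move=> t; apply: sum_continuous_at => i; exact: cy.
  exact: funext.
have FTC := @continuous_FTC2 R (derive1 g) g 0 1 ltr01.
have {}FTC : (\int[mu]_(t in I01) (derive1 g t)%:E = (g 1)%:E - (g 0)%:E)%E.
  apply: FTC.
  - exact: continuous_subspaceT.
  - split=> [t _||]; first by case: (dg t).
      apply: cvg_at_right_filter; apply: differentiable_continuous.
      by apply/derivable1_diffP; case: (dg 0).
    apply: cvg_at_left_filter; apply: differentiable_continuous.
    by apply/derivable1_diffP; case: (dg 1).
  - by [].
have -> : F0 y = F0 0 + \int[mu]_(t in I01) (derive1 g t).
  rewrite /Rintegral FTC /= /g scale0r scale1r !add0r.
  by rewrite subrKC.
congr (_ + _).
transitivity (\int[mu]_(t in I01)
    \sum_i y 0 i * (t ^+ 0 * 'D_(delta_mx 0 i) F0 (t *: y))).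
  by apply: eq_Rintegral => t _; rewrite g'E.
have m01 : measurable I01 by exact: measurable_itv.
have S (r : seq 'I_n) :
    \int[mu]_(t in I01) (\sum_(i <- r) y 0 i * (t ^+ 0 * 'D_(delta_mx 0 i) F0 (t *: y)))
    = \sum_(i <- r) (x 0 i - x0 0 i) * wint 0 ('D_(delta_mx 0 i) F0) y.
  elim: r => [|i r IH].
    rewrite big_nil; under eq_Rintegral do rewrite big_nil.
    by rewrite unit_integral_cst.
  rewrite big_cons -IH; under eq_Rintegral do rewrite big_cons.
  rewrite RintegralD //.
  - rewrite RintegralZl //; last by apply: unit_integrable; exact: (@wint_cont n 0 _ y (cD i)).
    by rewrite /y !mxE.
  - apply: (unit_integrable (g := fun t => y 0 i * (t ^+ 0 * 'D_(delta_mx 0 i) F0 (t *: y)))) => t.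
    exact: cy.
  - apply: (unit_integrable (g := fun t => \sum_(i <- r) y 0 i * (t ^+ 0 * 'D_(delta_mx 0 i) F0 (t *: y)))) => t.
    by apply: sum_continuous_at => j; exact: cy.
exact: S.
Qed.

End Hadamard.

(** * The inverse function theorem *)

HB.instance Definition _ (R : realType) n := Complete.on 'rV[R]_n.

Section InverseFunction.
Variable R : realType.

Lemma Ck_det k n p (V : set 'rV[R]_n) (A : 'rV[R]_n -> 'M[R]_p) : open V ->
  (forall i j, Ck k V (fun x => A x i j)) -> Ck k V (fun x => \det (A x)).
Proof.
move=> oV CA; rewrite /determinant; apply: Ck_sum => // s.
by apply: CkM; [ | exact: Ck_cst | apply: Ck_prod].
Qed.

Lemma Ck_adj k n p (V : set 'rV[R]_n) (A : 'rV[R]_n -> 'M[R]_p) i j : open V ->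
  (forall i j, Ck k V (fun x => A x i j)) -> Ck k V (fun x => (\adj (A x)) i j).
Proof.
move=> oV CA.
apply: (@Ck_ext _ _ _ _ (fun x => (-1) ^+ (j + i) * \det (row' j (col' i (A x))))) => //.
  by move=> x _; rewrite mxE.
apply: CkM => //; first exact: Ck_cst.
by apply: Ck_det => // a b; apply: Ck_ext (CA (lift j a) (lift i b)) => // x _; rewrite !mxE.
Qed.

Lemma Ck_invmx k n p (V : set 'rV[R]_n) (A : 'rV[R]_n -> 'M[R]_p) i j : open V ->
  (forall x, V x -> A x \in unitmx) ->
  (forall i j, Ck k V (fun x => A x i j)) -> Ck k V (fun x => (invmx (A x)) i j).
Proof.
move=> oV UA CA.
apply: (@Ck_ext _ _ _ _ (fun x => (\det (A x))^-1 * (\adj (A x)) i j)) => //.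
  by move=> x Vx; rewrite /invmx UA // [RHS]mxE.
apply: CkM => //; last exact: Ck_adj.
apply: CkV => //; last exact: Ck_det.
by move=> x /UA; rewrite unitmxE unitfE.
Qed.

Lemma rV_subE n (x y : 'rV[R]_n) j : (x - y) 0 j = x 0 j - y 0 j.
Proof. by rewrite !mxE. Qed.

Lemma mulmx_norm_le m n (A : 'M[R]_(m, n)) : exists2 c : R, 0 < c &
  forall v : 'rV[R]_m, `|v *m A| <= c * `|v|.
Proof.
pose c := \sum_i \sum_j `|A i j|.
have c0 : 0 <= c by apply: sumr_ge0 => i _; apply: sumr_ge0.
exists (c + 1); first by rewrite ltr_wpDl.
move=> v; apply: (@le_trans _ _ (c * `|v|)); last first.
  by rewrite ler_wpM2r // lerDl.
apply: rV_norm_le => [|j]; first by rewrite mulr_ge0.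
rewrite mxE; apply: (le_trans (ler_norm_sum _ _ _)).
rewrite /c mulr_suml; apply: ler_sum => i _; rewrite normrM mulrC.
apply: ler_pM => //; last exact: rV_coord_le.
by rewrite (bigD1 j) //= lerDl sumr_ge0.
Qed.

(** The transposed Jacobian: vectors are rows, and the differential acts on them by multiplication
    from the right. *)
Definition jac n m (F : 'rV[R]_n -> 'rV[R]_m) (x : 'rV[R]_n) : 'M[R]_(n, m) :=
  \matrix_(i, j) 'D_(delta_mx 0 i) (fun z => F z 0 j) x.

Lemma jac_expand n m (F : 'rV[R]_n -> 'rV[R]_m) (x : 'rV[R]_n) (e : R) : 0 < e ->
  (forall j, differentiable (fun z => F z 0 j) x) ->
  exists2 d : R, 0 < d & forall v, `|v| < d ->
    `|F (v + x) - F x - v *m jac F x| <= e * `|v|.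
Proof.
move=> e0 dF.
have : \forall v \near (0 : 'rV[R]_n), forall j,
    `|F (v + x) 0 j - F x 0 j - (v *m jac F x) 0 j| <= e * `|v|.
  apply: (@filter_forall _ _ (fun j v =>
    `|F (v + x) 0 j - F x 0 j - (v *m jac F x) 0 j| <= e * `|v|) (nbhs (0 : 'rV[R]_n))) => j.
  have /diff_locally /eqaddoP /(_ e e0) := dF j.
  apply: filterS => v; rewrite !fctE /= opprD addrA.
  rewrite diff_sum_partials // => h.
  suff -> : (v *m jac F x) 0 j =
     \sum_i v 0 i * 'D_(delta_mx 0 i) (fun z => F z 0 j) x by [].
  by rewrite mxE; apply: eq_bigr => i _; rewrite mxE.
move=> /nbhs_ballP [d /= d0 hd]; exists d => // v vd.
apply: rV_norm_le; first by rewrite mulr_ge0 // ltW.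
move=> j; rewrite !rV_subE; apply: (hd v _ j).
by apply/rV_ballP; rewrite subr0.
Qed.

Lemma det_near n p (V : set 'rV[R]_n) (A : 'rV[R]_n -> 'M[R]_p) x0 : open V -> V x0 ->
  (forall i j, Ck 0 V (fun x => A x i j)) -> A x0 \in unitmx ->
  exists2 r : R, 0 < r & forall x, `|x - x0| < r -> V x /\ A x \in unitmx.
Proof.
move=> oV Vx0 CA; rewrite unitmxE unitfE => U.
have cd := Ck0 (Ck_det oV CA) Vx0.
have nV := open_nbhs_nbhs (conj oV Vx0).
have : \forall x \near x0, V x /\ A x \in unitmx.
  apply: filterI => //.
  have : \forall x \near x0, \det (A x) != 0.
    exact: (cvgr_neq0 _ cd U).
  by apply: filterS => x; rewrite unitmxE unitfE.
move=> /nbhs_ballP [r /= r0 hr]; exists r => // x xr; apply: hr.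
exact/rV_ballP.
Qed.

(* G y is the fixed point of x |-> x - (F x - y) (jac F x0)^-1; its smoothness is
   bootstrapped from jac G = (jac F)^-1 o G. *)
Theorem inverse_function n (V : set 'rV[R]_n) (F : 'rV[R]_n -> 'rV[R]_n) x0 :
  open V -> V x0 -> (forall j, smooth_on V (fun x => F x 0 j)) ->
  jac F x0 \in unitmx ->
  exists (V' W : set 'rV[R]_n) (G : 'rV[R]_n -> 'rV[R]_n),
  [/\ open V' /\ open W, V' `<=` V /\ V' x0,
      forall x, V' x -> W (F x) /\ G (F x) = x,
      forall y, W y -> V' (G y) /\ F (G y) = y &
      forall j, smooth_on W (fun y => G y 0 j)].
Proof.
move=> oV Vx0 sF UJ.
pose A := invmx (jac F x0).
have jacS i j : smooth_on V (fun x => jac F x i j).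
  move=> k; have [_ /(_ i) [_ h]] := sF j k.+1.
  by apply: Ck_ext h => // x _; rewrite mxE.
have dF x : V x -> forall j, differentiable (fun z => F z 0 j) x.
  by move=> Vx j; exact: (Ck_differentiable (k := 0) oV (sF j 1%N) Vx).
have [r1 r10 hr1] := det_near oV Vx0 (fun i j => jacS i j 0%N) UJ.
pose phi x := x - F x *m A.
(* A bound M on all partial derivatives makes each component of [phi] Lipschitz with constant
   [n * M <= 1/2]. *)
pose M : R := (2 * n.+1%:R)^-1.
have M0 : 0 < M by rewrite invr_gt0 mulr_gt0.
have Cphi j : smooth_on V (fun x => phi x 0 j).
  move=> k.
  have := CkD oV (Ck_coord k j oV) (CkM oV (Ck_cst k V (-1))
    (Ck_sum (index_enum 'I_n) oV (fun i => CkM oV (sF i k) (Ck_cst k V (A i j))))).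
  by apply: Ck_ext => // x _; rewrite /phi !mxE mulN1r.
have Dphi x i j : V x -> 'D_(delta_mx 0 i) (fun z => phi z 0 j) x =
    (i == j)%:R - (jac F x *m A) i j.
  move=> Vx.
  have d1 : is_derive x (delta_mx 0 i) (fun z : 'rV[R]_n => z 0 j) (i == j)%:R.
    have := linear_is_derive (delta_mx j 0 : 'cV[R]_n) x (delta_mx 0 i).
    rewrite (_ : (fun y : 'rV[R]_n => _) = fun z : 'rV[R]_n => z 0 j); last first.
      by apply: funext => z; rewrite -colE mxE.
    by rewrite -colE !mxE eqxx eq_sym.
  have d2 : 'D_(delta_mx 0 i) (fun z => (F z *m A) 0 j) x = (jac F x *m A) i j
    /\ derivable (fun z => (F z *m A) 0 j) x (delta_mx 0 i).
    have dA : differentiable (fun y : 'rV[R]_n => (y *m col j A) 0 0) (F x).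
      apply: (Ck_differentiable (k := 0) openT (Ck_linear 1 setT (col j A))).
      by [].
    have dFi l : derivable (fun z => F z 0 l) x (delta_mx 0 i).
      by apply: diff_derivable; exact: dF.
    have [h1 h2] := @derive_comp _ _ _ F (fun y : 'rV[R]_n => (y *m col j A) 0 0)
      x (delta_mx 0 i) dA dFi.
    have E : (fun z => (F z *m A) 0 j) = (fun z => (F z *m col j A) 0 0).
      by apply: funext => z; rewrite !mxE; apply: eq_bigr => l _; rewrite !mxE.
    rewrite E h2; split => //; rewrite [RHS]mxE; apply: eq_bigr => l _.
    have [_ ->] := linear_is_derive (col j A) (F x) (delta_mx 0 l).
    by rewrite -rowE !mxE.
  have [e1 e2] := d2; have [f1 f2] := d1.
  have E : (fun z => phi z 0 j) = (fun z : 'rV[R]_n => z 0 j) - (fun z => (F z *m A) 0 j).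
    by apply: funext => z; rewrite /phi rV_subE.
  by rewrite E (deriveB f1 e2) e1 f2.
have Dphi0 i j : 'D_(delta_mx 0 i) (fun z => phi z 0 j) x0 = 0.
  by rewrite Dphi // /A mulmxV // mxE subrr.
have [r2 r20 hr2] : exists2 r : R, 0 < r & forall x, `|x - x0| < r -> forall i j,
    `|'D_(delta_mx 0 i) (fun z => phi z 0 j) x| <= M.
  have : \forall x \near x0, forall ij : 'I_n * 'I_n,
     `|'D_(delta_mx 0 ij.1) (fun z => phi z 0 ij.2) x| <= M.
    apply: (@filter_forall _ _ (fun (ij : 'I_n * 'I_n) x =>
       `|'D_(delta_mx 0 ij.1) (fun z => phi z 0 ij.2) x| <= M) (nbhs x0)) => -[i j].
    have [_ /(_ i) [_ [h _]]] := Cphi j 1%N.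
    have /cvgrPdist_le /(_ M M0) := h _ Vx0.
    by apply: filterS => x /=; rewrite Dphi0 sub0r normrN.
  move=> /nbhs_ballP [r /= r0 hr]; exists r => // x xr i j.
  by apply: (hr x _ (i, j)); exact/rV_ballP.
pose r := Num.min r1 r2.
have r0 : 0 < r by rewrite lt_min r10.
have rV x : `|x - x0| < r -> V x /\ jac F x \in unitmx.
  by rewrite lt_min => /andP[/hr1].
have lip x y : `|x - x0| < r -> `|y - x0| < r -> `|phi x - phi y| <= 2^-1 * `|x - y|.
  move=> xr yr; apply: rV_norm_le => [|j]; first by rewrite mulr_ge0.
  rewrite rV_subE.
  apply: (@le_trans _ _ (n%:R * M * `|x - y|)).
    apply: (@partials_lipschitz _ _ (fun z => phi z 0 j) x0 r) => //.
      move=> z zr i; have [_ /(_ i) [h _]] := Cphi j 1%N; apply: h.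
      by have [] := rV z zr.
    by move=> z; rewrite lt_min => /andP[_ zr] i; exact: hr2.
  rewrite ler_wpM2r // /M invfM mulrCA ger_pMr //.
  by rewrite ler_pdivrMr // mul1r ler_nat.
have lipF x y : `|x - x0| < r -> `|y - x0| < r ->
    `|x - y| <= 2 * `|(F x - F y) *m A|.
  move=> xr yr; have := lip x y xr yr.
  have -> : phi x - phi y = (x - y) - (F x - F y) *m A.
    rewrite /phi mulmxBl; move: (F x *m A) (F y *m A) => a b.
    by apply/rowP => j; rewrite !mxE; ring.
  have := ler_dist_dist (x - y) ((F x - F y) *m A).
  have := ler_norm (`|x - y| - `|(F x - F y) *m A|).
  by lra.
pose r' := r / 2.
have r'0 : 0 < r' by rewrite divr_gt0.
have r'r : r' < r by rewrite /r' ltr_pdivrMr // ltr_pMr // ltr1n.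
(* Since [phi] is 1/2-Lipschitz near x0, this bound is what makes the map x |-> y A + phi(x)
   preserve the closed ball of radius r' around x0. *)
pose W : set 'rV[R]_n := [set y | `|(y - F x0) *m A| < r' / 2].
pose V' : set 'rV[R]_n := [set x | `|x - x0| < r' /\ W (F x)].
have [c c0 hc] := mulmx_norm_le A.
have surj y : W y -> exists2 x, `|x - x0| < r' & F x = y.
  move=> Wy.
  pose T x := y *m A + phi x.
  pose B : set 'rV[R]_n := [set x | `|x - x0| <= r'].
  have TB0 x : B x -> `|T x - x0| < r'.
    move=> Bx.
    have -> : T x - x0 = (y - F x0) *m A + (phi x - phi x0).
      rewrite /T /phi mulmxBl; move: (F x *m A) (F x0 *m A) (y *m A) => a b e.
      by apply/rowP => j; rewrite !mxE; ring.
    apply: (le_lt_trans (ler_normD _ _)).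
    have := lip x x0 (le_lt_trans Bx r'r); rewrite subrr normr0 => /(_ r0) h.
    have h2 : 2^-1 * `|x - x0| <= r' / 2 by rewrite mulrC ler_wpM2r.
    have {}Wy : `|(y - F x0) *m A| < r' / 2 := Wy.
    by lra.
  have TB : {homo T : x / B x >-> B x} by move=> x /TB0 /ltW.
  pose TT : {fun B >-> B} := HB.pack_for {fun B >-> B} T (isFun.Build _ _ B B T TB).
  have ctr : is_contraction TT.
    exists (2^-1)%:nng; split=> /=; first by rewrite invf_lt1 // ltr1n.
    move=> [a b] [/= Ba Bb].
    have -> : T a - T b = phi a - phi b by rewrite /T opprD addrACA subrr add0r.
    by apply: lip; apply: le_lt_trans r'r.
  have clB : closed B.
    apply: (@closed_comp _ _ (fun x : 'rV[R]_n => `|x - x0|) [set s | s <= r']); last exact: closed_le.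
    move=> x _; apply: (@continuous_comp _ _ _ (fun x : 'rV[R]_n => x - x0) Num.norm).
      by apply: continuousB; [exact: cvg_id | exact: cst_continuous].
    exact: norm_continuous.
  have [|x Bx Tx] := banach_fixed_point ctr clB.
    by exists x0; rewrite /B /= subrr normr0 ltW.
  exists x; first by rewrite Tx; exact: TB0.
  have e : F x *m A = y *m A.
    by move: Tx; rewrite /= /T /phi addrCA => /eqP; rewrite -subr_eq0 opprD addrA subrr sub0r
       opprB subr_eq0 => /eqP.
  by have := congr1 (mulmx^~ (jac F x0)) e; rewrite /A !mulmxKV.
have /choice [G hG] : forall y, exists x, W y -> `|x - x0| < r' /\ F x = y.
  by move=> y; have [/surj [x h1 h2]|] := pselect (W y); [exists x | exists x0].
have oW : open W.
  apply: rV_openP => y Wy.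
  exists ((r' / 2 - `|(y - F x0) *m A|) / c); first by rewrite divr_gt0 // subr_gt0.
  move=> z; rewrite ltr_pdivlMr // => hz; rewrite /W /=.
  have -> : z - F x0 = (z - y) + (y - F x0) by rewrite addrA subrK.
  rewrite mulmxDl (le_lt_trans (ler_normD _ _)) // -ltrBrDr.
  by apply: le_lt_trans hz; rewrite mulrC.
have GF x : V' x -> G (F x) = x.
  move=> [xr Wx]; have [h1 h2] := hG _ Wx.
  apply/eqP; rewrite -subr_eq0 -normr_le0.
  apply: (le_trans (lipF _ _ _ _)); try exact: lt_trans r'r.
  by rewrite h2 subrr mul0mx normr0 mulr0.
have GV y : W y -> V' (G y) /\ F (G y) = y.
  by move=> Wy; have [h1 h2] := hG _ Wy; split; rewrite // /V' /= h2.
have Gr y : W y -> `|G y - x0| < r by move=> /hG [h _]; exact: lt_trans r'r.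
have Glip y z : W y -> W z -> `|G z - G y| <= 2 * c * `|z - y|.
  move=> Wy Wz; apply: (le_trans (lipF _ _ (Gr _ Wz) (Gr _ Wy))).
  have [_ ->] := hG _ Wy; have [_ ->] := hG _ Wz.
  by rewrite -mulrA ler_wpM2l.
have Gder y i j : W y -> is_derive y (delta_mx 0 i) (fun z => G z 0 j)
    (invmx (jac F (G y)) i j).
  move=> Wy; set x := G y; pose B := invmx (jac F x).
  have [Vx Ux] := rV x (Gr _ Wy).
  have [cB cB0 hcB] := mulmx_norm_le B.
  (* Put v = G(y + h e_i) - G(y). Differentiability of F at x gives h e_i = v J + o(|v|) with J the
     Jacobian at x; multiply by B = J^-1. As |v| <= 2c|h|, the constant e' is chosen to make the
     error at most e |h|. *)
  have key : (fun h : R => h^-1 *: (((fun z => G z 0 j) \o shift y) (h *: delta_mx 0 i)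
      - G y 0 j)) @ 0^' --> B i j.
    apply/cvgrPdist_le => e e0.
    pose e' := e / (cB * (2 * c)).
    have e'0 : 0 < e' by rewrite divr_gt0 // !mulr_gt0.
    have [d d0 hd] := jac_expand e'0 (dF x Vx).
    have [rw rw0 hrw] := rV_open_ball oW Wy.
    have nd : `|delta_mx 0 i : 'rV[R]_n| <= 1.
      by apply: rV_norm_le => // l; rewrite mxE eqxx /=; case: eqP; rewrite ?normr1 ?normr0.
    near=> h.
    have h0 : h != 0 by near: h; exact: nbhs_dnbhs_neq.
    have hh : `|h *: (delta_mx 0 i : 'rV[R]_n)| <= `|h|.
      by rewrite normrZ ler_piMr.
    have h1 : `|h| < rw by near: h; apply: dnbhs0_lt.
    have h2 : `|h| < d / (2 * c) by near: h; apply: dnbhs0_lt; rewrite divr_gt0 // mulr_gt0.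
    set z := h *: delta_mx 0 i + y.
    have zy : z - y = h *: delta_mx 0 i by rewrite /z addrK.
    have Wz : W z by apply: hrw; rewrite zy (le_lt_trans hh).
    pose v := G z - x.
    have vle : `|v| <= 2 * c * `|h|.
      by apply: (le_trans (Glip _ _ Wy Wz)); rewrite zy ler_wpM2l // mulr_ge0 // ltW.
    have vd : `|v| < d.
      by apply: (le_lt_trans vle); rewrite mulrC -ltr_pdivlMr // mulr_gt0.
    have := hd v vd; rewrite /v subrK; have [_ ->] := hG _ Wz; have [_ ->] := hG _ Wy.
    rewrite zy -/v => hv.
    have hv2 : `|(h *: delta_mx 0 i - v *m jac F x) *m B| <= cB * (e' * (2 * c * `|h|)).
      apply: (le_trans (hcB _)); apply: ler_wpM2l; first exact: ltW.
      by apply: (le_trans hv); apply: ler_wpM2l => //; exact: ltW.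
    have := le_trans (rV_coord_le _ j) hv2.
    rewrite mulmxBl -mulmxA mulmxV // mulmx1 -scalemxAl -rowE !mxE => hv4.
    have hp : 0 < `|h| by rewrite normr_gt0.
    rewrite -(ler_pM2l hp) -normrM mulrBr.
    have -> : h * (h^-1 *: (((fun z => G z 0 j) \o shift y) (h *: delta_mx 0 i) - G y 0 j))
      = G z 0 j - x 0 j by rewrite /= [_ *: _]mulrC mulrCA mulfV // mulr1.
    apply: (le_trans hv4).
    have -> : cB * (e' * (2 * c * `|h|)) = `|h| * e; last by [].
    by rewrite /e'; field; rewrite !gt_eqF.
  by split; [apply/cvg_ex; exists (B i j) | exact: cvg_lim key].
have GC k j : Ck k W (fun y => G y 0 j).
  have c0' j' y : W y -> {for y, continuous (fun y => G y 0 j')}.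
    move=> Wy; apply/(@cvgrPdist_le _ _ _ (nbhs y) (nbhs_filter y)) => e e0.
    have [rw rw0 hrw] := rV_open_ball oW Wy.
    have c20 : 0 < 2 * c by rewrite mulr_gt0.
    apply/nbhs_ballP; exists (Num.min rw (e / (2 * c))); first by rewrite /= lt_min rw0 divr_gt0.
    move=> z /rV_ballP; rewrite lt_min => /andP[/hrw Wz]; rewrite ltr_pdivlMr // => hz.
    have h := rV_coord_le (G z - G y) j'; rewrite rV_subE in h.
    rewrite distrC; apply: (le_trans h).
    by apply: (le_trans (Glip _ _ Wy Wz)); rewrite mulrC ltW.
  elim: k j => [|k IH] j; split=> //; try by move=> y; exact: c0'.
  move=> i; split=> [y Wy|]; first by case: (Gder y i j Wy).
  apply: (@Ck_ext _ _ _ _ (fun y => invmx (jac F (G y)) i j)) => //.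
    by move=> y Wy; case: (Gder y i j Wy).
  apply: (Ck_invmx (A := fun y => jac F (G y))) => //.
    by move=> y /Gr /rV [].
  move=> a b; apply: (Ck_comp (F := fun x => jac F x a b)) (jacS a b k) => //.
  by move=> y /Gr /rV [].
exists V', W, G; split=> //.
- split=> //; apply: rV_openP => x [xr Wx].
  have [rw rw0 hrw] := rV_open_ball oW Wx.
  have [Vx _] := rV x (lt_trans xr r'r).
  have cF : {for x, continuous F}.
    apply/(@cvgrPdist_le _ _ _ (nbhs x) (nbhs_filter x)) => e e0.
    have : \forall z \near x, forall j, `|F x 0 j - F z 0 j| <= e.
      apply: (@filter_forall _ _ (fun j z => `|F x 0 j - F z 0 j| <= e) (nbhs x)) => j.
      by have /cvgrPdist_le /(_ _ e0) := Ck0 (sF j 0%N) Vx.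
    apply: filterS => z hz; apply: rV_norm_le; first exact: ltW.
    by move=> j; rewrite !mxE.
  have /nbhs_ballP [d /= d0 hd] : \forall z \near x, `|F x - F z| < rw.
    by have /cvgrPdist_lt /(_ _ rw0) := cF.
  exists (Num.min d (r' - `|x - x0|)); first by rewrite lt_min d0 subr_gt0.
  move=> z; rewrite lt_min => /andP[zd zr]; split.
    have -> : z - x0 = (z - x) + (x - x0) by rewrite addrA subrK.
    by rewrite (le_lt_trans (ler_normD _ _)) // -ltrBrDr.
  apply: hrw; rewrite distrC; apply: hd; exact/rV_ballP.
- split=> [x [xr _]|]; first by have [] := rV x (lt_trans xr r'r).
  by rewrite /V' /= subrr normr0; split=> //; rewrite /W /= subrr mul0mx normr0 divr_gt0.
- by move=> x Vx; split; [case: Vx | exact: GF].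
- by move=> j k; exact: GC.
Unshelve. all: by end_near.
Qed.

End InverseFunction.

(** * Smooth functions and tangent vectors *)

Section DifferentiableSpaces.
Variable R : realType.

Lemma open_forall (T : topologicalType) (k : nat) (U : 'I_k -> set T) :
  (forall i, open (U i)) -> open [set y | forall i, U i y].
Proof.
move=> oU; rewrite openE => y Uy; rewrite /interior.
apply: (@filter_forall _ _ U (nbhs y)) => i.
exact: open_nbhs_nbhs (conj (oU i) (Uy i)).
Qed.

Lemma Ck_preimage_open n m (W : set 'rV[R]_n) (V : set 'rV[R]_m)
    (H : 'rV[R]_n -> 'rV[R]_m) : open W -> open V ->
  (forall j, Ck 0 W (fun x => H x 0 j)) -> open [set y | W y /\ V (H y)].
Proof.
move=> oW oV CH; apply: rV_openP => x [Wx Vx].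
have [rw rw0 hrw] := rV_open_ball oV Vx.
have [rx rx0 hrx] := rV_open_ball oW Wx.
have e0 : 0 < rw / 2 by rewrite divr_gt0.
have : \forall z \near x, forall j, `|H x 0 j - H z 0 j| <= rw / 2.
  apply: (@filter_forall _ _ (fun j z => `|H x 0 j - H z 0 j| <= rw / 2) (nbhs x)) => j.
  by have /cvgrPdist_le /(_ _ e0) := Ck0 (CH j) Wx.
move=> /nbhs_ballP [d /= d0 hd]; exists (Num.min d rx); first by rewrite lt_min d0.
move=> z; rewrite lt_min => /andP[zd /hrx Wz]; split=> //; apply: hrw.
rewrite distrC; apply: (@le_lt_trans _ _ (rw / 2)).
  apply: rV_norm_le => [|j]; first exact: ltW.
  by rewrite rV_subE; apply: hd; exact/rV_ballP.
by rewrite ltr_pdivrMr // ltr_pMr // ltr1n.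
Qed.

(** [chi] is a cutoff living in a ball inside V, and b is nonzero only where [chi] is 1. Thus
    [chi * F] is globally smooth and agrees with F on the neighbourhood {b <> 0} of y0; as a
    nonvanishing set, this neighbourhood can be pulled back to any space along smooth functions. *)
Lemma rV_bump n (V : set 'rV[R]_n) (y0 : 'rV[R]_n) : open V -> V y0 ->
  exists (chi b : 'rV[R]_n -> R) (r : R),
  [/\ smooth_on setT chi /\ smooth_on setT b,
      b y0 <> 0 /\ 0 < r, forall y, `|y - y0| <= r -> V y,
      (forall y, chi y <> 0 -> `|y - y0| < r) /\
      (forall y, b y <> 0 -> chi y = 1) &
      forall F, smooth_on V F -> smooth_on setT (fun y => chi y * F y)].
Proof.
move=> oV Vy0; have [r2 r20 hr2] := rV_open_ball oV Vy0.
pose r := r2 / 2; have r0 : 0 < r by rewrite divr_gt0.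
have rr2 : r < r2 by rewrite /r ltr_pdivrMr // ltr_pMr // ltr1n.
(* Nonzero only on the open cube of radius r around y0, which is the ball of the maximum norm. *)
pose rb (y : 'rV[R]_n) := \prod_i flat 0 (r ^+ 2 - (y 0 i - y0 0 i) ^+ 2).
pose c := rb y0.
have c0 : 0 < c.
  by apply: prodr_gt0 => i _; rewrite subrr expr0n subr0 flat_gt0 // exprn_gt0.
have oT := @openT 'rV[R]_n.
have Crb : smooth_on setT rb.
  move=> k; apply: Ck_prod => // i; apply: Ck_flat => //.
  have Cd : Ck k setT (fun y : 'rV[R]_n => y 0 i - y0 0 i).
    by apply: CkD => //; [exact: Ck_coord | exact: Ck_cst].
  have := CkD oT (Ck_cst k setT (r ^+ 2)) (CkM oT (Ck_cst k setT (-1)) (CkM oT Cd Cd)).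
  by apply: Ck_ext => // y _; rewrite mulN1r expr2.
have rbr y : rb y <> 0 -> `|y - y0| < r.
  move=> rby; rewrite ltNge; apply/negP => ry.
  have : exists i, r <= `|y 0 i - y0 0 i|.
    apply: contrapT => /forallNP h.
    have : forall i, `|(y - y0) 0 i| < r by move=> i; rewrite rV_subE ltNge; apply/negP.
    move=> {}h; have n0 : 0 <= Num.max 0 (\big[Num.max/0]_i `|(y - y0) 0 i|).
      by rewrite le_max lexx.
    have : `|y - y0| <= \big[Num.max/0]_i `|(y - y0) 0 i|.
      apply: rV_norm_le => [|i]; last exact: le_bigmax.
      exact: bigmax_ge_id.
    have lt : \big[Num.max/0]_i `|(y - y0) 0 i| < r by apply/bigmax_ltP; split.
    by move=> /le_lt_trans /(_ lt); rewrite ltNge ry.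
  move=> [i hi]; apply: rby; rewrite /rb (bigD1 i) //= flat_eq0 ?mul0r //.
  rewrite subr_le0 -[X in _ <= X]real_normK ?num_real //.
  by rewrite ler_sqr ?nnegrE // ltW.
(* Here [c = rb y0]: the cutoff equals 1 where rb >= c/2, and the bump is positive exactly where rb
   > c/2. *)
exists (fun y => step (2 / c * rb y)), (fun y => flat 0 (rb y - c / 2)), r.
have Cchi : smooth_on setT (fun y => step (2 / c * rb y)).
  move=> k; apply: Ck_step => //; apply: CkM => //; exact: Ck_cst.
have chir y : step (2 / c * rb y) <> 0 -> `|y - y0| < r.
  move=> h; apply: rbr => rb0; apply: h; rewrite rb0 mulr0 step0 //.
split=> //.
- split=> // k; apply: Ck_flat => //.
  have := CkD oT (Crb k) (Ck_cst k setT (- (c / 2))).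
  exact: Ck_ext.
- split=> //; apply/eqP; rewrite gt_eqF // flat_gt0 // -/c subr_gt0.
  by rewrite ltr_pdivrMr // ltr_pMr // ltr1n.
- by move=> y yr; apply: hr2; exact: le_lt_trans rr2.
- split=> // y by0; apply: step1.
  have h : 0 < rb y - c / 2.
    by rewrite ltNge; apply/negP => h; apply: by0; exact: flat_eq0.
  rewrite mulrAC ler_pdivlMr // mul1r; move: h; rewrite subr_gt0 ltr_pdivrMr //.
  by rewrite mulrC => /ltW.
move=> F sF k; apply: Ck_local => y _.
have [yr|yr] := ltP `|y - y0| r2.
  exists (V `&` ball y0 r2); first by split; [exact: hr2 | exact/rV_ballP].
  have oB : open (V `&` ball y0 r2) by apply: openI => //; exact: ball_open.
  apply: CkM => //; first by apply: Ck_sub (Cchi k) => //.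
  by apply: Ck_sub (sF k) => z [].
exists [set z | r < `|z - y0|]; first by rewrite /= (lt_le_trans rr2).
have oB : open [set z : 'rV[R]_n | r < `|z - y0|].
  apply: rV_openP => z /= zr; exists (`|z - y0| - r); first by rewrite subr_gt0.
  move=> w wz; have := ler_normD (w - y0) (z - w).
  have -> : w - y0 + (z - w) = z - y0 by rewrite addrC addrA subrK.
  by rewrite distrC in wz; lra.
apply: Ck_ext (Ck_cst k _ 0) => // z /= zr.
suff -> : step (2 / c * rb z) = 0 by rewrite mul0r.
apply: contrapT => /chir; rewrite ltNge => /negP; apply; exact: ltW.
Qed.

Local Notation space := (space R).

(** The axiom of a differential space in the sense of Sikorski. Manifolds, products and subspaces
    satisfy it, and it yields both the ring operations on smooth functions and the locality of
    smoothness. *)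
Definition dspace (M : space) := gen_smooth (@smooth R M) `<=` @smooth R M.

Lemma sub_gen_smooth (X : Type) (G : set (X -> R)) : G `<=` gen_smooth G.
Proof.
move=> g Gg p; exists 1%N, (fun=> g), setT, (fun y => y 0 0); split=> //.
- exact: openT.
- by move=> k; apply: Ck_coord; exact: openT.
- by move=> q _; rewrite mxE.
Qed.

(** Near p each outer function is a smooth function of its own finite list of generators. The lists
    are concatenated into one vector, indexed by the dependent pairs [T], and the smooth functions
    are composed. *)
Lemma gen_smooth_idem (X : Type) (G : set (X -> R)) :
  gen_smooth (gen_smooth G) `<=` gen_smooth G.
Proof.
move=> g Gg p; have [k [f [V [F [Gf oV Vf sF gF]]]]] := Gg p.
(* The number of generators depends on i, so the data are packed into a sigma type before
   choosing. *)
have /choice [K hK] : forall i, exists K : {k : nat & ('I_k -> X -> R) *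
    set 'rV[R]_k * ('rV[R]_k -> R)}%type, let: existT k (f', V', F') := K in
    [/\ forall i, G (f' i), open V', V' (\row_j f' j p), smooth_on V' F' &
        forall q, V' (\row_j f' j q) -> f i q = F' (\row_j f' j q)].
  move=> i; have [k' [f' [V' [F' h]]]] := Gf i p.
  by exists (existT _ k' (f', V', F')).
pose kk i := projT1 (K i).
pose ff i : 'I_(kk i) -> X -> R := (projT2 (K i)).1.1.
pose VV i : set 'rV[R]_(kk i) := (projT2 (K i)).1.2.
pose FF i : 'rV[R]_(kk i) -> R := (projT2 (K i)).2.
have {}hK i : [/\ forall j, G (ff i j), open (VV i), VV i (\row_j ff i j p),
     smooth_on (VV i) (FF i) &
     forall q, VV i (\row_j ff i j q) -> f i q = FF i (\row_j ff i j q)].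
  by move: (hK i); rewrite /ff /VV /FF /kk; case: (K i) => k' [[f' V'] F'].
pose T : finType := {i : 'I_k & 'I_(kk i)}.
pose cd i (y : 'rV[R]_#|T|) : 'rV[R]_(kk i) :=
  \row_j y 0 (enum_rank (existT (fun i => 'I_(kk i)) i j : T)).
have Ccd (W : set 'rV[R]_#|T|) i j l : open W -> Ck l W (fun y => cd i y 0 j).
  by move=> oW; apply: Ck_ext (Ck_coord l _ oW) => // y _; rewrite mxE.
pose W := [set y : 'rV[R]_#|T| | forall i, VV i (cd i y)].
have oW : open W.
  apply: open_forall => i; have [_ oVi _ _ _] := hK i.
  have := Ck_preimage_open openT oVi (fun j => Ccd _ i j 0%N openT).
  by congr (open _); apply: funext => y; apply: propext; split => [[]|].
pose H (y : 'rV[R]_#|T|) := \row_i FF i (cd i y).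
have CH l j : Ck l W (fun y => H y 0 j).
  have [_ oVj _ sFj _] := hK j.
  apply: (@Ck_ext _ _ _ _ (fun y => FF j (cd j y))) => //.
    by move=> y _; rewrite mxE.
  by apply: (Ck_comp (W := VV j)) => //; move=> i; exact: Ccd.
pose fT (t : 'I_#|T|) : X -> R := let t' := enum_val t in ff (tag t') (tagged t').
have cdE q i : cd i (\row_t fT t q) = \row_j ff i j q.
  by apply/rowP => j; rewrite !mxE /fT enum_rankK.
have HE q : W (\row_t fT t q) -> H (\row_t fT t q) = \row_i f i q.
  move=> Wq; apply/rowP => i; rewrite !mxE cdE.
  by have [_ _ _ _ ->] := hK i => //; rewrite -cdE.
have Wp : W (\row_t fT t p) by move=> i; rewrite cdE; have [] := hK i.
exists #|T|, fT, [set y | W y /\ V (H y)], (fun y => F (H y)); split.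
- by move=> t; rewrite /fT; have [] := hK (tag (enum_val t)).
- by apply: Ck_preimage_open => // j; exact: CH.
- by split=> //; rewrite HE.
- move=> l; apply: (Ck_comp (W := V)) => //.
  + by apply: Ck_preimage_open => // j; exact: CH.
  + by move=> y [].
  + by move=> j; apply: Ck_sub (CH l j) => y [].
- by move=> q [Wq]; rewrite /= (HE _ Wq) => Vq; exact: gF.
Qed.

Lemma dspace_gen X (G : set (X -> R)) : dspace (Space (gen_smooth G)).
Proof. exact: gen_smooth_idem. Qed.

Lemma dspace_prod (M N : space) : dspace (prod_space M N).
Proof. exact: dspace_gen. Qed.

Lemma dspace_sub (M : space) (P : M -> Prop) : dspace (sub_space P).
Proof. exact: dspace_gen. Qed.

End DifferentiableSpaces.

Notation push1 := (@push _ (prod_space _ _) _ fst).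
Notation push2 := (@push _ (prod_space _ _) _ snd).
Notation pushv P := (@push _ (sub_space P) _ sval).

(** * The algebra of smooth functions, derivations and tangent maps *)

Section SmoothFunctions.
Variable R : realType.
Local Notation space := (space R).
Implicit Types M N P : space.

Lemma smooth_compV M k (f : 'I_k -> M -> R) (V : set 'rV[R]_k) (F : 'rV[R]_k -> R)
    (g : M -> R) : dspace M ->
  (forall i, smooth (f i)) -> open V -> smooth_on V F ->
  (forall q, V (\row_i f i q) /\ g q = F (\row_i f i q)) -> smooth g.
Proof.
move=> dM sf oV sF h; apply: dM => p; exists k, f, V, F.
by split=> // [|q _]; [case: (h p) | case: (h q)].
Qed.

Lemma smooth_compT M k (f : 'I_k -> M -> R) (F : 'rV[R]_k -> R) : dspace M ->
  (forall i, smooth (f i)) -> smooth_on setT F ->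
  smooth (fun q => F (\row_i f i q)).
Proof.
move=> dM sf sF; apply: (smooth_compV (f := f) (V := setT) (F := F)) => //.
exact: openT.
Qed.

Lemma open_neq0 n (W : set 'rV[R]_n) (F : 'rV[R]_n -> R) : open W ->
  Ck 0 W F -> open [set y | W y /\ F y <> 0].
Proof.
move=> oW CF.
have := @Ck_preimage_open R n 1 W (fun s => s 0 0 <> 0) (fun y => \row__ F y) oW.
have E : [set y | W y /\ ((\row__ F y) : 'rV[R]_1) 0 0 <> 0] = [set y | W y /\ F y <> 0].
  by apply: funext => y; rewrite /= mxE.
rewrite E; apply.
  apply: rV_openP => s /eqP s0; exists `|s 0 0|; first by rewrite normr_gt0.
  move=> t ts t0.
  have := rV_coord_le (t - s) 0; rewrite rV_subE t0 sub0r normrN => /le_lt_trans /(_ ts).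
  by rewrite ltxx.
by move=> j; apply: Ck_ext CF => // y _; rewrite mxE.
Qed.

(** The sets {h <> 0} act as neighbourhoods: on such a set g is the second coordinate of the pair
    [(h, g')], and that pair takes values in the open set where the first coordinate is nonzero. *)
Lemma smooth_loc M (g : M -> R) : dspace M ->
  (forall p, exists (h g' : M -> R), [/\ smooth h, smooth g', h p <> 0 &
     forall q, h q <> 0 -> g q = g' q]) -> smooth g.
Proof.
move=> dM loc; apply: dM => p; have [h [g' [sh sg hp gg']]] := loc p.
have oV : open [set y : 'rV[R]_2 | setT y /\ y 0 0 <> 0].
  by apply: open_neq0; [exact: openT | apply: Ck_coord; exact: openT].
exists 2%N, (fun i => if i == 0 then h else g'), [set y | setT y /\ y 0 0 <> 0],
  (fun y => y 0 1); split=> //.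
- by move=> i; case: ifP.
- by split=> //=; rewrite mxE.
- by move=> k; apply: Ck_coord.
- by move=> q [_]; rewrite !mxE eqxx /=; exact: gg'.
Qed.

Lemma smoothC M (c : R) : dspace M -> smooth (fun _ : M => c).
Proof.
move=> dM; apply: (smooth_compT (k := 0) (f := fun _ _ => 0) (F := fun=> c)) => //.
  by case.
by move=> k; exact: Ck_cst.
Qed.

Lemma smooth_comp2 M (f g : M -> R) (F : R -> R -> R) : dspace M ->
  smooth_on setT (fun y : 'rV[R]_2 => F (y 0 0) (y 0 1)) ->
  smooth f -> smooth g -> smooth (fun q => F (f q) (g q)).
Proof.
move=> dM sF sf sg.
have := smooth_compT (f := fun i : 'I_2 => if i == 0 then f else g) dM _ sF.
rewrite (_ : (fun q => _) = (fun q => F (f q) (g q))).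
  by apply; move=> i; case: ifP.
by apply: funext => q; rewrite !mxE.
Qed.

Lemma smoothD M (f g : M -> R) : dspace M ->
  smooth f -> smooth g -> smooth (fun q => f q + g q).
Proof.
move=> dM; apply: (smooth_comp2 (F := fun a b => a + b)) => // k.
by apply: CkD; [exact: openT|apply: Ck_coord; exact: openT..].
Qed.

Lemma smoothM M (f g : M -> R) : dspace M ->
  smooth f -> smooth g -> smooth (fun q => f q * g q).
Proof.
move=> dM; apply: (smooth_comp2 (F := fun a b => a * b)) => // k.
by apply: CkM; [exact: openT|apply: Ck_coord; exact: openT..].
Qed.

Lemma smoothN M (f : M -> R) : dspace M -> smooth f -> smooth (fun q => - f q).
Proof.
move=> dM sf; have := smoothM dM (smoothC (-1) dM) sf.
by congr smooth; apply: funext => q; rewrite mulN1r.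
Qed.

Lemma smoothB M (f g : M -> R) : dspace M ->
  smooth f -> smooth g -> smooth (fun q => f q - g q).
Proof. by move=> dM sf sg; apply: smoothD => //; exact: smoothN. Qed.

Lemma smooth_comp1 M (f : M -> R) (F : R -> R) : dspace M ->
  smooth_on setT (fun y : 'rV[R]_1 => F (y 0 0)) ->
  smooth f -> smooth (fun q => F (f q)).
Proof.
move=> dM sF sf.
have := smooth_compT (f := fun i : 'I_1 => f) dM _ sF.
rewrite (_ : (fun q => _) = (fun q => F (f q))); first by apply.
by apply: funext => q; rewrite !mxE.
Qed.

Lemma smooth_flat M m (f : M -> R) : dspace M -> smooth f -> smooth (fun q => flat m (f q)).
Proof.
move=> dM; apply: smooth_comp1 => // k.
by apply: Ck_flat; [exact: openT | apply: Ck_coord; exact: openT].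
Qed.

Lemma smooth_step M (f : M -> R) : dspace M -> smooth f -> smooth (fun q => step (f q)).
Proof.
move=> dM; apply: smooth_comp1 => // k.
by apply: Ck_step; [exact: openT | apply: Ck_coord; exact: openT].
Qed.

Lemma smooth_sum M (I : Type) (r : seq I) (f : I -> M -> R) : dspace M ->
  (forall i, smooth (f i)) -> smooth (fun q => \sum_(i <- r) f i q).
Proof.
move=> dM sf; elim: r => [|i r IH].
  by have := smoothC 0 dM; congr smooth; apply: funext => q; rewrite big_nil.
by have := smoothD dM (sf i) IH; congr smooth; apply: funext => q; rewrite big_cons.
Qed.

Lemma smooth_prod M (I : Type) (r : seq I) (f : I -> M -> R) : dspace M ->
  (forall i, smooth (f i)) -> smooth (fun q => \prod_(i <- r) f i q).
Proof.
move=> dM sf; elim: r => [|i r IH].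
  by have := smoothC 1 dM; congr smooth; apply: funext => q; rewrite big_nil.
by have := smoothM dM (sf i) IH; congr smooth; apply: funext => q; rewrite big_cons.
Qed.

Lemma smooth_det M n (A : M -> 'M[R]_n) : dspace M ->
  (forall i j, smooth (fun q => A q i j)) -> smooth (fun q => \det (A q)).
Proof.
move=> dM sA; apply: smooth_sum => // s.
by apply: smoothM => //; [exact: smoothC | apply: smooth_prod].
Qed.

Lemma smooth_adj M n (A : M -> 'M[R]_n) i j : dspace M ->
  (forall i j, smooth (fun q => A q i j)) -> smooth (fun q => (\adj (A q)) i j).
Proof.
move=> dM sA.
have := smoothM dM (smoothC ((-1) ^+ (j + i)) dM)
  (smooth_det (A := fun q => row' j (col' i (A q))) dM _).
rewrite (_ : (fun q => _) = (fun q => (\adj (A q)) i j)); last first.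
  by apply: funext => q; rewrite [RHS]mxE.
apply => a b; have := sA (lift j a) (lift i b).
by congr smooth; apply: funext => q; rewrite !mxE.
Qed.

Lemma tangent_comb M (p : M) a u v : tangent p u -> tangent p v ->
  tangent p (comb a u v).
Proof.
move=> tu tv; split.
- by move=> f nf; rewrite /comb (tangent_junk tu nf) (tangent_junk tv nf) mulr0 addr0.
- by move=> c f g sf sg; rewrite /comb (tangent_lin tu) // (tangent_lin tv) //; ring.
- by move=> f g sf sg; rewrite /comb (tangent_leibniz tu) // (tangent_leibniz tv) //; ring.
Qed.

Lemma tangent_vec0 M (p : M) : tangent p (@vec0 R M).
Proof.
by split=> *; rewrite /vec0 ?(mulr0, mul0r, addr0).
Qed.

Lemma tangent_eq M (p : M) u v : tangent p u -> tangent p v ->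
  (forall f, smooth f -> u f = v f) -> u = v.
Proof.
move=> tu tv h; apply: funext => f; have [/h //|nf] := pselect (smooth f).
by rewrite (tangent_junk tu) // (tangent_junk tv).
Qed.

Lemma tangentC M (p : M) u (c : R) : dspace M -> tangent p u -> u (fun=> c) = 0.
Proof.
move=> dM tu; have s0 := smoothC 0 dM; have s1 := smoothC 1 dM.
have u0 : u (fun=> 0) = 0.
  have := tangent_lin tu 1 s0 s0.
  rewrite (_ : (fun _ => _) = fun=> 0); last by apply: funext => q; rewrite mulr0 addr0.
  by rewrite mul1r => /eqP; rewrite -subr_eq0 opprD addrA subrr sub0r oppr_eq0 => /eqP.
have u1 : u (fun=> 1) = 0.
  have := tangent_leibniz tu s1 s1.
  rewrite (_ : (fun _ => _) = fun=> 1); last by apply: funext => q; rewrite mulr1.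
  rewrite mul1r mulr1 => /eqP; rewrite -subr_eq0 opprD addrA subrr sub0r oppr_eq0.
  by move/eqP.
have := tangent_lin tu c s1 s0.
rewrite (_ : (fun _ => _) = fun=> c); last by apply: funext => q; rewrite mulr1 addr0.
by rewrite u1 u0 mulr0 addr0.
Qed.

Lemma tangentD M (p : M) u f g : tangent p u -> smooth f -> smooth g ->
  u (fun x => f x + g x) = u f + u g.
Proof.
move=> tu sf sg; have := tangent_lin tu 1 sf sg; rewrite mul1r => <-.
by congr u; apply: funext => q; rewrite mul1r.
Qed.

Lemma tangentZ M (p : M) u c f : dspace M -> tangent p u -> smooth f ->
  u (fun x => c * f x) = c * u f.
Proof.
move=> dM tu sf; have := tangent_lin tu c sf (smoothC 0 dM).
by rewrite (tangentC _ dM tu) addr0 => <-; congr u; apply: funext => q; rewrite addr0.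
Qed.

Lemma tangentB M (p : M) u f g : dspace M -> tangent p u -> smooth f -> smooth g ->
  u (fun x => f x - g x) = u f - u g.
Proof.
move=> dM tu sf sg; have sg' := smoothN dM sg.
rewrite (tangentD tu sf sg'); congr (_ + _).
rewrite -[RHS]mulN1r -(tangentZ _ dM tu) //.
by congr u; apply: funext => q; rewrite mulN1r.
Qed.

Lemma tangent_sum M (p : M) u (I : Type) (r : seq I) (f : I -> M -> R) :
  dspace M -> tangent p u -> (forall i, smooth (f i)) ->
  u (fun x => \sum_(i <- r) f i x) = \sum_(i <- r) u (f i).
Proof.
move=> dM tu sf; elim: r => [|i r IH].
  rewrite big_nil; have := tangentC 0 dM tu; congr (u _ = _).
  by apply: funext => q; rewrite big_nil.
rewrite big_cons -IH -(tangentD tu) //; last exact: smooth_sum.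
by congr u; apply: funext => q; rewrite big_cons.
Qed.

(** Derivations are local: apply the Leibniz rule to h f = h g and cancel h(p). *)
Lemma tangent_loc M (p : M) u f g h : tangent p u -> smooth f -> smooth g ->
  smooth h -> h p <> 0 -> (forall q, h q <> 0 -> f q = g q) -> u f = u g.
Proof.
move=> tu sf sg sh hp fg.
have E : (fun x => h x * f x) = (fun x => h x * g x).
  apply: funext => q; have [->|/eqP hq] := eqVneq (h q) 0; first by rewrite !mul0r.
  by rewrite fg.
have := congr1 u E; rewrite !(tangent_leibniz tu) // (fg p hp) => /addIr.
by apply: mulfI; exact/eqP.
Qed.

(** Cut F off to a global function, expand it at y0 by Hadamard's lemma and apply the Leibniz rule:
    only the terms in which u differentiates [f i - y0 0 i] survive. *)
Lemma tangent_chain M (p : M) u k (f : 'I_k -> M -> R) (V : set 'rV[R]_k)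
    (F : 'rV[R]_k -> R) (g : M -> R) : dspace M -> tangent p u ->
  (forall i, smooth (f i)) -> smooth g -> open V -> V (\row_i f i p) ->
  smooth_on V F -> (forall q, V (\row_i f i q) -> g q = F (\row_i f i q)) ->
  u g = \sum_i 'D_(delta_mx 0 i) F (\row_i f i p) * u (f i).
Proof.
move=> dM tu sf sg oV Vp sF gF; set y0 := \row_i f i p.
have [chi [b [r [[sc sb] [bp r0] rV [cr bc] hF]]]] := rV_bump oV Vp.
pose Fc y := chi y * F y.
have sFc : smooth_on setT Fc := hF F sF.
have [G [sG [G0 hG]]] := hadamard y0 sFc.
pose ff q : 'rV[R]_k := \row_i f i q.
have sffT (H : 'rV[R]_k -> R) : smooth_on setT H -> smooth (fun q => H (ff q)).
  exact: smooth_compT.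
have bV y : b y <> 0 -> V y.
  move=> by0; apply: rV; apply/ltW/cr; rewrite (bc y by0); apply/eqP; exact: oner_neq0.
have -> : u g = u (fun q => Fc (ff q)).
  apply: (tangent_loc (h := fun q => b (ff q)) tu) => //; try exact: sffT.
  by move=> q bq; rewrite /Fc (bc _ bq) mul1r gF //; exact: bV.
have nb : \forall y \near y0, b y != 0.
  have cb : {for y0, continuous b} by apply: (Ck0 (sb 0%N)).
  by apply: (cvgr_neq0 _ cb); apply/eqP.
have D0 i : 'D_(delta_mx 0 i) F y0 = 'D_(delta_mx 0 i) Fc y0.
  apply: near_eq_derive; apply: filterS nb => y /eqP /bc cy.
  by rewrite /Fc cy mul1r.
have sfi i : smooth (fun q => f i q - y0 0 i) by apply: smoothB => //; exact: smoothC.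
have sGi i : smooth (fun q => G i (ff q)) by exact: sffT.
have -> : (fun q => Fc (ff q)) =
   (fun q => Fc y0 + \sum_i (f i q - y0 0 i) * G i (ff q)).
  apply: funext => q; rewrite (hG (ff q)); congr (_ + _).
  by apply: eq_bigr => i _; rewrite !mxE.
rewrite (tangentD tu); [|exact: smoothC|by apply: smooth_sum => // i; exact: smoothM].
rewrite (tangentC _ dM tu) add0r (tangent_sum _ dM tu); last first.
  by move=> i; exact: smoothM.
apply: eq_bigr => i _; rewrite (tangent_leibniz tu) // D0 -G0.
rewrite {1}/y0 mxE subrr mul0r add0r mulrC; congr (_ * _).
by rewrite (tangentB dM tu) //; [rewrite (tangentC _ dM tu) subr0 | exact: smoothC].
Qed.

(** By the chain rule. This is what allows tangent vectors of products and subspaces to be compared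
    through their projections. *)
Lemma tangent_gen_eq X (G : set (X -> R)) (p : X) (u v : vec (Space (gen_smooth G))) :
  tangent (p : Space (gen_smooth G)) u -> tangent (p : Space (gen_smooth G)) v ->
  (forall g, G g -> u g = v g) -> u = v.
Proof.
move=> tu tv h; apply: (tangent_eq tu tv) => g sg.
have dM := @dspace_gen R X G.
have [k [f [V [F [Gf oV Vp sF gF]]]]] := sg p.
have sf i : @smooth R (Space (gen_smooth G)) (f i) by exact: sub_gen_smooth.
rewrite (tangent_chain dM tu sf sg oV Vp sF gF) (tangent_chain dM tv sf sg oV Vp sF gF).
by apply: eq_bigr => i _; rewrite h.
Qed.

Lemma push_smooth M N (f : M -> N) u g : smooth g -> push f u g = u (fun x => g (f x)).
Proof. by move=> sg; rewrite /push asboolT. Qed.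

Lemma push_tangent M N (f : M -> N) (p : M) u : dspace N -> smooth_map f ->
  tangent p u -> tangent (f p) (push f u).
Proof.
move=> dN sf tu; split.
- by move=> g ng; rewrite /push asboolF.
- move=> a g h sg sh; rewrite !push_smooth ?(tangent_lin tu) //; try exact: sf.
  by apply: smoothD => //; apply: smoothM => //; exact: smoothC.
- move=> g h sg sh; rewrite !push_smooth ?(tangent_leibniz tu) //; try exact: sf.
  exact: smoothM.
Qed.

Lemma push_comp M N P (f : M -> N) (g : N -> P) u : smooth_map g ->
  push g (push f u) = push (fun x => g (f x)) u.
Proof.
move=> sg; apply: funext => h; rewrite /push; case: asboolP => // sh.
by rewrite asboolT //; exact: sg.
Qed.

Lemma push_comb M N (f : M -> N) a u v :
  push f (comb a u v) = comb a (push f u) (push f v).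
Proof.
by apply: funext => h; rewrite /push /comb; case: asboolP; rewrite // mulr0 addr0.
Qed.

Lemma push_vec0 M N (f : M -> N) : push f (@vec0 R M) = @vec0 R N.
Proof. by apply: funext => h; rewrite /push /vec0; case: asboolP. Qed.

Lemma push_id M (p : M) u : tangent p u -> push (fun x : M => x) u = u.
Proof.
move=> tu; apply: funext => h; rewrite /push; case: asboolP => // nh.
by rewrite (tangent_junk tu).
Qed.

Lemma push_cst M N (p : M) (q : N) u : dspace M -> tangent p u ->
  push (fun _ : M => q) u = @vec0 R N.
Proof.
move=> dM tu; apply: funext => h; rewrite /push /vec0; case: asboolP => // _.
exact: tangentC dM tu.
Qed.

Lemma smooth_mapC M N (q : N) : dspace M -> smooth_map (fun _ : M => q).
Proof. by move=> dM g _; exact: smoothC. Qed.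

Lemma smooth_map_id M : smooth_map (fun x : M => x).
Proof. by []. Qed.

Lemma smooth_map_comp M N P (f : M -> N) (g : N -> P) :
  smooth_map f -> smooth_map g -> smooth_map (fun x => g (f x)).
Proof. by move=> sf sg h /sg /sf. Qed.

Lemma smooth_map_gen M X (G : set (X -> R)) (f : M -> X) : dspace M ->
  (forall g, G g -> smooth (fun x => g (f x))) ->
  smooth_map (f : M -> Space (gen_smooth G)).
Proof.
move=> dM h g sg; apply: dM => p.
have [k [gs [V [F [Gg oV Vp sF gF]]]]] := sg (f p).
exists k, (fun i x => gs i (f x)), V, F; split=> //.
- by move=> i; exact: h.
- by move=> q; exact: gF.
Qed.

Lemma smooth_fst M N : @smooth_map R (prod_space M N) M fst.
Proof. by move=> g sg; apply: sub_gen_smooth; left; exists g. Qed.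

Lemma smooth_snd M N : @smooth_map R (prod_space M N) N snd.
Proof. by move=> g sg; apply: sub_gen_smooth; right; exists g. Qed.

Lemma smooth_sval M (P : M -> Prop) : @smooth_map R (sub_space P) M sval.
Proof. by move=> g sg; apply: sub_gen_smooth; exists g. Qed.

Lemma smooth_pair M N P (f : P -> M) (g : P -> N) : dspace P ->
  smooth_map f -> smooth_map g ->
  smooth_map ((fun x => (f x, g x)) : P -> prod_space M N).
Proof.
by move=> dP sf sg; apply: smooth_map_gen => // h [] [k sk ->]; [exact: sf | exact: sg].
Qed.

Lemma smooth_into_sub M N (P : N -> Prop) (f : M -> sub_space P) : dspace M ->
  smooth_map (fun x => sval (f x)) -> smooth_map f.
Proof. by move=> dM sf; apply: smooth_map_gen => // h [k sk ->]; exact: sf. Qed.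

Lemma tangent_prod_eq M N (p : prod_space M N) (u v : vec (prod_space M N)) :
  tangent p u -> tangent p v ->
  push1 u = push1 v ->
  push2 u = push2 v -> u = v.
Proof.
move=> tu tv e1 e2; apply: (tangent_gen_eq tu tv) => g [] [f sf ->].
  by have := congr1 (fun w => w f) e1; rewrite !push_smooth.
by have := congr1 (fun w => w f) e2; rewrite !push_smooth.
Qed.

Lemma tangent_sub_eq M (P : M -> Prop) (p : sub_space P) (u v : vec (sub_space P)) :
  tangent p u -> tangent p v ->
  pushv P u = pushv P v -> u = v.
Proof.
move=> tu tv e; apply: (tangent_gen_eq tu tv) => g [f sf ->].
by have := congr1 (fun w => w f) e; rewrite !push_smooth.
Qed.

Definition pair_vec M N (p : prod_space M N) (u : vec M) (v : vec N) :
    vec (prod_space M N) :=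
  comb 1 (push (fun x => (x, p.2) : prod_space M N) u)
         (push (fun y => (p.1, y) : prod_space M N) v).

Lemma pair_vecP M N (p : prod_space M N) u v : dspace M -> dspace N ->
  tangent p.1 u -> tangent p.2 v ->
  [/\ tangent p (pair_vec p u v),
      push1 (pair_vec p u v) = u &
      push2 (pair_vec p u v) = v].
Proof.
move=> dM dN tu tv; have dP := @dspace_prod R M N.
have s1 : smooth_map (fun x => (x, p.2) : prod_space M N).
  by apply: smooth_pair => //; exact: smooth_mapC.
have s2 : smooth_map (fun y => (p.1, y) : prod_space M N).
  by apply: smooth_pair => //; exact: smooth_mapC.
have t1 := push_tangent dP s1 tu; have t2 := push_tangent dP s2 tv.
rewrite -surjective_pairing in t1; rewrite -surjective_pairing in t2.
split; first exact: tangent_comb.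
  rewrite push_comb !push_comp; try exact: smooth_fst.
  rewrite /= (push_id tu) (push_cst _ dN tv) /comb /vec0.
  by apply: funext => f; rewrite mul1r addr0.
rewrite push_comb !push_comp; try exact: smooth_snd.
rewrite /= (push_id tv) (push_cst _ dM tu) /comb /vec0.
by apply: funext => f; rewrite mul1r add0r.
Qed.

End SmoothFunctions.

(** * Coordinates and frames *)

Section ManifoldCoordinates.
Variable R : realType.
Local Notation space := (space R).
Implicit Types M N P : space.

(** The topology with the nonvanishing sets of smooth functions as a basis; on a manifold it is the
    atlas topology, see [atlas_topology_dopen]. *)
Definition dopen M (U : set M) :=
  forall p, U p -> exists h : M -> R, [/\ smooth h, h p <> 0 & forall q, h q <> 0 -> U q].

Definition second_countable M := exists B : nat -> set M,
  (forall i, dopen (B i)) /\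
  forall U p, dopen U -> U p -> exists2 i, B i p & B i `<=` U.

(** A chart given by global data: its domain is {h <> 0}, its image is V, and its coordinate
    functions are smooth on all of M. The maps x and y are mutually inverse only between {h <> 0}
    and V. *)
Record coords n M (x : M -> 'rV[R]_n) (y : 'rV[R]_n -> M) (h : M -> R)
    (V : set 'rV[R]_n) : Prop := Coords {
  coords_x : forall j, smooth (fun q => x q 0 j);
  coords_h : smooth h;
  coords_open : open V;
  coords_xV : forall q, h q <> 0 -> V (x q) /\ y (x q) = q;
  coords_yV : forall v, V v -> h (y v) <> 0 /\ x (y v) = v;
  coords_smooth : forall g, smooth g -> smooth_on V (fun v => g (y v)) }.

Definition has_coords n M (p : M) := exists x y h V, @coords n M x y h V /\ h p <> 0.

Lemma coords_comp n M x y h V (F : 'rV[R]_n -> R) : dspace M -> @coords n M x y h V ->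
  smooth_on setT F -> smooth (fun q => F (x q)).
Proof.
move=> dM C sF.
have := smooth_compT (f := fun i q => x q 0 i) dM (coords_x C) sF.
by congr smooth; apply: funext => q; congr F; apply/rowP => j; rewrite mxE.
Qed.

(** Extends a function given in coordinates to all of M after shrinking the domain; this takes the
    place of restriction to an open set. *)
Lemma coords_germ n M x y h V (F : 'rV[R]_n -> R) p : dspace M -> @coords n M x y h V ->
  smooth_on V F -> h p <> 0 -> exists g k : M -> R, [/\ smooth g, smooth k, k p <> 0 &
    forall q, k q <> 0 -> h q <> 0 /\ g q = F (x q)].
Proof.
move=> dM C sF hp; have [Vp _] := coords_xV C hp.
have [chi [b [r [[sc sb] [bp r0] rV [cr bc] hF]]]] := rV_bump (coords_open C) Vp.
exists (fun q => chi (x q) * F (x q)), (fun q => h q * b (x q)); split.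
- exact: (coords_comp dM C (hF _ sF)).
- by apply: smoothM => //; [exact: (coords_h C) | exact: (coords_comp dM C sb)].
- by move=> /eqP; rewrite mulf_eq0 => /orP[] /eqP.
- move=> q kq; have hq : h q <> 0 by move=> e; apply: kq; rewrite e mul0r.
  split=> //; rewrite bc ?mul1r // => e; apply: kq; by rewrite e mulr0.
Qed.

Section OfManifold.
Variables (n : nat) (M : space) (A : set (chart R n M)).
Hypothesis (sA : smooth_atlas A).
Hypothesis (hausA : forall p q : M, p <> q -> exists U W,
  [/\ atlas_topology A U, atlas_topology A W, U p, W q & U `&` W = set0]).
Hypothesis (smA : forall f : M -> R,
  smooth f <-> forall c, A c -> smooth_on (cimg c) (fun x => f (cinv c x))).

Lemma cimg_cinv c x : A c -> cimg c x -> cdom c (cinv c x) /\ cmap c (cinv c x) = x.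
Proof. by move=> Ac [p cp <-]; rewrite (atlas_inv sA Ac cp). Qed.

Lemma atlas_dspace : dspace M.
Proof.
move=> g Gg; apply/smA => c Ac k; apply: Ck_local => x cx.
have oc := atlas_open sA Ac.
have [m [f [V [F [sf oV Vp sF gF]]]]] := Gg (cinv c x).
have CH l j : Ck l (cimg c) (fun z => (\row_i f i (cinv c z)) 0 j).
  have := (smA (f j)).1 (sf j) c Ac l; apply: Ck_ext => // z _; by rewrite mxE.
exists [set z | cimg c z /\ V (\row_i f i (cinv c z))] => //.
have oW := Ck_preimage_open oc oV (CH 0%N).
apply: (@Ck_ext _ _ _ _ (fun z => F (\row_i f i (cinv c z)))) => //.
  by move=> z [_ Vz]; rewrite gF.
apply: (Ck_comp (W := V)) (sF k) => //; first by move=> z [].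
by move=> j; apply: Ck_sub (CH k j) => z [].
Qed.

(** At a point outside the domain of c the extension has to vanish on a whole neighbourhood. It does
    because the part of M over the closed ball is compact and therefore, M being Hausdorff,
    closed. *)
Lemma smooth_extend c (F : 'rV[R]_n -> R) x0 r : A c -> smooth_on setT F ->
  (forall z, `|z - x0| <= r -> cimg c z) -> (forall z, F z <> 0 -> `|z - x0| < r) ->
  smooth (fun q => if `[< cdom c q >] then F (cmap c q) else 0).
Proof.
move=> Ac sF rc Fr; apply/smA => d Ad k; apply: Ck_local => z dz.
have [dq zE] := cimg_cinv Ad dz; set q := cinv d z in dq zE.
have [cq|ncq] := pselect (cdom c q).
  exists (cmap d @` (cdom d `&` cdom c)); first by exists q.
  have oW := atlas_overlap sA Ad Ac.
  apply: (@Ck_ext _ _ _ _ (fun w => F (cmap c (cinv d w)))) => //.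
    by move=> _ [q' [dq' cq'] <-]; rewrite (atlas_inv sA Ad dq') asboolT.
  apply: (Ck_comp (W := setT)) (sF k) => //; first exact: openT.
  by move=> j; exact: (atlas_transition sA Ad Ac).
pose K : set 'rV[R]_n := [set y | `|y - x0| <= r].
have cK : compact K.
  apply: bounded_closed_compact.
    exists (r + `|x0|); split; first exact: num_real.
    move=> m rm y /= yr; rewrite -[y](subrK x0) (le_trans (ler_normD _ _)) //.
    by apply: le_trans (ltW rm); rewrite lerD2r.
  apply: (@closed_comp _ _ (fun x : 'rV[R]_n => `|x - x0|) [set s | s <= r]); last exact: closed_le.
  move=> x _; apply: (@continuous_comp _ _ _ (fun x : 'rV[R]_n => x - x0) Num.norm).
    by apply: continuousB; [exact: cvg_id | exact: cst_continuous].
  exact: norm_continuous.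
(* Separate q from each point over the ball K; compactness of K then gives one neighbourhood of z
   that avoids all of them. *)
have : \forall w \near z, K `<=` (fun y => cinv d w <> cinv c y).
  apply: ((compact_near_coveringP K).1 cK _ (nbhs z)
     (fun w y => cinv d w <> cinv c y) (nbhs_filter z)) => y Ky.
  have [cy yE] := cimg_cinv Ac (rc y Ky).
  have yq : cinv c y <> q by move=> e; apply: ncq; rewrite -e.
  have [U [W [aU aW Uy Wq UW]]] := hausA yq.
  have nU : nbhs y (cmap c @` (U `&` cdom c)).
    by apply: open_nbhs_nbhs; split; [exact: aU | exists (cinv c y)].
  have nW : nbhs z (cmap d @` (W `&` cdom d)).
    by apply: open_nbhs_nbhs; split; [exact: aW | exists q].
  exists (cmap c @` (U `&` cdom c), cmap d @` (W `&` cdom d)); first by split.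
  move=> [y' w] /= [[a [Ua ca] <-] [b [Wb db] <-]].
  rewrite (atlas_inv sA Ad db) (atlas_inv sA Ac ca) => ba.
  have : (U `&` W) a by split=> //; rewrite -ba.
  by rewrite UW.
move=> /nbhs_ballP [e /= e0 he].
exists (cimg d `&` ball z e); first by split=> //; apply/rV_ballP; rewrite subrr normr0.
have oB : open (cimg d `&` ball z e).
  by apply: openI; [exact: (atlas_open sA Ad )| exact: ball_open].
apply: Ck_ext (Ck_cst k _ 0) => // w [dw /he hw].
case: asboolP => // cw; apply: contrapT => Fw.
have Fw' : F (cmap c (cinv d w)) <> 0 by move=> e1; apply: Fw; rewrite e1.
apply: (hw (cmap c (cinv d w))); first by rewrite /K /= ltW //; exact: Fr.
by rewrite (atlas_inv sA Ac cw).
Qed.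

Lemma atlas_coords (U : set M) p : atlas_topology A U -> U p ->
  exists x y h V, [/\ @coords n M x y h V, h p <> 0 & forall q, h q <> 0 -> U q].
Proof.
move=> aU Up; have [c Ac cp] := atlas_cover sA p.
have oW := aU c Ac.
have Wp : (cmap c @` (U `&` cdom c)) (cmap c p) by exists p.
have [chi [b [r [[sc sb] [bp r0] rV [cr bc] hF]]]] := rV_bump oW Wp.
have rc z : `|z - cmap c p| <= r -> cimg c z.
  by move=> /rV [q [_ cq] <-]; exists q.
have sX j : smooth_on setT (fun z : 'rV[R]_n => chi z * z 0 j).
  by move=> k; apply: CkM; [exact: openT | exact: sc | apply: Ck_coord; exact: openT].
have br z : b z <> 0 -> `|z - cmap c p| < r.
  by move=> bz; apply: cr; rewrite bc //; apply/eqP; exact: oner_neq0.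
pose ext (F : 'rV[R]_n -> R) q := if `[< cdom c q >] then F (cmap c q) else 0.
pose x q : 'rV[R]_n := \row_j ext (fun z : 'rV[R]_n => chi z * z 0 j) q.
have hb q : ext b q <> 0 -> cdom c q /\ b (cmap c q) <> 0.
  by rewrite /ext; case: asboolP.
have bW z : b z <> 0 -> exists q, [/\ U q, cdom c q & cmap c q = z].
  by move=> /br /ltW /rV [q [Uq cq] e]; exists q.
have xE q : cdom c q -> b (cmap c q) <> 0 -> x q = cmap c q.
  move=> cq bq; apply/rowP => j; rewrite mxE /ext asboolT //.
  by rewrite bc // mul1r.
exists x, (cinv c), (ext b), [set z | setT z /\ b z <> 0]; split; last 2 first.
- by rewrite /ext asboolT.
- move=> q /hb [cq /bW [q' [Uq' cq' e]]].
  by rewrite -(atlas_inv sA Ac cq) -e (atlas_inv sA Ac cq').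
split.
- move=> j; have := smooth_extend Ac (sX j) rc.
  rewrite (_ : (fun q => x q 0 j) = ext (fun z : 'rV[R]_n => chi z * z 0 j)); last first.
    by apply: funext => q; rewrite mxE.
  by apply=> z h; apply: cr => e; apply: h; rewrite e mul0r.
- exact: smooth_extend Ac sb rc br.
- by apply: open_neq0; [exact: openT | exact: sb].
- by move=> q /hb [cq bq]; rewrite xE // (atlas_inv sA Ac cq).
- move=> v [_ bv]; have [q [Uq cq e]] := bW v bv.
  have -> : cinv c v = q by rewrite -e (atlas_inv sA Ac cq).
  by rewrite xE ?e //; split=> //; rewrite /ext asboolT // e.
- move=> g sg k; apply: Ck_sub ((smA g).1 sg c Ac k).
  by move=> v [_ /br /ltW /rc].
Qed.

Lemma atlas_topology_dopen (U : set M) : atlas_topology A U <-> dopen U.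
Proof.
split=> [aU p Up|dU c Ac].
  have [x [y [h [V [C hp hU]]]]] := atlas_coords aU Up.
  by exists h; split=> //; exact: (coords_h C).
apply: rV_openP => _ [p [Up cp] <-].
have [h [sh hp hU]] := dU p Up.
have Ch := (smA h).1 sh c Ac 0%N.
have oW := open_neq0 (atlas_open sA Ac) Ch.
have Wp : [set z | cimg c z /\ h (cinv c z) <> 0] (cmap c p).
  by split; [exists p | rewrite (atlas_inv sA Ac cp)].
have [r r0 hr] := rV_open_ball oW Wp.
exists r => // z /hr [cz hz]; have [dz e] := cimg_cinv Ac cz.
by exists (cinv c z) => //; split=> //; exact: hU.
Qed.

End OfManifold.

Lemma manifold_coords n M : manifold n M ->
  [/\ dspace M, forall p : M, has_coords n p & second_countable M].
Proof.
move=> [A [sA hA [B [oB bB]] smA]]; split; first exact: (atlas_dspace sA smA).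
  move=> p; have aT : atlas_topology A setT.
    move=> c Ac; rewrite setTI; exact: (atlas_open sA Ac).
  have [x [y [h [V [C hp _]]]]] := atlas_coords sA hA smA aT (I : setT p).
  by exists x, y, h, V.
exists B; split; first by move=> i; apply/(atlas_topology_dopen sA hA smA).
by move=> U p /(atlas_topology_dopen sA hA smA); exact: bB.
Qed.

(** The atlas consists of all charts with global data, and its topology is that of the smooth
    functions. Two points are separated by a smooth function: by h if it vanishes at the second
    point, and otherwise by a coordinate. *)
Lemma coords_manifold n M : dspace M -> (forall p : M, has_coords n p) ->
  second_countable M -> manifold n M.
Proof.
move=> dM cM [B [oB bB]].
pose A : set (chart R n M) := fun c => exists h V,
  coords (cmap c) (cinv c) h V /\ cdom c = [set q | h q <> 0].
have imgV (c : chart R n M) h V : coords (cmap c) (cinv c) h V -> cdom c = [set q | h q <> 0] ->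
    cimg c = V.
  move=> C dE; apply/seteqP; split=> [_ [q + <-]|v Vv].
    by rewrite dE => /(coords_xV C) [].
  by have [h1 h2] := coords_yV C Vv; exists (cinv c v) => //; rewrite dE.
have ovl (c : chart R n M) h V (f : M -> R) : coords (cmap c) (cinv c) h V ->
    cdom c = [set q | h q <> 0] -> smooth f ->
    open (cmap c @` (cdom c `&` [set q | f q <> 0])).
  move=> C dE sf.
  rewrite (_ : _ @` _ = [set v | V v /\ f (cinv c v) <> 0]).
    apply: open_neq0; first exact: (coords_open C).
    exact: (coords_smooth C sf).
  apply/seteqP; split=> [_ [q [+ fq] <-]|v [Vv fv]].
    by rewrite dE => /(coords_xV C) [Vq e]; rewrite /= e.
  by have [h1 h2] := coords_yV C Vv; exists (cinv c v) => //; split=> //; rewrite dE.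
have sA : smooth_atlas A.
  split.
  - move=> p; have [x [y [h [V [C hp]]]]] := cM p.
    by exists (Chart [set q | h q <> 0] x y) => //; exists h, V.
  - by move=> c [h [V [C dE]]]; rewrite (imgV _ _ _ C dE); exact: (coords_open C).
  - by move=> c [h [V [C dE]]] p; rewrite dE => /(coords_xV C) [].
  - move=> c d [h [V [C dE]]] [h' [V' [C' dE']]]; rewrite dE'.
    by apply: ovl C dE _; exact: (coords_h C').
  - move=> c d [h [V [C dE]]] [h' [V' [C' dE']]] j k.
    have := coords_smooth C (coords_x C' j) k; apply: Ck_sub.
    by move=> _ [q [+ _] <-]; rewrite dE => /(coords_xV C) [].
have smA (f : M -> R) : smooth f <->
    forall c, A c -> smooth_on (cimg c) (fun x => f (cinv c x)).
  split=> [sf c [h [V [C dE]]]|sf].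
    by rewrite (imgV _ _ _ C dE); exact: (coords_smooth C sf).
  apply: smooth_loc => // p; have [x [y [h [V [C hp]]]]] := cM p.
  pose c := Chart [set q | h q <> 0] x y.
  have Ac : A c by exists h, V.
  have sfc := sf c Ac; rewrite (imgV c h V C erefl) /= in sfc.
  have [g [k [sg sk kp gk]]] := coords_germ dM C sfc hp.
  exists k, g; split=> // q kq; have [hq ->] := gk q kq.
  by have [_ ->] := coords_xV C hq.
have topA (U : set M) : atlas_topology A U <-> dopen U.
  split=> [aU p Up|dU c Ac].
    have [x [y [h [V [C hp]]]]] := cM p.
    pose c := Chart [set q | h q <> 0] x y.
    have Ac : A c by exists h, V.
    have Wp : (cmap c @` (U `&` cdom c)) (x p) by exists p.
    have [chi [b [r [[_ sb] [bp r0] rV [cr bc] _]]]] := rV_bump (aU c Ac) Wp.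
    exists (fun q => h q * b (x q)); split.
    - apply: smoothM => //; first exact: (coords_h C).
      exact: (coords_comp dM C sb).
    - by move=> /eqP; rewrite mulf_eq0 => /orP[] /eqP.
    - move=> q hq; have h1 : h q <> 0 by move=> e; apply: hq; rewrite e mul0r.
      have b1 : b (x q) <> 0 by move=> e; apply: hq; rewrite e mulr0.
      have : `|x q - x p| < r by apply: cr; rewrite bc //; apply/eqP; exact: oner_neq0.
      move=> /ltW /rV [q' [Uq' hq'] e].
      have [_ <-] := coords_xV C h1.
      by rewrite -[x q]e; have [_ ->] := coords_xV C hq'.
  have [h [V [C dE]]] := Ac.
  apply: rV_openP => _ [p [Up cp] <-].
  have [f [sf fp fU]] := dU p Up.
  have Wp : (cmap c @` (cdom c `&` [set q | f q <> 0])) (cmap c p) by exists p.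
  have [r r0 hr] := rV_open_ball (ovl _ _ _ _ C dE sf) Wp.
  by exists r => // z /hr [q [cq fq] <-]; exists q => //; split=> //; exact: fU.
exists A; split=> //.
  move=> p q pq.
  have [f sf fpq] : exists2 f : M -> R, smooth f & f p < f q.
    suff [f sf /eqP fpq] : exists2 f : M -> R, smooth f & f p <> f q.
      have [lt|lt|e] := ltgtP (f p) (f q); first by exists f.
        by exists (fun x => - f x); [exact: smoothN | rewrite ltrN2].
      by rewrite e eqxx in fpq.
    have [x [y [h [V [C hp]]]]] := cM p.
    have [hq|hq] := pselect (h q = 0).
      by exists h; [exact: (coords_h C )| rewrite hq].
    apply: contrapT => no; apply: pq.
    have [_ <-] := coords_xV C hp; have [_ <-] := coords_xV C hq; congr y.
    apply/rowP => j; apply: contrapT => ne; apply: no.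
    by exists (fun q => x q 0 j); [exact: (coords_x C j)|].
  pose m := (f p + f q) / 2.
  exists [set x | f x < m], [set x | m < f x]; split.
  - apply/topA => x fx; exists (fun x => flat 0 (m - f x)); split.
    + by apply: smooth_flat => //; apply: smoothB => //; exact: smoothC.
    + by apply/eqP; rewrite gt_eqF // flat_gt0 // subr_gt0.
    + move=> z /= hz; rewrite ltNge; apply/negP => h; apply: hz; apply: flat_eq0.
      by rewrite subr_le0.
  - apply/topA => x fx; exists (fun x => flat 0 (f x - m)); split.
    + by apply: smooth_flat => //; apply: smoothB => //; exact: smoothC.
    + by apply/eqP; rewrite gt_eqF // flat_gt0 // subr_gt0.
    + move=> z /= hz; rewrite ltNge; apply/negP => h; apply: hz; apply: flat_eq0.
      by rewrite subr_le0.
  - by rewrite /= /m; lra.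
  - by rewrite /= /m; lra.
  - apply/seteqP; split=> // x [/= h1 h2].
    by have := lt_trans h1 h2; rewrite ltxx.
exists B; split; first by move=> i; apply/topA.
by move=> U p /topA; exact: bB.
Qed.

End ManifoldCoordinates.

(** * Coordinate vectors and local frames *)

Section Frames.
Variable R : realType.
Local Notation space := (space R).
Implicit Types M N P : space.

Definition coord_vec n M (x : M -> 'rV[R]_n) (y : 'rV[R]_n -> M) (q : M)
    (w : 'rV[R]_n) : vec M :=
  fun f => if `[< smooth f >] then 'D_w (fun v => f (y v)) (x q) else 0.

Lemma coords_differentiable n M x y h V (q : M) f : @coords R n M x y h V -> h q <> 0 ->
  smooth f -> differentiable (fun v => f (y v)) (x q).
Proof.
move=> C hq sf; have [Vq _] := coords_xV C hq.
exact: smooth_differentiable (coords_open C) (coords_smooth C sf) Vq.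
Qed.

Lemma coord_vec_tangent n M x y h V (q : M) w : dspace M -> @coords R n M x y h V ->
  h q <> 0 -> tangent q (coord_vec x y q w).
Proof.
move=> dM C hq.
have df f : smooth f -> derivable (fun v => f (y v)) (x q) w.
  by move=> sf; apply: diff_derivable; exact: coords_differentiable C hq sf.
have E f : smooth f -> coord_vec x y q w f = 'D_w (fun v => f (y v)) (x q).
  by move=> sf; rewrite /coord_vec asboolT.
have [_ yx] := coords_xV C hq.
split.
- by move=> f nf; rewrite /coord_vec asboolF.
- move=> a f g sf sg.
  have saf : smooth (fun z => a * f z) by apply: smoothM => //; exact: smoothC.
  rewrite !E //; last exact: smoothD.
  by have [_ e] := is_deriveD (is_deriveZ a (derivableP (df f sf))) (derivableP (df g sg)).
- move=> f g sf sg; rewrite !E //; last exact: smoothM.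
  have := deriveM (df f sf) (df g sg); rewrite yx /GRing.scale /= => ->.
  by congr (_ + _); rewrite mulrC.
Qed.

Lemma coord_vec_x n M x y h V (q : M) w j : @coords R n M x y h V -> h q <> 0 ->
  coord_vec x y q w (fun q => x q 0 j) = w 0 j.
Proof.
move=> C hq; have [Vq _] := coords_xV C hq.
rewrite /coord_vec asboolT; last exact: (coords_x C j).
have nV : nbhs (x q) V by apply: open_nbhs_nbhs; split=> //; exact: (coords_open C).
rewrite (near_eq_derive (g := fun v : 'rV[R]_n => (v *m (delta_mx j 0 : 'cV_n)) 0 0)).
  have [_ ->] := linear_is_derive (delta_mx j 0 : 'cV[R]_n) (x q) w.
  by rewrite -colE mxE.
apply: (@filterS _ (nbhs (x q)) (nbhs_filter (x q)) V) => // v Vv.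
by rewrite -colE mxE; have [_ ->] := coords_yV C Vv.
Qed.

Lemma coords_tangent_eq n M x y h V (q : M) u v : dspace M -> @coords R n M x y h V ->
  h q <> 0 -> tangent q u -> tangent q v ->
  (forall j, u (fun q => x q 0 j) = v (fun q => x q 0 j)) -> u = v.
Proof.
move=> dM C hq tu tv uv; apply: (tangent_eq tu tv) => f sf.
have [Vq _] := coords_xV C hq.
have [chi [b [r [[sc sb] [bp r0] rV [cr bc] hF]]]] := rV_bump (coords_open C) Vq.
have sF := hF _ (coords_smooth C sf).
pose g q := chi (x q) * f (y (x q)).
have sg : smooth g by exact: (coords_comp dM C sF).
have fg w : tangent q w -> w f = w g.
  move=> tw; apply: (tangent_loc (h := fun q => h q * b (x q)) tw) => //.
  - by apply: smoothM => //; [exact: (coords_h C) | exact: (coords_comp dM C sb)].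
  - by move=> /eqP; rewrite mulf_eq0 => /orP[] /eqP.
  - move=> z hz; rewrite /g.
    have hz' : h z <> 0 by move=> e; apply: hz; rewrite e mul0r.
    have [_ ->] := coords_xV C hz'; rewrite bc ?mul1r // => e.
    by apply: hz; rewrite e mulr0.
have xr z : \row_j x z 0 j = x z by apply/rowP => j; rewrite mxE.
have ch w (tw : tangent q w) := tangent_chain dM tw (f := fun j z => x z 0 j)
  (coords_x C) sg openT I sF (fun z _ => congr1 (fun v => chi v * f (y v)) (esym (xr z))).
by rewrite fg // ch // [RHS]fg // ch //; apply: eq_bigr => i _; rewrite uv.
Qed.

Lemma tangent_coord_vec n M x y h V (q : M) u : dspace M -> @coords R n M x y h V ->
  h q <> 0 -> tangent q u -> u = coord_vec x y q (\row_j u (fun q => x q 0 j)).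
Proof.
move=> dM C hq tu; apply: (coords_tangent_eq dM C hq tu).
  exact: coord_vec_tangent dM C hq.
by move=> j; rewrite (coord_vec_x _ _ C hq) mxE.
Qed.

Lemma tangent_coords n M x y h V (q : M) u f : dspace M -> @coords R n M x y h V ->
  h q <> 0 -> tangent q u -> smooth f ->
  u f = \sum_i u (fun q => x q 0 i) * 'D_(delta_mx 0 i) (fun v => f (y v)) (x q).
Proof.
move=> dM C hq tu sf; rewrite {1}(tangent_coord_vec dM C hq tu) /coord_vec asboolT //.
have df := coords_differentiable C hq sf.
by rewrite deriveE // diff_sum_partials //; apply: eq_bigr => i _; rewrite mxE.
Qed.

(* A frame is a chart-free form of local coordinates: functions x_i and global
   vector fields E_i that restrict to coordinates and d/dx_i on {h <> 0}. *)
Record frame n M (x : 'I_n -> M -> R) (E : 'I_n -> M -> vec M) (h : M -> R) : Prop :=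
  Frame {
  frame_x : forall i, smooth (x i);
  frame_E : forall i, vfield (E i);
  frame_h : smooth h;
  frame_delta : forall q, h q <> 0 -> forall i j, E i q (x j) = (i == j)%:R;
  frame_span : forall q, h q <> 0 -> forall u, tangent q u ->
    u = fun f => \sum_i u (x i) * E i q f }.

Definition has_frame n M (p : M) := exists x E h, @frame n M x E h /\ h p <> 0.

(** Coordinate fields exist on {h <> 0} only. Multiplication by a cutoff [rho] supported there makes
    them global, and the frame is claimed only where [rho] is 1. *)
Lemma coords_frame n M (p : M) : dspace M -> has_coords n p -> has_frame n p.
Proof.
move=> dM [x [y [h [V [C hp]]]]].
have hp2 : h p ^+ 2 != 0 by rewrite expf_neq0 //; exact/eqP.
(* Normalised to s >= 0 and s(p) = 1. The cutoff [rho] is 0 for s <= 1/4 and 1 for s >= 1/2, while k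
   is nonzero only for s > 1/2. *)
pose s q := h q * h q / (h p ^+ 2).
have ss : smooth s.
  apply: smoothM => //; last exact: smoothC.
  by apply: smoothM => //; exact: (coords_h C).
have sp : s p = 1 by rewrite /s -expr2 mulfV.
pose rho q := step (4 * s q - 1).
have srho : smooth rho.
  apply: smooth_step => //; apply: smoothB => //; last exact: smoothC.
  by apply: smoothM => //; exact: smoothC.
pose k q := flat 0 (s q - 2^-1).
have ks q : k q <> 0 -> 2^-1 < s q.
  by move=> kq; rewrite ltNge; apply/negP => h1; apply: kq; rewrite /k flat_eq0 // subr_le0.
have kh q : k q <> 0 -> h q <> 0.
  by move=> /ks + hq; rewrite /s hq !mul0r; lra.
have krho q : k q <> 0 -> rho q = 1 by move=> /ks hs; apply: step1; lra.
pose E i q : vec M := if `[< h q <> 0 >] then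
  comb (rho q) (coord_vec x y q (delta_mx 0 i)) (@vec0 R M) else @vec0 R M.
exists (fun i q => x q 0 i), E, k; split; last first.
  by apply/eqP; rewrite /k gt_eqF // flat_gt0 // sp; lra.
have EE i q f : k q <> 0 -> E i q f = coord_vec x y q (delta_mx 0 i) f.
  move=> kq; rewrite /E asboolT; last exact: kh.
  by rewrite /comb /vec0 krho // mul1r addr0.
split.
- exact: (coords_x C).
- move=> i; split=> [q|f sf].
    rewrite /E; case: asboolP => hq; last exact: tangent_vec0.
    by apply: tangent_comb; [exact: coord_vec_tangent dM C hq | exact: tangent_vec0].
  apply: smooth_loc => // q; have [hq|hq] := pselect (h q = 0).
    exists (fun q => flat 0 (4^-1 - s q)), (fun=> 0); split.
    + by apply: smooth_flat => //; apply: smoothB => //; exact: smoothC.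
    + exact: smoothC.
    + by apply/eqP; rewrite gt_eqF // flat_gt0 // /s hq !mul0r; lra.
    + move=> z hz; have sz : s z < 4^-1.
        by rewrite ltNge; apply/negP => h1; apply: hz; rewrite flat_eq0 // subr_le0.
      rewrite /E; case: asboolP => // _; rewrite /comb /vec0 addr0.
      by rewrite /rho step0 ?mul0r //; lra.
  have [g [l [sg sl lq gl]]] := coords_germ dM C (smooth_partial i (coords_smooth C sf)) hq.
  exists l, (fun z => rho z * g z); split=> //; first exact: smoothM.
  move=> z /gl [hz ->]; rewrite /E asboolT // /comb /vec0 addr0.
  by rewrite /coord_vec asboolT.
- apply: smooth_flat => //; apply: smoothB => //; exact: smoothC.
- move=> q kq i j; rewrite EE // (coord_vec_x _ _ C (kh q kq)) mxE eqxx /=.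
  by rewrite eq_sym.
- move=> q kq u tu; apply: funext => f; have [sf|nf] := pselect (smooth f); last first.
    rewrite (tangent_junk tu nf) big1 // => i _.
    by rewrite EE // /coord_vec asboolF // mulr0.
  rewrite (tangent_coords dM C (kh q kq) tu sf); apply: eq_bigr => i _.
  by rewrite EE // /coord_vec asboolT.
Qed.

End Frames.

(** * Submanifolds and fibre products *)

Section Submanifolds.
Variable R : realType.
Local Notation space := (space R).
Implicit Types M N P : space.

Lemma smooth_on_gen X (G : set (X -> R)) n (V : set 'rV[R]_n) (y : 'rV[R]_n -> X) g :
  open V -> (forall f, G f -> smooth_on V (fun v => f (y v))) ->
  gen_smooth G g -> smooth_on V (fun v => g (y v)).
Proof.
move=> oV h sg k; apply: Ck_local => v Vv.
have [m [f [W [F [Gf oW Wp sF gF]]]]] := sg (y v).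
have CH l j : Ck l V (fun z => (\row_i f i (y z)) 0 j).
  by apply: Ck_ext (h _ (Gf j) l) => // z _; rewrite mxE.
exists [set z | V z /\ W (\row_i f i (y z))] => //.
have oVW := Ck_preimage_open oV oW (CH 0%N).
apply: (@Ck_ext _ _ _ _ (fun z => F (\row_i f i (y z)))) => //.
  by move=> z [_ Wz]; rewrite gF.
apply: (Ck_comp (W := W)) (sF k) => //; first by move=> z [].
by move=> j; apply: Ck_sub (CH k j) => z [].
Qed.

Lemma gen_smooth_box X (G : set (X -> R)) h (p : X) : gen_smooth G h -> h p <> 0 ->
  exists k (f : 'I_k -> X -> R) (r : R), [/\ 0 < r, forall i, G (f i) &
    forall q, (forall i, `|f i q - f i p| < r) -> h q <> 0].
Proof.
move=> sh hp; have [k [f [V [F [Gf oV Vp sF hF]]]]] := sh p.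
have Fp : F (\row_i f i p) <> 0 by rewrite -hF.
have [r r0 hr] := rV_open_ball (open_neq0 oV (sF 0%N)) (conj Vp Fp).
exists k, f, (r / 2); split=> //; first by rewrite divr_gt0.
move=> q fq; have [|Vq Fq] := hr (\row_i f i q); last by rewrite hF.
apply: (@le_lt_trans _ _ (r / 2)); last by rewrite ltr_pdivrMr // ltr_pMr // ltr1n.
apply: rV_norm_le => [|i]; first by rewrite divr_ge0 // ltW.
by rewrite rV_subE !mxE ltW.
Qed.

Lemma box_function M k (f : 'I_k -> M -> R) (p : M) (r : R) : dspace M -> 0 < r ->
  (forall i, smooth (f i)) -> exists b, [/\ smooth b, b p <> 0 &
    forall q, b q <> 0 -> forall i, `|f i q - f i p| < r].
Proof.
move=> dM r0 sf.
exists (fun q => \prod_i flat 0 (r ^+ 2 - (f i q - f i p) * (f i q - f i p))); split.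
- apply: smooth_prod => // i; apply: smooth_flat => //.
  apply: smoothB => //; first exact: smoothC.
  by apply: smoothM => //; apply: smoothB => //; exact: smoothC.
- apply/eqP; rewrite gt_eqF //; apply: prodr_gt0 => i _.
  by rewrite subrr mulr0 subr0 flat_gt0 // exprn_gt0.
- move=> q + i; rewrite (bigD1 i) //= ltNge => h; apply/negP => ri; apply: h.
  rewrite flat_eq0 ?mul0r // subr_le0 -expr2 -[X in _ <= X]real_normK ?num_real //.
  by rewrite ler_sqr ?nnegrE // ltW.
Qed.

Lemma prod_second_countable M N : dspace M -> dspace N ->
  second_countable M -> second_countable N -> second_countable (prod_space M N).
Proof.
move=> dM dN [A [oA bA]] [B [oB bB]].
pose C (k : nat) : set (prod_space M N) :=
  if @unpickle (nat * nat)%type k is Some ij then [set q | A ij.1 q.1 /\ B ij.2 q.2] else set0.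
have dP := @dspace_prod R M N.
exists C; split.
  move=> k; rewrite /C; case: unpickle => [[i j]|] //= p [Ap Bp].
  have [f [sf fp fA]] := oA i _ Ap; have [g [sg gp gB]] := oB j _ Bp.
  exists (fun q => f q.1 * g q.2); split.
  - by apply: smoothM => //; [exact: smooth_fst sf | exact: smooth_snd sg].
  - by move=> /eqP; rewrite mulf_eq0 => /orP[] /eqP.
  - move=> q fgq; split; [apply: fA|apply: gB] => e; apply: fgq.
      by rewrite e mul0r.
    by rewrite e mulr0.
move=> U p dU Up; have [h [sh hp hU]] := dU p Up.
have [k [f [r [r0 Gf hf]]]] := gen_smooth_box sh hp.
(* Each generator depends on one factor alone, so boxes for the restrictions of f to the two slices
   through p combine into a box for f. *)
pose f1 i (x : M) := f i (x, p.2); pose f2 i (x : N) := f i (p.1, x).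
have sf1 i : smooth (f1 i).
  rewrite /f1; case: (Gf i) => -[g sg ->] //=; exact: smoothC.
have sf2 i : smooth (f2 i).
  rewrite /f2; case: (Gf i) => -[g sg ->] //=; exact: smoothC.
have [b1 [sb1 b1p hb1]] := box_function p.1 dM r0 sf1.
have [b2 [sb2 b2p hb2]] := box_function p.2 dN r0 sf2.
have dn (P : space) (b : P -> R) : smooth b -> dopen [set q | b q <> 0].
  by move=> sb q bq; exists b.
have [i Ai sA] := bA _ _ (dn _ _ sb1) b1p.
have [j Bj sB] := bB _ _ (dn _ _ sb2) b2p.
exists (pickle (i, j)); rewrite /C pickleK //= => q [/sA /hb1 h1 /sB /hb2 h2].
apply: hU; apply: hf => l; have := h1 l; have := h2 l; rewrite /f1 /f2.
by case: (Gf l) => -[g sg ->].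
Qed.

Lemma sub_second_countable M (Q : M -> Prop) : dspace M ->
  second_countable M -> second_countable (sub_space Q).
Proof.
move=> dM [A [oA bA]]; exists (fun i => [set q | A i (sval q)]); split.
  move=> i p Ap; have [f [sf fp fA]] := oA i _ Ap.
  exists (fun q => f (sval q)); split=> //; first exact: smooth_sval sf.
  by move=> q; apply: fA.
move=> U p dU Up; have [h [sh hp hU]] := dU p Up.
have [k [f [r [r0 Gf hf]]]] := gen_smooth_box sh hp.
have /choice [g hg] : forall i, exists g, smooth g /\ f i = (fun x => g (sval x)).
  by move=> i; have [g sg e] := Gf i; exists g.
have [b [sb bp hb]] := box_function (sval p) dM r0 (fun i => proj1 (hg i)).
have [i Ai sA] : exists2 i, A i (sval p) & A i `<=` [set q | b q <> 0].
  by apply: bA => // q bq; exists b.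
exists i => // q /sA /hb bq; apply: hU; apply: hf => l.
by have [_ ->] := hg l; exact: bq.
Qed.

Lemma prod_coords m n M N (p : prod_space M N) : dspace M -> dspace N ->
  has_coords m p.1 -> has_coords n p.2 -> has_coords (m + n) p.
Proof.
move=> dM dN [x1 [y1 [h1 [V1 [C1 p1]]]]] [x2 [y2 [h2 [V2 [C2 p2]]]]].
have dP := @dspace_prod R M N; have oT := @openT 'rV[R]_(m + n).
pose V : set 'rV[R]_(m + n) := [set v | V1 (lsubmx v) /\ V2 (rsubmx v)].
have Cl k j : Ck k setT (fun v : 'rV[R]_(m + n) => lsubmx v 0 j).
  by apply: Ck_ext (Ck_coord k (lshift n j) oT) => // v _; rewrite mxE.
have Cr k j : Ck k setT (fun v : 'rV[R]_(m + n) => rsubmx v 0 j).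
  by apply: Ck_ext (Ck_coord k (rshift m j) oT) => // v _; rewrite mxE.
have oV : open V.
  have o1 := Ck_preimage_open oT (coords_open C1) (Cl 0%N).
  have o2 := Ck_preimage_open oT (coords_open C2) (Cr 0%N).
  have := openI o1 o2; congr (open _); apply: funext => v; apply: propext.
  by split=> [[[_ ?] [_ ?]]|[? ?]].
exists (fun q => row_mx (x1 q.1) (x2 q.2)), (fun v => (y1 (lsubmx v), y2 (rsubmx v))),
  (fun q => h1 q.1 * h2 q.2), V; split; last first.
  by move=> /eqP; rewrite mulf_eq0 => /orP[] /eqP.
have hn q : h1 q.1 * h2 q.2 <> 0 -> h1 q.1 <> 0 /\ h2 q.2 <> 0.
  by move=> hq; split=> e; apply: hq; rewrite e ?mul0r ?mulr0.
split=> //.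
- move=> j; rewrite -(splitK j); case: (fintype.split j) => i /=.
    have := smooth_fst (N := N) (coords_x C1 i); congr smooth.
    by apply: funext => q; rewrite row_mxEl.
  have := smooth_snd (M := M) (coords_x C2 i); congr smooth.
  by apply: funext => q; rewrite row_mxEr.
- apply: smoothM => //; first exact: smooth_fst (coords_h C1).
  exact: smooth_snd (coords_h C2).
- move=> q /hn [q1 q2]; have [V1q e1] := coords_xV C1 q1; have [V2q e2] := coords_xV C2 q2.
  by rewrite /V /= row_mxKl row_mxKr e1 e2 -surjective_pairing.
- move=> v [Vl Vr] /=; have [a1 b1] := coords_yV C1 Vl; have [a2 b2] := coords_yV C2 Vr.
  rewrite b1 b2 hsubmxK; split=> //; apply/eqP; rewrite mulf_eq0 negb_or.
  by apply/andP; split; apply/eqP.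
- move=> g; apply: smooth_on_gen => // f [] [f' sf' ->] k /=.
    apply: (Ck_comp (W := V1) (G := @lsubmx _ 1 m n) (F := fun v => f' (y1 v))) => //.
    + exact: (coords_open C1).
    + by move=> v [].
    + by move=> j; apply: Ck_sub (Cl k j).
    + exact: (coords_smooth C1 sf').
  apply: (Ck_comp (W := V2) (G := @rsubmx _ 1 m n) (F := fun v => f' (y2 v))) => //.
  + exact: (coords_open C2).
  + by move=> v [].
  + by move=> j; apply: Ck_sub (Cr k j).
  + exact: (coords_smooth C2 sf').
Qed.

Lemma prod_manifold m n M N : manifold m M -> manifold n N ->
  manifold (m + n) (prod_space M N).
Proof.
move=> /manifold_coords [dM cM bM] /manifold_coords [dN cN bN].
apply: coords_manifold; first exact: dspace_prod.
  by move=> p; exact: prod_coords.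
exact: prod_second_countable.
Qed.

(** By the rank normal form J is L times the column block (1; 0) times an invertible matrix, with L
    invertible; the last d columns of L complete J. *)
Lemma complete_unitmx (c d : nat) (J : 'M[R]_(c + d, c)) : \rank J = c ->
  exists C : 'M[R]_(c + d, d), row_mx J C \in unitmx.
Proof.
move=> rJ; pose L : 'M[R]_(c + d) := col_ebase J.
exists (rsubmx L).
suff -> : row_mx J (rsubmx L) = L *m block_mx (row_ebase J) 0 0 1%:M.
  rewrite unitmx_mul col_ebase_unit /= unitmxE det_ublock det1 mulr1.
  by rewrite -unitmxE row_ebase_unit.
rewrite -[L in RHS]hsubmxK mul_row_block !mulmx0 mulmx1 addr0 add0r; congr row_mx.
rewrite -[LHS](mulmx_ebase J) rJ; congr (_ *m _).
have -> : pid_mx c = col_mx 1%:M 0 :> 'M[R]_(c + d, c).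
  apply/matrixP => i j; rewrite -(splitK i); case: (fintype.split i) => a /=.
    by rewrite col_mxEu !mxE /= ltn_ord andbT.
  by rewrite col_mxEd !mxE /= ltnNge leq_addr andbF.
by rewrite -[col_ebase J]hsubmxK mul_row_col mulmx1 mulmx0 addr0.
Qed.

Lemma tangent_jac n c M x y h V (q : M) u (g : 'I_c -> M -> R) : dspace M ->
  @coords R n M x y h V -> h q <> 0 -> tangent q u -> (forall j, smooth (g j)) ->
  \row_j u (g j) =
  (\row_i u (fun q => x q 0 i)) *m jac (fun v => \row_j g j (y v)) (x q).
Proof.
move=> dM C hq tu sg; apply/rowP => j; rewrite !mxE (tangent_coords dM C hq tu (sg j)).
apply: eq_bigr => i _; rewrite !mxE.
have -> // : (fun z => (\row_j0 g j0 (y z)) 0 j) = (fun v => g j (y v)).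
by apply: funext => v; rewrite mxE.
Qed.

Lemma rank_jac n c M x y h V (q : M) (g : 'I_c -> M -> R) : dspace M ->
  @coords R n M x y h V -> h q <> 0 -> (forall j, smooth (g j)) ->
  (forall w : 'rV[R]_c, exists2 u, tangent q u & forall j, u (g j) = w 0 j) ->
  \rank (jac (fun v => \row_j g j (y v)) (x q)) = c.
Proof.
move=> dM C hq sg surj; set J := jac _ _.
apply/eqP; rewrite -[_ == _]/(row_full J) -sub1mx; apply/row_subP => i.
have [u tu hu] := surj (row i 1%:M).
have := tangent_jac dM C hq tu sg; rewrite -/J.
have -> : \row_j u (g j) = row i 1%:M by apply/rowP => j; rewrite mxE hu.
by move=> ->; exact: submxMl.
Qed.

(* Q is cut out near p by c functions with independent differentials; the
   complementary coordinates are x *m D where [J | D] is invertible, J being the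
   Jacobian of the equations. *)
Lemma regular_coords c d M (Q : M -> Prop) (p : sub_space Q) (g : 'I_c -> M -> R)
    (h0 : M -> R) : dspace M -> has_coords (c + d) (sval p) ->
  (forall j, smooth (g j)) -> smooth h0 -> h0 (sval p) <> 0 ->
  (forall q, h0 q <> 0 -> (Q q <-> forall j, g j q = 0)) ->
  (forall w : 'rV[R]_c, exists2 u, tangent (sval p) u & forall j, u (g j) = w 0 j) ->
  has_coords d p /\
  forall u, tangent (sval p) u -> (forall j, u (g j) = 0) ->
        exists2 u', tangent p u' & pushv Q u' = u.
Proof.
move=> dM [x [y [h [V [C hp]]]]] sg sh0 h0p Qg surj.
pose v0 := x (sval p).
have [Vv0 yv0] := coords_xV C hp; rewrite -/v0 in Vv0 yv0.
pose gam v : 'rV[R]_c := \row_j g j (y v).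
have gamE j : (fun v => gam v 0 j) = (fun v => g j (y v)).
  by apply: funext => v; rewrite mxE.
have sgam j : smooth_on V (fun v => gam v 0 j).
  by rewrite gamE; exact: (coords_smooth C (sg j)).
have rJ := rank_jac dM C hp sg surj.
pose J := jac gam v0; rewrite -/gam -/v0 -/J in rJ.
have [D UD] := complete_unitmx rJ.
have oV := coords_open C.
pose Psi v : 'rV[R]_(c + d) := row_mx (gam v) ((v - v0) *m D).
have linE l (v : 'rV[R]_(c + d)) : ((v - v0) *m D) 0 l =
    (v *m col l D) 0 0 + - (v0 *m D) 0 l.
  by rewrite mulmxBl rV_subE; congr (_ - _); rewrite !mxE; apply: eq_bigr => i _; rewrite mxE.
have CD k (W : set 'rV[R]_(c + d)) l : open W -> Ck k W (fun v => ((v - v0) *m D) 0 l).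
  move=> oW; have := CkD oW (Ck_linear k W (col l D)) (Ck_cst k W (- (v0 *m D) 0 l)).
  by apply: Ck_ext => // v _; rewrite linE.
have PsiL j : (fun v => Psi v 0 (lshift d j)) = (fun v => gam v 0 j).
  by apply: funext => v; rewrite /Psi row_mxEl.
have PsiR j : (fun v => Psi v 0 (rshift c j)) = (fun v => ((v - v0) *m D) 0 j).
  by apply: funext => v; rewrite /Psi row_mxEr.
have sPsi j : smooth_on V (fun v => Psi v 0 j).
  rewrite -(splitK j); case: (fintype.split j) => i /= k.
    by rewrite PsiL; exact: sgam.
  by rewrite PsiR; exact: CD.
have jPsi : jac Psi v0 = row_mx J D.
  apply/matrixP => i j; rewrite mxE -(splitK j); case: (fintype.split j) => l /=.
    by rewrite PsiL row_mxEl mxE.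
  rewrite PsiR row_mxEr (funext (linE l)).
  have d1 := linear_is_derive (col l D) v0 (delta_mx 0 i).
  have [_ ->] := is_deriveD d1 (is_derive_cst (- (v0 *m D) 0 l) v0 (delta_mx 0 i)).
  by rewrite addr0 -rowE !mxE.
have UPsi : jac Psi v0 \in unitmx by rewrite jPsi.
have [V' [W [G [[oV' oW] [V'V V'v0] PG GP sG]]]] := inverse_function oV Vv0 sPsi UPsi.
have [chi [b [r [[_ sb] [bp r0] rV' [cr bc] _]]]] := rV_bump oV' V'v0.
have bV' v : b v <> 0 -> V' v.
  by move=> bv; apply/rV'/ltW/cr; rewrite bc //; apply/eqP; exact: oner_neq0.
(* In the coordinates [Psi] the subset Q is the slice where the first c coordinates vanish, and [io]
   parametrises this slice. *)
pose io (w : 'rV[R]_d) : 'rV[R]_(c + d) := row_mx 0 w.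
have Cio k (U : set 'rV[R]_d) j : open U -> Ck k U (fun w => io w 0 j).
  move=> oU; rewrite -(splitK j); case: (fintype.split j) => l /=.
    by apply: Ck_ext (Ck_cst k U 0) => // w _; rewrite row_mxEl mxE.
  by apply: Ck_ext (Ck_coord k l oU) => // w _; rewrite row_mxEr.
pose W1 : set 'rV[R]_d := [set w | setT w /\ W (io w)].
have oW1 : open W1.
  apply: Ck_preimage_open => //; first exact: openT.
  by move=> j; apply: Cio; exact: openT.
have sGio j : smooth_on W1 (fun w => G (io w) 0 j).
  move=> k; apply: (Ck_comp (W := W) (F := fun z => G z 0 j)) (sG j k) => //.
    by move=> w [].
  by move=> l; exact: Cio.
have sGf (f : 'rV[R]_(c + d) -> R) : smooth_on V f -> smooth_on W1 (fun w => f (G (io w))).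
  move=> sf k; apply: (Ck_comp (W := V) (G := fun w => G (io w))) (sf k) => //.
    by move=> w [_ /GP [/V'V]].
  by move=> j; exact: sGio.
(* Nonvanishing of F keeps the point where [h0] is nonzero, so that Q is described by the equations,
   and inside the domain V' of the local inverse. *)
pose F w := h0 (y (G (io w))) * b (G (io w)).
have sF : smooth_on W1 F.
  move=> k; apply: CkM => //.
    exact: (sGf _ (coords_smooth C sh0)).
  by apply: (sGf b) => l; apply: Ck_sub (sb l).
pose W' := [set w | W1 w /\ F w <> 0].
have oW' : open W' by exact: open_neq0 (sF 0%N).
pose x' (q : sub_space Q) : 'rV[R]_d := (x (sval q) - v0) *m D.
(* The default value p is never taken on W', where the equations hold and so put the point in Q. *)
pose y' (w : 'rV[R]_d) : sub_space Q :=
  if pselect (Q (y (G (io w)))) is left Qw then exist _ _ Qw else p.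
pose h' (q : sub_space Q) := h0 (sval q) * h (sval q) * b (x (sval q)).
have Fn w : W' w -> [/\ h0 (y (G (io w))) <> 0, b (G (io w)) <> 0 & V' (G (io w))].
  move=> [_ Fw]; have b0 : b (G (io w)) <> 0 by move=> e; apply: Fw; rewrite /F e mulr0.
  by split=> //; [move=> e; apply: Fw; rewrite /F e mul0r | exact: bV'].
have W'P w : W' w -> [/\ gam (G (io w)) = 0, (G (io w) - v0) *m D = w &
    sval (y' w) = y (G (io w))].
  move=> W'w; have [h0w bw V'w] := Fn w W'w; have [[_ Ww] _] := W'w.
  have [_ e] := GP _ Ww; have [e1 e2] := eq_row_mx e.
  have Qw : Q (y (G (io w))).
    by apply/(Qg _ h0w) => j; have := congr1 (fun z : 'rV_c => z 0 j) e1; rewrite !mxE.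
  by split=> //; rewrite /y'; case: pselect.
have hn (q : sub_space Q) : h' q <> 0 ->
    [/\ h0 (sval q) <> 0, h (sval q) <> 0 & V' (x (sval q))].
  move=> hq; split; [| |apply: bV'] => e; apply: hq; rewrite /h' e ?mul0r ?mulr0 //.
  by rewrite mul0r.
have dS := @dspace_sub R M Q.
have sres f : smooth f -> smooth (fun q : sub_space Q => f (sval q)).
  by move=> sf; exact: (smooth_sval sf).
have xx z : V z -> x (y z) = z by move=> /(coords_yV C) [].
have sx' j : smooth (fun q => x' q 0 j).
  exact: (sres _ (coords_comp dM C (fun k => CD k setT j openT))).
have C' : coords x' y' h' W'.
  split=> //.
  - apply: (sres (fun q => h0 q * h q * b (x q))).
    apply: smoothM => //; last exact: (coords_comp dM C sb).
    by apply: smoothM => //; exact: (coords_h C).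
  - move=> q h'q; have [h0q hq V'q] := hn q h'q.
    have [Vq yq] := coords_xV C hq; have [WP GPq] := PG _ V'q.
    have g0 : gam (x (sval q)) = 0.
      by apply/rowP => j; rewrite !mxE yq; move: j; apply/(Qg _ h0q); exact: svalP.
    have Pio : Psi (x (sval q)) = io (x' q) by rewrite /Psi g0.
    rewrite Pio in WP GPq.
    have W'q : W' (x' q).
      split; first by split.
      rewrite /F GPq yq => /eqP; rewrite mulf_eq0 => /orP[] /eqP // e.
      by apply: h'q; rewrite /h' e mulr0.
    split=> //; apply: eq_sig_hprop => [? ? ?|]; first exact: Prop_irrelevance.
    by have [_ _ ->] := W'P _ W'q; rewrite GPq yq.
  - move=> w W'w; have [_ e2 yE] := W'P w W'w; have [h0w bw V'w] := Fn w W'w.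
    rewrite /h' /x' yE xx ?e2; last exact: V'V.
    split=> //; have [hw _] := coords_yV C (V'V _ V'w).
    by apply/eqP; rewrite !mulf_neq0 //; exact/eqP.
  - move=> f; apply: smooth_on_gen => // _ [f' sf' ->] k.
    have : Ck k W' (fun w => f' (y (G (io w)))).
      by apply: Ck_sub (sGf _ (coords_smooth C sf') k) => w [].
    by apply: Ck_ext => // w /W'P [_ _ ->].
have h'p : h' p <> 0.
  by apply/eqP; rewrite !mulf_neq0 //; exact/eqP.
split; first by exists x', y', h', W'.
move=> u tu ug.
pose a := \row_i u (fun q => x q 0 i).
have aJ : a *m J = 0.
  rewrite -(tangent_jac dM C hp tu sg); apply/rowP => j; by rewrite !mxE.
pose u' := coord_vec x' y' p (a *m D).
have tu' : tangent p u' by exact: (coord_vec_tangent _ dS C' h'p).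
exists u' => //.
have tpu : tangent (sval p) (pushv Q u') by apply: push_tangent => //; exact: smooth_sval.
apply: (coords_tangent_eq dM C hp tpu tu).
(* [be] and a are the coordinate rows of the pushed vector and of u. Both are annihilated by J and
   they agree after multiplication by D, so the invertibility of [J | D] makes them equal. *)
pose be := \row_i (pushv Q u') (fun q => x q 0 i).
suff : be = a by move=> e j; have := congr1 (fun z : 'rV_(c + d) => z 0 j) e; rewrite !mxE.
have beJ : be *m J = 0.
  rewrite -(tangent_jac dM C hp tpu sg); apply/rowP => j; rewrite !mxE push_smooth //.
  rewrite -(tangentC 0 dS tu').
  apply: (tangent_loc (h := fun q : sub_space Q => h0 (sval q)) tu') => //.
  - exact: (sres _ (sg j)).
  - exact: smoothC.
  - exact: (sres _ sh0).
  - by move=> q h0q; move: j; apply/(Qg _ h0q); exact: svalP.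
have beD : be *m D = a *m D.
  apply/rowP => l; rewrite -(coord_vec_x (a *m D) l C' h'p) -/u'.
  have -> : (fun q : sub_space Q => x' q 0 l) =
     (fun q => \sum_i D i l * x (sval q) 0 i - (v0 *m D) 0 l).
    apply: funext => q; rewrite /x' mulmxBl rV_subE mxE; congr (_ - _).
    by apply: eq_bigr => i _; rewrite mulrC.
  have sxi i : smooth (fun q : sub_space Q => x (sval q) 0 i).
    by apply: (sres (fun q => x q 0 i)); exact: (coords_x C).
  have sDx i : smooth (fun q : sub_space Q => D i l * x (sval q) 0 i).
    by apply: smoothM => //; exact: smoothC.
  rewrite (tangentB dS tu'); [|exact: smooth_sum|exact: smoothC].
  rewrite (tangentC _ dS tu') subr0.
  rewrite (tangent_sum (index_enum 'I_(c + d)) dS tu' sDx) [LHS]mxE.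
  apply: eq_bigr => i _; rewrite (tangentZ (D i l) dS tu' (sxi i)) [LHS]mulrC mxE.
  by congr (_ * _); rewrite push_smooth //; exact: (coords_x C).
have : be *m row_mx J D = a *m row_mx J D by rewrite !mul_mx_row beJ aJ beD.
by move=> /(congr1 (mulmx^~ (invmx (row_mx J D)))); rewrite !mulmxK.
Qed.

Lemma regular_subspace m c M (Q : M -> Prop) (p : sub_space Q) (g : 'I_c -> M -> R)
    (h0 : M -> R) : dspace M -> has_coords m (sval p) ->
  (forall j, smooth (g j)) -> smooth h0 -> h0 (sval p) <> 0 ->
  (forall q, h0 q <> 0 -> (Q q <-> forall j, g j q = 0)) ->
  (forall w : 'rV[R]_c, exists2 u, tangent (sval p) u & forall j, u (g j) = w 0 j) ->
  (forall d, m = (c + d)%N -> has_coords d p) /\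
  forall u, tangent (sval p) u -> (forall j, u (g j) = 0) ->
        exists2 u', tangent p u' & pushv Q u' = u.
Proof.
move=> dM cM sg sh0 h0p Qg surj.
have cm : (c <= m)%N.
  have [x [y [h [V [C hp]]]]] := cM.
  by rewrite -(rank_jac dM C hp sg surj) rank_leq_row.
have main d : m = (c + d)%N -> has_coords d p /\
    forall u, tangent (sval p) u -> (forall j, u (g j) = 0) ->
        exists2 u', tangent p u' & pushv Q u' = u.
  by move=> e; rewrite e in cM; exact: regular_coords cM sg sh0 h0p Qg surj.
split; first by move=> d /main [].
by have [] := main (m - c)%N (esym (subnKC cm)).
Qed.

End Submanifolds.

(** * Fibre products of transverse maps *)

Section FibreProducts.
Variable R : realType.
Local Notation space := (space R).

Lemma manifold_dspace n (M : space) : manifold n M -> dspace M.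
Proof. by case/manifold_coords. Qed.

Lemma manifold_frame n (M : space) (p : M) : manifold n M -> has_frame n p.
Proof. by case/manifold_coords => dM cM _; exact: coords_frame. Qed.

Variables (M1 M2 B : space) (f1 : M1 -> B) (f2 : M2 -> B).
Let Q (x : prod_space M1 M2) := f1 x.1 = f2 x.2.
Local Notation F := (sub_space Q).

Definition fibre_fst (x : F) : M1 := (sval x).1.
Definition fibre_snd (x : F) : M2 := (sval x).2.

Lemma smooth_fibre_fst : smooth_map fibre_fst.
Proof. exact: smooth_map_comp (@smooth_sval R _ Q) (@smooth_fst R M1 M2). Qed.

Lemma smooth_fibre_snd : smooth_map fibre_snd.
Proof. exact: smooth_map_comp (@smooth_sval R _ Q) (@smooth_snd R M1 M2). Qed.

Lemma smooth_into_fibre (N : space) (f : N -> F) : dspace N ->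
  smooth_map (fun x => fibre_fst (f x)) -> smooth_map (fun x => fibre_snd (f x)) ->
  smooth_map f.
Proof.
move=> dN s1 s2; apply: smooth_into_sub => //.
have := smooth_pair dN s1 s2; congr smooth_map.
by apply: funext => x; rewrite [RHS]surjective_pairing.
Qed.

Lemma fibre_tangent_eq (p : F) u v : tangent p u -> tangent p v ->
  push fibre_fst u = push fibre_fst v -> push fibre_snd u = push fibre_snd v -> u = v.
Proof.
move=> tu tv e1 e2; apply: (tangent_sub_eq tu tv).
have t w : tangent p w -> tangent (sval p) (pushv Q w).
  by apply: push_tangent; [exact: dspace_prod | exact: smooth_sval].
apply: (tangent_prod_eq (t _ tu) (t _ tv)).
  by rewrite !push_comp //; exact: smooth_fst.
by rewrite !push_comp //; exact: smooth_snd.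
Qed.

Definition transverse_at (p1 : M1) (p2 : M2) := forall w, tangent (f1 p1) w ->
  exists (u1 : vec M1) (u2 : vec M2),
    [/\ tangent p1 u1, tangent p2 u2 & w = comb 1 (push f1 u1) (push f2 u2)].

Hypotheses (sf1 : smooth_map f1) (sf2 : smooth_map f2).

(** In a chart z of B around the common image of p, the fibre product is cut out by the differences
    of the coordinates [z j] of f1 and f2. Transversality at p, after a change of sign in the second
    vector, makes the differentials of these equations independent. *)
Lemma fibre_product a b c (p : F) : manifold a M1 -> manifold b M2 -> manifold c B ->
  transverse_at (fibre_fst p) (fibre_snd p) ->
  (forall d, (a + b = c + d)%N -> has_coords d p) /\
  forall u1 u2, tangent (fibre_fst p) u1 -> tangent (fibre_snd p) u2 ->
    push f1 u1 = push f2 u2 -> exists u, [/\ tangent p u, push fibre_fst u = u1 &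
      push fibre_snd u = u2].
Proof.
move=> /manifold_coords [d1 c1 _] /manifold_coords [d2 c2 _] /manifold_coords [dB cB _] tr.
have [z [y [h [V [C hp]]]]] := cB (f1 (fibre_fst p)).
have dP := @dspace_prod R M1 M2.
pose g j (q : prod_space M1 M2) := z (f1 q.1) 0 j - z (f2 q.2) 0 j.
have sz1 j : smooth (fun q : prod_space M1 M2 => z (f1 q.1) 0 j).
  exact: (smooth_fst (N := M2) (sf1 (coords_x C j))).
have sz2 j : smooth (fun q : prod_space M1 M2 => z (f2 q.2) 0 j).
  exact: (smooth_snd (M := M1) (sf2 (coords_x C j))).
have sg j : smooth (g j) by exact: smoothB.
pose h0 (q : prod_space M1 M2) := h (f1 q.1) * h (f2 q.2).
have sh0 : smooth h0.
  apply: smoothM => //; first exact: (smooth_fst (N := M2) (sf1 (coords_h C))).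
  exact: (smooth_snd (M := M1) (sf2 (coords_h C))).
have eqp : f1 (fibre_fst p) = f2 (fibre_snd p) := svalP p.
have h0p : h0 (sval p) <> 0.
  by apply/eqP; rewrite mulf_neq0 //; apply/eqP; rewrite -?eqp.
have Qg q : h0 q <> 0 -> (Q q <-> forall j, g j q = 0).
  move=> h0q.
  have hq1 : h (f1 q.1) <> 0 by move=> e; apply: h0q; rewrite /h0 e mul0r.
  have hq2 : h (f2 q.2) <> 0 by move=> e; apply: h0q; rewrite /h0 e mulr0.
  split=> [e j|e]; first by rewrite /g e subrr.
  have [_ e1] := coords_xV C hq1; have [_ e2] := coords_xV C hq2.
  rewrite /Q -e1 -e2; congr y; apply/rowP => j; apply/eqP; rewrite -subr_eq0; apply/eqP.
  exact: (e j).
have ug u1 u2 j : tangent (fibre_fst p) u1 -> tangent (fibre_snd p) u2 ->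
    pair_vec (sval p) u1 u2 (g j) =
    push f1 u1 (fun q => z q 0 j) - push f2 u2 (fun q => z q 0 j).
  move=> tu1 tu2; have [tu e1 e2] := pair_vecP d1 d2 tu1 tu2.
  rewrite (tangentB dP tu) // !push_smooth; try exact: (coords_x C).
  have -> : u1 (fun x => z (f1 x) 0 j) = push1 (pair_vec (sval p) u1 u2) (fun x => z (f1 x) 0 j).
    by rewrite e1.
  have -> : u2 (fun x => z (f2 x) 0 j) = push2 (pair_vec (sval p) u1 u2) (fun x => z (f2 x) 0 j).
    by rewrite e2.
  rewrite !push_smooth //; [exact: (sf2 (coords_x C j)) | exact: (sf1 (coords_x C j))].
have surj (w : 'rV[R]_c) : exists2 u, tangent (sval p) u & forall j, u (g j) = w 0 j.
  have [u1 [u2 [tu1 tu2 we]]] := tr _ (coord_vec_tangent w dB C hp).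
  have tu2' : tangent (fibre_snd p) (comb (-1) u2 (@vec0 R M2)).
    by apply: tangent_comb => //; exact: tangent_vec0.
  exists (pair_vec (sval p) u1 (comb (-1) u2 (@vec0 R M2))).
    by have [] := pair_vecP d1 d2 tu1 tu2'.
  move=> j; rewrite ug // push_comb push_vec0 -(coord_vec_x w j C hp) we.
  by rewrite /comb /vec0 addr0 mulN1r opprK mul1r.
have [hc lift] := regular_subspace dP (prod_coords d1 d2 (c1 _) (c2 _)) sg sh0 h0p Qg surj.
split=> // u1 u2 tu1 tu2 e12.
have [tu e1 e2] := pair_vecP d1 d2 tu1 tu2.
have [|u' tu' e'] := lift _ tu; first by move=> j; rewrite ug // e12 subrr.
exists u'; split=> //.
  by rewrite -[RHS]e1 -e' push_comp //; exact: smooth_fst.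
by rewrite -[RHS]e2 -e' push_comp //; exact: smooth_snd.
Qed.

Lemma fibre_manifold a b c d : manifold a M1 -> manifold b M2 -> manifold c B ->
  transverse f1 f2 -> (a + b = c + d)%N -> manifold d F.
Proof.
move=> m1 m2 mB tr e.
apply: coords_manifold; first exact: dspace_sub.
  move=> p; have [h _] := fibre_product m1 m2 mB (tr _ _ (svalP p)).
  exact: h.
have [d1 _ b1] := manifold_coords m1; have [d2 _ b2] := manifold_coords m2.
by apply: sub_second_countable; [exact: dspace_prod | exact: prod_second_countable].
Qed.

End FibreProducts.

(** * Differential forms *)

Section Forms.
Variable R : realType.
Local Notation space := (space R).
Implicit Types M N P : space.

Lemma covector0 M (p : M) a : covector p a -> a (@vec0 R M) = 0.
Proof.
move=> ca; have := ca (-1) _ _ (tangent_vec0 p) (tangent_vec0 p).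
rewrite (_ : comb _ _ _ = @vec0 R M); first by rewrite mulN1r addNr.
by apply: funext => f; rewrite /comb /vec0 mulr0 addr0.
Qed.

Definition lincomb n M (c : 'I_n -> R) (E : 'I_n -> vec M) : vec M :=
  fun f => \sum_i c i * E i f.

Lemma lincomb_seq M (p : M) (I : Type) (r : seq I) (c : I -> R) (E : I -> vec M) :
  (forall i, tangent p (E i)) ->
  tangent p (fun f => \sum_(i <- r) c i * E i f) /\
  forall a, covector p a ->
    a (fun f => \sum_(i <- r) c i * E i f) = \sum_(i <- r) c i * a (E i).
Proof.
move=> tE; elim: r => [|i r [IHt IH]].
  have -> : (fun f : M -> R => \sum_(i <- [::]) c i * E i f) = @vec0 R M.
    by apply: funext => f; rewrite big_nil.
  by split=> [|a ca]; [exact: tangent_vec0 | rewrite big_nil (covector0 ca)].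
have -> : (fun f : M -> R => \sum_(i <- i :: r) c i * E i f) =
    comb (c i) (E i) (fun f => \sum_(i <- r) c i * E i f).
  by apply: funext => f; rewrite big_cons.
split; first exact: tangent_comb.
by move=> a ca; rewrite ca // big_cons IH.
Qed.

Lemma tangent_lincomb n M (p : M) (c : 'I_n -> R) (E : 'I_n -> vec M) :
  (forall i, tangent p (E i)) -> tangent p (lincomb c E).
Proof. by move=> tE; have [] := lincomb_seq (index_enum 'I_n) c tE. Qed.

Lemma covector_lincomb n M (p : M) (c : 'I_n -> R) (E : 'I_n -> vec M) a :
  covector p a -> (forall i, tangent p (E i)) -> a (lincomb c E) = \sum_i c i * a (E i).
Proof. by move=> ca tE; have [_ h] := lincomb_seq (index_enum 'I_n) c tE; exact: h. Qed.

Lemma push_lincomb n M N (f : M -> N) (c : 'I_n -> R) (E : 'I_n -> vec M) :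
  push f (lincomb c E) = lincomb c (fun i => push f (E i)).
Proof.
apply: funext => g; rewrite /push /lincomb; case: asboolP => // _.
by rewrite big1 // => i _; rewrite mulr0.
Qed.

Lemma vfield_lincomb n M (c : 'I_n -> M -> R) (E : 'I_n -> M -> vec M) : dspace M ->
  (forall i, smooth (c i)) -> (forall i, vfield (E i)) ->
  vfield (fun q => lincomb (c ^~ q) (E ^~ q)).
Proof.
move=> dM sc vE; split=> [p|f sf].
  by apply: tangent_lincomb => i; exact: (vfield_tangent (vE i)).
apply: smooth_sum => // i; apply: smoothM => //.
exact: (vfield_smooth (vE i)).
Qed.

Lemma vfield_extend n M (p : M) u : dspace M -> has_frame n p -> tangent p u ->
  exists2 X, vfield X & X p = u.
Proof.
move=> dM [x [E [h [F hp]]]] tu.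
exists (fun q => lincomb (fun i => u (x i)) (E ^~ q)).
  apply: (vfield_lincomb (c := fun i _ => u (x i))) => //; last exact: (frame_E F).
  by move=> i; exact: smoothC.
exact: esym (frame_span F hp tu).
Qed.

Lemma vfield_lie M X Y : dspace M -> @vfield R M X -> vfield Y -> vfield (lie X Y).
Proof.
move=> dM vX vY.
have sX f : smooth f -> smooth (fun q => X q f) := vfield_smooth vX (f:=f).
have sY f : smooth f -> smooth (fun q => Y q f) := vfield_smooth vY (f:=f).
have tX p : tangent p (X p) := vfield_tangent vX p.
have tY p : tangent p (Y p) := vfield_tangent vY p.
split=> [p|f sf]; last first.
  by apply: smoothB => //; [apply/sX/sY | apply/sY/sX].
split.
- move=> f nf; rewrite /lie.
  have -> : (fun q => Y q f) = fun=> 0 by apply: funext => q; exact: (tangent_junk (tY q)).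
  have -> : (fun q => X q f) = fun=> 0 by apply: funext => q; exact: (tangent_junk (tX q)).
  by rewrite (tangentC _ dM (tX p)) (tangentC _ dM (tY p)) subrr.
- move=> a f g sf sg; rewrite /lie.
  have -> : (fun q => Y q (fun x => a * f x + g x)) = fun q => a * Y q f + Y q g.
    by apply: funext => q; rewrite (tangent_lin (tY q)).
  have -> : (fun q => X q (fun x => a * f x + g x)) = fun q => a * X q f + X q g.
    by apply: funext => q; rewrite (tangent_lin (tX q)).
  rewrite (tangent_lin (tX p)); [|exact: sY|exact: sY].
  rewrite (tangent_lin (tY p)); [|exact: sX|exact: sX].
  ring.
- move=> f g sf sg; rewrite /lie.
  have -> : (fun q => Y q (fun x => f x * g x)) = fun q => f q * Y q g + Y q f * g q.
    by apply: funext => q; rewrite (tangent_leibniz (tY q)).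
  have -> : (fun q => X q (fun x => f x * g x)) = fun q => f q * X q g + X q f * g q.
    by apply: funext => q; rewrite (tangent_leibniz (tX q)).
  have := sX f sf; have := sY f sf; have := sX g sg; have := sY g sg => Yg Xg Yf Xf.
  rewrite (tangentD (tX p)); [|exact: smoothM|exact: smoothM].
  rewrite (tangentD (tY p)); [|exact: smoothM|exact: smoothM].
  rewrite !(tangent_leibniz (tX p)) // !(tangent_leibniz (tY p)) //.
  ring.
Qed.

Definition bil n (a : 'I_n -> 'I_n -> R) (u v : 'I_n -> R) : R :=
  \sum_i \sum_j a i j * u i * v j.

Definition tri n (a : 'I_n -> 'I_n -> 'I_n -> R) (u v w : 'I_n -> R) : R :=
  \sum_i \sum_j \sum_k a i j k * u i * v j * w k.

Lemma bil_swap n a (u v : 'I_n -> R) : (forall i j, a i j = - a j i) ->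
  bil a u v = - bil a v u.
Proof.
move=> h; rewrite /bil exchange_big /= -sumrN; apply: eq_bigr => i _.
by rewrite -sumrN; apply: eq_bigr => j _; rewrite h; ring.
Qed.

Lemma bilB n a (u u' v : 'I_n -> R) : bil a (fun i => u i - u' i) v = bil a u v - bil a u' v.
Proof.
rewrite /bil -sumrB; apply: eq_bigr => i _; rewrite -sumrB; apply: eq_bigr => j _.
ring.
Qed.

Lemma tri_swap12 n a (u v w : 'I_n -> R) : (forall i j k, a i j k = - a j i k) ->
  tri a u v w = - tri a v u w.
Proof.
move=> h; rewrite /tri exchange_big /= -sumrN; apply: eq_bigr => i _.
rewrite -sumrN; apply: eq_bigr => j _; rewrite -sumrN; apply: eq_bigr => k _.
by rewrite h; ring.
Qed.

Lemma tri_swap23 n a (u v w : 'I_n -> R) : (forall i j k, a i j k = - a i k j) ->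
  tri a u v w = - tri a u w v.
Proof.
move=> h; rewrite /tri -sumrN; apply: eq_bigr => i _; rewrite exchange_big /= -sumrN.
apply: eq_bigr => j _; rewrite -sumrN; apply: eq_bigr => k _.
by rewrite h; ring.
Qed.

Lemma triB n a (u u' v w : 'I_n -> R) :
  tri a (fun i => u i - u' i) v w = tri a u v w - tri a u' v w.
Proof.
rewrite /tri -sumrB; apply: eq_bigr => i _; rewrite -sumrB; apply: eq_bigr => j _.
rewrite -sumrB; apply: eq_bigr => k _; ring.
Qed.

Lemma smooth_bil n M (a : 'I_n -> 'I_n -> M -> R) (u v : 'I_n -> M -> R) : dspace M ->
  (forall i j, smooth (a i j)) -> (forall i, smooth (u i)) -> (forall i, smooth (v i)) ->
  smooth (fun q => bil (fun i j => a i j q) (u ^~ q) (v ^~ q)).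
Proof.
move=> dM sa su sv; apply: smooth_sum => // i; apply: smooth_sum => // j.
by apply: smoothM => //; exact: smoothM.
Qed.

Lemma smooth_tri n M (a : 'I_n -> 'I_n -> 'I_n -> M -> R) (u v w : 'I_n -> M -> R) : dspace M ->
  (forall i j k, smooth (a i j k)) -> (forall i, smooth (u i)) -> (forall i, smooth (v i)) ->
  (forall i, smooth (w i)) ->
  smooth (fun q => tri (fun i j k => a i j k q) (u ^~ q) (v ^~ q) (w ^~ q)).
Proof.
move=> dM sa su sv sw; apply: smooth_sum => // i; apply: smooth_sum => // j.
apply: smooth_sum => // k; apply: smoothM => //; apply: smoothM => //; exact: smoothM.
Qed.

Lemma tangent_bil n M (p : M) X (a : 'I_n -> 'I_n -> M -> R) (u v : 'I_n -> M -> R) :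
  dspace M -> tangent p X ->
  (forall i j, smooth (a i j)) -> (forall i, smooth (u i)) -> (forall i, smooth (v i)) ->
  X (fun q => bil (fun i j => a i j q) (u ^~ q) (v ^~ q)) =
    bil (fun i j => X (a i j)) (u ^~ p) (v ^~ p) +
    bil (fun i j => a i j p) (fun i => X (u i)) (v ^~ p) +
    bil (fun i j => a i j p) (u ^~ p) (fun i => X (v i)).
Proof.
move=> dM tX sa su sv; rewrite (tangent_sum _ dM tX); last first.
  by move=> i; apply: smooth_sum => // j; apply: smoothM => //; exact: smoothM.
rewrite /bil -!big_split; apply: eq_bigr => i _ /=; rewrite (tangent_sum _ dM tX); last first.
  by move=> j; apply: smoothM => //; exact: smoothM.
rewrite -!big_split; apply: eq_bigr => j _ /=.
rewrite (tangent_leibniz tX) //; last exact: smoothM.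
rewrite (tangent_leibniz tX) //; ring.
Qed.

Lemma tangent_tri n M (p : M) X (a : 'I_n -> 'I_n -> 'I_n -> M -> R) (u v w : 'I_n -> M -> R) :
  dspace M -> tangent p X ->
  (forall i j k, smooth (a i j k)) -> (forall i, smooth (u i)) -> (forall i, smooth (v i)) ->
  (forall i, smooth (w i)) ->
  X (fun q => tri (fun i j k => a i j k q) (u ^~ q) (v ^~ q) (w ^~ q)) =
    tri (fun i j k => X (a i j k)) (u ^~ p) (v ^~ p) (w ^~ p) +
    tri (fun i j k => a i j k p) (fun i => X (u i)) (v ^~ p) (w ^~ p) +
    tri (fun i j k => a i j k p) (u ^~ p) (fun i => X (v i)) (w ^~ p) +
    tri (fun i j k => a i j k p) (u ^~ p) (v ^~ p) (fun i => X (w i)).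
Proof.
move=> dM tX sa su sv sw.
have s2 i j k : smooth (fun q => a i j k q * u i q) by exact: smoothM.
have s3 i j k : smooth (fun q => a i j k q * u i q * v j q) by exact: smoothM.
have s4 i j k : smooth (fun q => a i j k q * u i q * v j q * w k q) by exact: smoothM.
rewrite (tangent_sum _ dM tX); last first.
  by move=> i; apply: smooth_sum => // j; exact: smooth_sum.
rewrite /tri -!big_split; apply: eq_bigr => i _ /=; rewrite (tangent_sum _ dM tX); last first.
  by move=> j; exact: smooth_sum.
rewrite -!big_split; apply: eq_bigr => j _ /=; rewrite (tangent_sum _ dM tX) //.
rewrite -!big_split; apply: eq_bigr => k _ /=.
rewrite (tangent_leibniz tX) // (tangent_leibniz tX) // (tangent_leibniz tX) //; ring.
Qed.

Lemma form2_covl M (s : M -> vec M -> vec M -> R) (p : M) w : form2 s -> tangent p w -> covector p (s p ^~ w).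
Proof. by move=> fs tw c u v tu tv; exact: (form2_lin fs). Qed.

(** Supplies the function by which the tensoriality arguments perturb a vector field without
    changing its value at p. The only exception is dimension zero, where all tangent vectors
    vanish. *)
Lemma deriv_witness n M (p : M) : dspace M -> has_frame n p ->
  (forall u, tangent p u -> u = @vec0 R M) \/
  exists (f : M -> R) Z, [/\ smooth f, vfield Z, f p = 0 & Z p f = 1].
Proof.
move=> dM [x [E [h [F hp]]]]; case: n x E F => [|n] x E F.
  left=> u tu; rewrite (frame_span F hp tu).
  by apply: funext => f; rewrite big_ord0.
right; have sx := frame_x F 0; exists (fun q => x 0 q - x 0 p), (E 0); split.
- by apply: smoothB => //; exact: smoothC.
- exact: (frame_E F 0).
- by rewrite subrr.
- have tE := vfield_tangent (frame_E F 0) p.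
  by rewrite (tangentB dM tE) ?(tangentC _ dM tE) ?subr0 ?(frame_delta F hp) //; exact: smoothC.
Qed.

(** The perturbation used for tensoriality: where f vanishes the field keeps its value, while its
    bracket with X changes by a multiple X(f) of W. *)
Definition addf M (Y : M -> vec M) (f : M -> R) (W : M -> vec M) : M -> vec M :=
  fun q => comb (f q) (W q) (Y q).

Lemma vfield_addf M Y f W : dspace M -> @vfield R M Y -> smooth f -> vfield W ->
  vfield (addf Y f W).
Proof.
move=> dM vY sf vW; split=> [p|g sg].
  by apply: tangent_comb; [exact: (vfield_tangent vW) | exact: (vfield_tangent vY)].
apply: smoothD => //; last exact: (vfield_smooth vY).
by apply: smoothM => //; exact: (vfield_smooth vW).
Qed.

Lemma addf_at M Y f W (p : M) : f p = 0 -> addf Y f W p = Y p.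
Proof. by move=> f0; apply: funext => g; rewrite /addf /comb f0 mul0r add0r. Qed.

Lemma lie_addfr M X Y f W (p : M) : dspace M -> @vfield R M X -> vfield Y -> smooth f ->
  vfield W -> f p = 0 -> lie X (addf Y f W) p = comb (X p f) (W p) (lie X Y p).
Proof.
move=> dM vX vY sf vW f0; have vA := vfield_addf dM vY sf vW.
apply: (tangent_eq (p := p)).
- exact: (vfield_tangent (vfield_lie dM vX vA)).
- apply: tangent_comb; first exact: (vfield_tangent vW).
  exact: (vfield_tangent (vfield_lie dM vX vY)).
move=> g sg; rewrite /lie addf_at // /comb.
have tX := vfield_tangent vX p.
have sW := vfield_smooth vW sg; have sY := vfield_smooth vY sg.
have -> : (fun q => addf Y f W q g) = (fun q => f q * W q g + Y q g) by [].
rewrite (tangentD tX) //; last exact: smoothM.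
by rewrite (tangent_leibniz tX) // f0 mul0r add0r addrA.
Qed.

Lemma lie_addfl M X Y f W (p : M) : dspace M -> @vfield R M X -> vfield Y -> smooth f ->
  vfield W -> f p = 0 -> lie (addf Y f W) X p = comb (- X p f) (W p) (lie Y X p).
Proof.
move=> dM vX vY sf vW f0; have := lie_addfr dM vX vY sf vW f0.
move=> /(congr1 (fun u : vec M => fun g => - u g)) h.
have -> : lie (addf Y f W) X p = (fun g => - lie X (addf Y f W) p g).
  by apply: funext => g; rewrite /lie opprB.
by rewrite h; apply: funext => g; rewrite /comb /lie; ring.
Qed.

Definition alt2 M (s : M -> vec M -> vec M -> R) := forall p u v,
  tangent p u -> tangent p v -> s p u v = - s p v u.

Definition alt3 M (h : M -> vec M -> vec M -> vec M -> R) := forall p u v w,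
  tangent p u -> tangent p v -> tangent p w ->
  h p u v w = - h p v u w /\ h p u v w = - h p u w v.

(* [form2] only asks for linearity in the first slot; antisymmetry is forced by
   the tensoriality of the exterior derivative. *)
Lemma form2_alt2 n M (s : M -> vec M -> vec M -> R) : dspace M -> (forall p : M, has_frame n p) -> form2 s ->
  (forall X Y Y' Z p, vfield X -> vfield Y -> vfield Y' -> vfield Z -> Y p = Y' p ->
     d2 s X Y Z p = d2 s X Y' Z p) -> alt2 s.
Proof.
move=> dM fr fs tens p.
case: (deriv_witness dM (fr p)) => [z0|[f [Z [sf vZ f0 Zf]]]].
  move=> u v tu tv; rewrite (z0 u tu) (z0 v tv).
  by rewrite (form2_alt fs (tangent_vec0 p)) oppr0.
(* This compares [d2 s] on Y and on Y + f W. If s were already additive in the second slot, the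
   identity would be antisymmetry itself. *)
have key W Y X : vfield W -> vfield Y -> vfield X ->
    Z p (fun q => s q (X q) (addf Y f W q)) = Z p (fun q => s q (X q) (Y q)) - s p (W p) (X p).
  move=> vW vY vX; have vA := vfield_addf dM vY sf vW.
  have := tens X Y (addf Y f W) Z p vX vY vA vZ (esym (addf_at _ _ f0)).
  have t (V : M -> vec M) : vfield V -> forall q, tangent q (V q) := fun vV q => vfield_tangent vV q.
  have vl := fun V V' => @vfield_lie M V V' dM.
  rewrite /d2 lie_addfr // lie_addfl // addf_at //.
  rewrite !(form2_lin fs); try exact: t; try by apply: t; exact: vl.
  have -> : (fun q => s q (addf Y f W q) (Z q)) =
            (fun q => f q * s q (W q) (Z q) + s q (Y q) (Z q)).
    by apply: funext => q; rewrite (form2_lin fs) //; exact: t.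
  have tX := t X vX p.
  have s1 := form2_smooth fs vW vZ; have s2 := form2_smooth fs vY vZ.
  rewrite (tangentD tX) //; last exact: smoothM.
  rewrite (tangent_leibniz tX) // f0 Zf => h.
  by move: h; lra.
(* The one case of additivity in the second slot that antisymmetry needs: with it, expanding s(u+v,
   u+v) = 0 in the first slot leaves s(u,v) + s(v,u) = 0. *)
have absorb u v : tangent p u -> tangent p v -> s p u (comb 1 v u) = s p u v.
  move=> tu tv.
  have [W vW We] := vfield_extend dM (fr p) tu.
  have [Y vY Ye] := vfield_extend dM (fr p) tv.
  have t (V : M -> vec M) : vfield V -> forall q, tangent q (V q) := fun vV q => vfield_tangent vV q.
  pose X q := comb 1 (Y q) (W q).
  have vX : vfield X by exact: (vfield_addf dM vW (smoothC 1 dM) vY).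
  have k1 := key W Y W vW vY vW; rewrite (form2_alt fs (t W vW p)) subr0 in k1.
  have vA := vfield_addf dM vY sf vW.
  have := key W Y X vW vY vX.
  have -> : (fun q => s q (X q) (addf Y f W q)) =
      (fun q => (1 - f q) * s q (W q) (addf Y f W q)).
    apply: funext => q.
    (* Written this way, Y + W has the second argument Y + f W as a summand, and the corresponding
       term vanishes by alternation. *)
    have -> : X q = comb (1 - f q) (W q) (addf Y f W q).
      by apply: funext => g; rewrite /X /addf /comb; ring.
    rewrite (form2_lin fs) ?(form2_alt fs) ?addr0 //; try exact: t.
  have -> : (fun q => s q (X q) (Y q)) = (fun q => s q (W q) (Y q)).
    apply: funext => q; rewrite /X (form2_lin fs); try exact: t.
    by rewrite (form2_alt fs) ?mulr0 ?add0r //; exact: t.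
  have tZ := t Z vZ p.
  have s1 := form2_smooth fs vW vA.
  have s2 : smooth (fun q => 1 - f q) by apply: smoothB => //; exact: smoothC.
  rewrite (tangent_leibniz tZ) // (tangentB dM tZ) ?(tangentC _ dM tZ) //; last exact: smoothC.
  rewrite f0 Zf k1 addf_at // /X We Ye; lra.
move=> u v tu tv.
have tuv := tangent_comb 1 tu tv.
have e : comb 1 u v = comb 1 v u by apply: funext => g; rewrite /comb; ring.
have := form2_alt fs tuv.
rewrite (form2_lin fs _ tu tv tuv) mul1r (absorb v u) // e (absorb u v) //; lra.
Qed.

Lemma form2_covr M (s : M -> vec M -> vec M -> R) (p : M) u : form2 s -> alt2 s -> tangent p u -> covector p (s p u).
Proof.
move=> fs as_ tu c v w tv tw; have tvw := tangent_comb c tv tw.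
rewrite as_ // (form2_lin fs) // (as_ _ v u) // (as_ _ w u) //; ring.
Qed.

End Forms.

(** * Antisymmetry of closed 3-forms *)

Section ThreeForms.
Variable R : realType.
Local Notation space := (space R).
Implicit Types M N P : space.

Lemma form3_cov1 M (h : M -> vec M -> vec M -> vec M -> R) (p : M) w z : form3 h ->
  tangent p w -> tangent p z -> covector p (fun u => h p u w z).
Proof. by move=> fh tw tz c u v tu tv; exact: (form3_lin fh). Qed.

(** Linearity is available in the first slot only. For phi = h(W, f W, V) the product f phi equals
    h(f W, f W, V) = 0; differentiating it along Z at p, where f = 0 and Z f = 1, gives phi(p) =
    0. *)
Lemma form3_zero2 n M (h : M -> vec M -> vec M -> vec M -> R) (p : M) w v : dspace M ->
  (forall p : M, has_frame n p) -> form3 h -> tangent p w -> tangent p v ->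
  h p w (@vec0 R M) v = 0.
Proof.
move=> dM fr fh tw tv.
case: (deriv_witness dM (fr p)) => [z0|[f [Z [sf vZ f0 Zf]]]].
  by rewrite (z0 w tw) (form3_altl fh (tangent_vec0 p) tv).
have [W vW We] := vfield_extend dM (fr p) tw.
have [V vV Ve] := vfield_extend dM (fr p) tv.
have v0 : vfield (fun _ : M => @vec0 R M).
  by split=> [q|g _]; [exact: tangent_vec0 | exact: smoothC].
have vA := vfield_addf dM v0 sf vW.
pose phi q := h q (W q) (addf (fun _ => @vec0 R M) f W q) (V q).
have sphi : smooth phi by exact: (form3_smooth fh vW vA vV).
have fphi : (fun q => f q * phi q) = fun=> 0.
  apply: funext => q; rewrite /phi; set A := addf _ _ _ q.
  have tA : tangent q A := vfield_tangent vA q.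
  have c0 := covector0 (form3_cov1 fh tA (vfield_tangent vV q)).
  have := form3_lin fh (f q) (vfield_tangent vW q) (tangent_vec0 q) tA (vfield_tangent vV q).
  rewrite c0 addr0 => <-.
  exact: (form3_altl fh tA (vfield_tangent vV q)).
have tZ := vfield_tangent vZ p.
have := tangent_leibniz tZ sf sphi; rewrite fphi (tangentC _ dM tZ) f0 Zf mul0r add0r mul1r.
by rewrite /phi addf_at // We Ve => <-.
Qed.

(* As for [form2_alt2]: [key] compares dh = 0 on Y and on Y + f W with f p = 0. *)
Lemma closed_form3_alt12 n M (h : M -> vec M -> vec M -> vec M -> R) : dspace M ->
  (forall p : M, has_frame n p) -> closed_form3 h ->
  forall p u v w, tangent p u -> tangent p v -> tangent p w -> h p u v w = - h p v u w.
Proof.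
move=> dM fr [fh dh] p.
have t (V : M -> vec M) : vfield V -> forall q, tangent q (V q) := fun vV q => vfield_tangent vV q.
have key X Y Z V W f : vfield X -> vfield Y -> vfield Z -> vfield V -> vfield W ->
  smooth f -> f p = 0 ->
  Z p (fun q => h q (X q) (addf Y f W q) (V q)) - Z p (fun q => h q (X q) (Y q) (V q))
  + Z p f * h p (W p) (X p) (V p)
  - (V p (fun q => h q (X q) (addf Y f W q) (Z q)) - V p (fun q => h q (X q) (Y q) (Z q)))
  - V p f * h p (W p) (X p) (Z p) = 0.
  move=> vX vY vZ vV vW sf f0.
  have vA := vfield_addf dM vY sf vW.
  have e1 := dh X _ Z V vX vA vZ vV p; have e2 := dh X Y Z V vX vY vZ vV p.
  have := etrans e1 (esym e2); rewrite /d3 lie_addfr // !lie_addfl // addf_at //.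
  have vl := fun V V' => @vfield_lie R M V V' dM.
  rewrite !(form3_lin fh); try exact: t; try by apply: t; exact: vl.
  have -> : (fun q => h q (addf Y f W q) (Z q) (V q)) =
            (fun q => f q * h q (W q) (Z q) (V q) + h q (Y q) (Z q) (V q)).
    by apply: funext => q; rewrite (form3_lin fh) //; exact: t.
  have tX := t X vX p.
  have s1 := form3_smooth fh vW vZ vV; have s2 := form3_smooth fh vY vZ vV.
  rewrite (tangentD tX) //; last exact: smoothM.
  rewrite (tangent_leibniz tX) // f0 => e.
  by move: e; lra.
(* The condition w f = 0 removes the terms of [key] in which f is differentiated along V, whose
   value at p is w. *)
have absorb u v w f Z : tangent p u -> tangent p v -> tangent p w -> vfield Z ->
  smooth f -> f p = 0 -> Z p f = 1 -> w f = 0 -> h p u (comb 1 v u) w = h p u v w.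
  move=> tu tv tw vZ sf f0 Zf wf.
  have [W vW We] := vfield_extend dM (fr p) tu.
  have [Y vY Ye] := vfield_extend dM (fr p) tv.
  have [V vV Ve] := vfield_extend dM (fr p) tw.
  pose X q := comb 1 (Y q) (W q).
  have vX : vfield X by exact: (vfield_addf dM vW (smoothC 1 dM) vY).
  have k1 := key W Y Z V W f vW vY vZ vV vW sf f0.
  rewrite !(form3_altl fh (t W vW p)) in k1; try exact: t.
  have vA := vfield_addf dM vY sf vW.
  have := key X Y Z V W f vX vY vZ vV vW sf f0.
  have E1 T : vfield T -> (fun q => h q (X q) (addf Y f W q) (T q)) =
      (fun q => (1 - f q) * h q (W q) (addf Y f W q) (T q)).
    move=> vT; apply: funext => q.
    have -> : X q = comb (1 - f q) (W q) (addf Y f W q).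
      by apply: funext => g; rewrite /X /addf /comb; ring.
    by rewrite (form3_lin fh) ?(form3_altl fh) ?addr0 //; exact: t.
  have E2 T : vfield T -> (fun q => h q (X q) (Y q) (T q)) = (fun q => h q (W q) (Y q) (T q)).
    move=> vT; apply: funext => q; rewrite /X (form3_lin fh); try exact: t.
    by rewrite (form3_altl fh) ?mulr0 ?add0r //; exact: t.
  have tZ := t Z vZ p; have tV := t V vV p.
  have s1 := form3_smooth fh vW vA vV; have s3 := form3_smooth fh vW vA vZ.
  have s2 : smooth (fun q => 1 - f q) by apply: smoothB => //; exact: smoothC.
  rewrite !E1 // !E2 // (tangent_leibniz tZ) // (tangent_leibniz tV) //.
  rewrite (tangentB dM tZ) ?(tangentC _ dM tZ) //; last exact: smoothC.
  rewrite (tangentB dM tV) ?(tangentC _ dM tV) //; last exact: smoothC.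
  by rewrite f0 Zf addf_at // /X We Ye Ve wf; move: k1; rewrite Zf Ve wf; lra.
move=> u v w tu tv tw.
have [x [E [k [F kp]]]] := fr p.
have span := frame_span F kp.
have conclude f Z : vfield Z -> smooth f -> f p = 0 -> Z p f = 1 -> w f = 0 ->
    h p u v w = - h p v u w.
  move=> vZ sf f0 Zf wf; have tuv := tangent_comb 1 tu tv.
  have e : comb 1 u v = comb 1 v u by apply: funext => g; rewrite /comb; ring.
  have := form3_altl fh tuv tw; rewrite (form3_lin fh _ tu tv tuv tw) mul1r.
  rewrite (absorb v u w f Z) // e (absorb u v w f Z) //; lra.
have tEp i := vfield_tangent (frame_E F i) p.
(* A function annihilated by w and with derivative 1 along some frame field is found below from
   dimension two on. In dimension one any two vectors are proportional, so h(a, b, w) vanishes. *)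
case: n fr x E F span tEp => [|[|n]] fr x E F span tEp.
- have z u' : tangent p u' -> u' = @vec0 R M.
    by move=> /span ->; apply: funext => g; rewrite big_ord0.
  by rewrite (z u tu) (z v tv) (form3_altl fh (tangent_vec0 p) tw) oppr0.
- have z a b : tangent p a -> tangent p b -> h p a b w = 0.
    move=> ta tb; have [b0|b0] := eqVneq (b (x 0)) 0.
      rewrite (_ : b = @vec0 R M); first exact: form3_zero2.
      by rewrite (span b tb); apply: funext => g; rewrite big_ord1 b0 mul0r.
    have -> : a = comb (a (x 0) / b (x 0)) b (@vec0 R M).
      apply: funext => g; rewrite /comb /vec0 addr0 {1}(span a ta) {2}(span b tb).
      by rewrite !big_ord1 mulrA divfK.
    rewrite (form3_lin fh) //; last exact: tangent_vec0.
    rewrite (form3_altl fh) // mulr0 add0r.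
    exact: (covector0 (form3_cov1 fh tb tw)).
  by rewrite !z // oppr0.
have sx i := frame_x F i.
pose y i q := x i q - x i p.
have sy i : smooth (y i) by apply: smoothB => //; exact: smoothC.
have yE a i : tangent p a -> a (y i) = a (x i).
  by move=> ta; rewrite (tangentB dM ta) // ?(tangentC _ dM ta) ?subr0 //; exact: smoothC.
have [/forallP w0|/forallPn [i wi]] := boolP [forall i, w (x i) == 0].
  apply: (conclude (y 0) (E 0)) => //; first exact: (frame_E F).
  - by rewrite /y subrr.
  - by rewrite yE // (frame_delta F kp) eqxx.
  - by rewrite yE //; exact/eqP.
have [j ji] : exists j : 'I_n.+2, j != i.
  have [->|i0] := eqVneq i 0; first by exists 1.
  by exists 0; rewrite eq_sym.
(* Subtracting this multiple of [y i] makes w annihilate the function, and its derivative along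
   [E j] at p is still 1 because [E j] annihilates [y i] there. *)
apply: (conclude (fun q => y j q - w (x j) / w (x i) * y i q) (E j)) => //.
- exact: (frame_E F).
- by apply: smoothB => //; apply: smoothM => //; exact: smoothC.
- by rewrite /y !subrr mulr0 subrr.
- rewrite (tangentB dM (tEp j)) //; last by apply: smoothM => //; exact: smoothC.
  rewrite (tangentZ _ dM (tEp j)) // !yE // !(frame_delta F kp) eqxx (negbTE ji).
  by rewrite mulr0 subr0.
- rewrite (tangentB dM tw) //; last by apply: smoothM => //; exact: smoothC.
  by rewrite (tangentZ _ dM tw) // !yE // divfK ?subrr.
Qed.

(** The first transposition makes h linear in the second slot as well; the perturbation argument,
    now in the third slot, then gives the other transposition. *)
Lemma closed_form3_alt3 n M (h : M -> vec M -> vec M -> vec M -> R) : dspace M ->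
  (forall p : M, has_frame n p) -> closed_form3 h -> alt3 h.
Proof.
move=> dM fr ch; have a12 := closed_form3_alt12 dM fr ch; have [fh dh] := ch.
move=> p u v w tu tv tw; split; first exact: a12.
case: (deriv_witness dM (fr p)) => [z0|[f [V [sf vV f0 Vf]]]].
  by rewrite (z0 v tv) (z0 w tw) (form3_altr fh tu (tangent_vec0 p)) oppr0.
have t (V : M -> vec M) : vfield V -> forall q, tangent q (V q) := fun vV q => vfield_tangent vV q.
have lin2 q c a b d e : tangent q a -> tangent q b -> tangent q d -> tangent q e ->
    h q a (comb c b d) e = c * h q a b e + h q a d e.
  move=> ta tb td te; have tbd := tangent_comb c tb td.
  rewrite a12 // (form3_lin fh) // (a12 _ b a) // (a12 _ d a) //; ring.
have key X Y Z W : vfield X -> vfield Y -> vfield Z -> vfield W ->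
  V p (fun q => h q (X q) (Y q) (addf Z f W q)) - V p (fun q => h q (X q) (Y q) (Z q)) =
  h p (W p) (X p) (Y p).
  move=> vX vY vZ vW.
  have vA := vfield_addf dM vZ sf vW.
  have e1 := dh X Y _ V vX vY vA vV p; have e2 := dh X Y Z V vX vY vZ vV p.
  have := etrans e1 (esym e2); rewrite /d3 !lie_addfr // lie_addfl // addf_at //.
  have vl := fun V V' => @vfield_lie R M V V' dM.
  rewrite !(form3_lin fh); try exact: t; try by apply: t; exact: vl.
  have E T : vfield T -> (fun q => h q (T q) (addf Z f W q) (V q)) =
            (fun q => f q * h q (T q) (W q) (V q) + h q (T q) (Z q) (V q)).
    by move=> vT; apply: funext => q; rewrite lin2 //; exact: t.
  have tX := t X vX p; have tY := t Y vY p.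
  have s1 := form3_smooth fh vY vW vV; have s2 := form3_smooth fh vY vZ vV.
  have s3 := form3_smooth fh vX vW vV; have s4 := form3_smooth fh vX vZ vV.
  rewrite !E // (tangentD tX) //; last exact: smoothM.
  rewrite (tangentD tY) //; last exact: smoothM.
  rewrite (tangent_leibniz tX) // (tangent_leibniz tY) // f0 Vf.
  rewrite (a12 p (Y p) (W p)) ?(a12 p (X p) (W p)); try exact: t.
  by lra.
have [W vW We] := vfield_extend dM (fr p) tu.
have [Z vZ Ze] := vfield_extend dM (fr p) tw.
have [Y vY Ye] := vfield_extend dM (fr p) tv.
pose X q := comb 1 (Z q) (W q).
have vX : vfield X by exact: (vfield_addf dM vW (smoothC 1 dM) vZ).
have vA := vfield_addf dM vZ sf vW.
have := key W Y Z W vW vY vZ vW; rewrite (form3_altl fh) //; try exact: t.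
move=> k1; have := key X Y Z W vX vY vZ vW.
have aba q a b : tangent q a -> tangent q b -> h q a b a = 0.
  by move=> ta tb; rewrite a12 // (form3_altr fh) ?oppr0.
have -> : (fun q => h q (X q) (Y q) (addf Z f W q)) =
    (fun q => (1 - f q) * h q (W q) (Y q) (addf Z f W q)).
  apply: funext => q.
  have -> : X q = comb (1 - f q) (W q) (addf Z f W q).
    by apply: funext => g; rewrite /X /addf /comb; ring.
  by rewrite (form3_lin fh) ?aba ?addr0 //; exact: t.
have -> : (fun q => h q (X q) (Y q) (Z q)) = (fun q => h q (W q) (Y q) (Z q)).
  apply: funext => q; rewrite /X (form3_lin fh); try exact: t.
  by rewrite aba ?mulr0 ?add0r //; exact: t.
have tV := t V vV p.
have s1 := form3_smooth fh vW vY vA.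
have s2 : smooth (fun q => 1 - f q) by apply: smoothB => //; exact: smoothC.
rewrite (tangent_leibniz tV) // (tangentB dM tV) ?(tangentC _ dM tV) //; last exact: smoothC.
rewrite f0 Vf addf_at // We Ye Ze /X We Ze.
have tuw := tangent_comb 1 tw tu.
have -> : h p u (comb 1 w u) v = h p u w v.
  by rewrite lin2 // (form3_altl fh) // addr0 mul1r.
by move: k1; lra.
Qed.

End ThreeForms.

(** * Local expressions of forms and naturality of d *)

Section Pullback.
Variable R : realType.
Local Notation space := (space R).
Implicit Types M N P : space.

(** The expression of s as a sum of a_ij dx_i dx_j on {g <> 0}. Unlike a frame it makes sense for
    functions x_i that are not coordinates, and so it pulls back along any smooth map. *)
Record rep2 n M (x : 'I_n -> M -> R) (a : 'I_n -> 'I_n -> M -> R) (g : M -> R)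
    (s : M -> vec M -> vec M -> R) : Prop := Rep2 {
  rep2_x : forall i, smooth (x i);
  rep2_a : forall i j, smooth (a i j);
  rep2_g : smooth g;
  rep2_anti : forall q i j, a i j q = - a j i q;
  rep2_eq : forall q, g q <> 0 -> forall u v, tangent q u -> tangent q v ->
    s q u v = bil (fun i j => a i j q) (fun i => u (x i)) (fun i => v (x i)) }.

Record rep3 n M (x : 'I_n -> M -> R) (a : 'I_n -> 'I_n -> 'I_n -> M -> R) (g : M -> R)
    (h : M -> vec M -> vec M -> vec M -> R) : Prop := Rep3 {
  rep3_x : forall i, smooth (x i);
  rep3_a : forall i j k, smooth (a i j k);
  rep3_g : smooth g;
  rep3_anti12 : forall q i j k, a i j k q = - a j i k q;
  rep3_anti23 : forall q i j k, a i j k q = - a i k j q;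
  rep3_eq : forall q, g q <> 0 -> forall u v w, tangent q u -> tangent q v -> tangent q w ->
    h q u v w = tri (fun i j k => a i j k q) (fun i => u (x i)) (fun i => v (x i))
                    (fun i => w (x i)) }.

Lemma form2_rep n M x E g s : @frame R n M x E g -> form2 s -> alt2 s ->
  rep2 x (fun i j q => s q (E i q) (E j q)) g s.
Proof.
move=> F fs as_.
have tE i q : tangent q (E i q) := vfield_tangent (frame_E F i) q.
split.
- exact: (frame_x F).
- by move=> i j; exact: (form2_smooth fs (frame_E F i) (frame_E F j)).
- exact: (frame_h F).
- by move=> q i j; exact: as_.
- move=> q gq u v tu tv.
  have eu : u = lincomb (fun i => u (x i)) (E ^~ q) := frame_span F gq tu.
  have ev : v = lincomb (fun i => v (x i)) (E ^~ q) := frame_span F gq tv.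
  rewrite {1}eu (covector_lincomb _ (form2_covl fs tv)) // /bil; apply: eq_bigr => i _.
  rewrite {1}ev (covector_lincomb _ (form2_covr fs as_ _)) // mulr_sumr.
  by apply: eq_bigr => j _; ring.
Qed.

Lemma form3_rep n M x E g h : @frame R n M x E g -> form3 h -> alt3 h ->
  rep3 x (fun i j k q => h q (E i q) (E j q) (E k q)) g h.
Proof.
move=> F fh ah.
have tE i q : tangent q (E i q) := vfield_tangent (frame_E F i) q.
have c1 q v w : tangent q v -> tangent q w -> covector q (fun u => h q u v w).
  by move=> tv tw; exact: form3_cov1.
have c2 q u w : tangent q u -> tangent q w -> covector q (fun v => h q u v w).
  move=> tu tw c v v' tv tv'; have tvv := tangent_comb c tv tv'.
  rewrite (ah _ _ _ _ tu tvv tw).1 (c1 q u w tu tw) //.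
  by rewrite (ah _ _ _ _ tu tv tw).1 (ah _ _ _ _ tu tv' tw).1; ring.
have c3 q u v : tangent q u -> tangent q v -> covector q (h q u v).
  move=> tu tv c w w' tw tw'; have tww := tangent_comb c tw tw'.
  rewrite (ah _ _ _ _ tu tv tww).2 (c2 q u v tu tv) //.
  by rewrite (ah _ _ _ _ tu tv tw).2 (ah _ _ _ _ tu tv tw').2; ring.
split.
- exact: (frame_x F).
- by move=> i j k; exact: (form3_smooth fh (frame_E F i) (frame_E F j) (frame_E F k)).
- exact: (frame_h F).
- by move=> q i j k; exact: (ah _ _ _ _ _ _ _).1.
- by move=> q i j k; exact: (ah _ _ _ _ _ _ _).2.
- move=> q gq u v w tu tv tw.
  have eu : u = lincomb (fun i => u (x i)) (E ^~ q) := frame_span F gq tu.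
  have ev : v = lincomb (fun i => v (x i)) (E ^~ q) := frame_span F gq tv.
  have ew : w = lincomb (fun i => w (x i)) (E ^~ q) := frame_span F gq tw.
  rewrite {1}eu (covector_lincomb _ (c1 q v w tv tw)) // /tri; apply: eq_bigr => i _.
  rewrite {1}ev (covector_lincomb _ (c2 q _ w (tE i q) tw)) // mulr_sumr.
  apply: eq_bigr => j _.
  rewrite {1}ew (covector_lincomb _ (c3 q _ _ (tE i q) (tE j q))) // !mulr_sumr.
  by apply: eq_bigr => k _; ring.
Qed.

Lemma rep2_pull n M N (f : M -> N) x a g s : dspace N -> smooth_map f ->
  @rep2 n N x a g s ->
  rep2 (fun i q => x i (f q)) (fun i j q => a i j (f q)) (fun q => g (f q)) (pull2 f s).
Proof.
move=> dN sf r; split.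
- by move=> i; exact: sf (rep2_x r i).
- by move=> i j; exact: sf (rep2_a r i j).
- exact: sf (rep2_g r).
- by move=> q i j; exact: (rep2_anti r).
- move=> q gq u v tu tv.
  rewrite /pull2 (rep2_eq r gq (push_tangent dN sf tu) (push_tangent dN sf tv)).
  by congr bil; apply: funext => i; rewrite push_smooth //; exact: (rep2_x r i).
Qed.

Lemma rep3_pull n M N (f : M -> N) x a g h : dspace N -> smooth_map f ->
  @rep3 n N x a g h ->
  rep3 (fun i q => x i (f q)) (fun i j k q => a i j k (f q)) (fun q => g (f q)) (pull3 f h).
Proof.
move=> dN sf r; split.
- by move=> i; exact: sf (rep3_x r i).
- by move=> i j k; exact: sf (rep3_a r i j k).
- exact: sf (rep3_g r).
- by move=> q i j k; exact: (rep3_anti12 r).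
- by move=> q i j k; exact: (rep3_anti23 r).
- move=> q gq u v w tu tv tw.
  rewrite /pull3 (rep3_eq r gq (push_tangent dN sf tu) (push_tangent dN sf tv)
    (push_tangent dN sf tw)).
  by congr tri; apply: funext => i; rewrite push_smooth //; exact: (rep3_x r i).
Qed.

(** The terms in which some x_i is differentiated twice cancel against those of the brackets. What
    remains involves only the values of X, Y, Z at p, which is why d can be compared across a
    map. *)
Lemma rep2_d2 n M (x : 'I_n -> M -> R) a g s X Y Z p : dspace M -> rep2 x a g s -> g p <> 0 ->
  vfield X -> vfield Y -> vfield Z ->
  (forall V W, vfield V -> vfield W -> smooth (fun q => s q (V q) (W q))) ->
  d2 s X Y Z p =
    bil (fun i j => X p (a i j)) (fun i => Y p (x i)) (fun i => Z p (x i))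
  - bil (fun i j => Y p (a i j)) (fun i => X p (x i)) (fun i => Z p (x i))
  + bil (fun i j => Z p (a i j)) (fun i => X p (x i)) (fun i => Y p (x i)).
Proof.
move=> dM r gp vX vY vZ ss.
have t (V : M -> vec M) : vfield V -> forall q, tangent q (V q) := fun vV q => vfield_tangent vV q.
have sx i := rep2_x r i; have sa i j := rep2_a r i j.
have sV V : vfield V -> forall i, smooth (fun q => V q (x i)) :=
  fun vV i => vfield_smooth vV (sx i).
have D U V W : vfield U -> vfield V -> vfield W -> U p (fun q => s q (V q) (W q)) =
    bil (fun i j => U p (a i j)) (fun i => V p (x i)) (fun i => W p (x i)) +
    bil (fun i j => a i j p) (fun i => U p (fun q => V q (x i))) (fun i => W p (x i)) +
    bil (fun i j => a i j p) (fun i => V p (x i)) (fun i => U p (fun q => W q (x i))).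
  move=> vU vV vW; have tU := t U vU p.
  rewrite -(tangent_bil dM tU sa (sV V vV) (sV W vW)).
  apply: (tangent_loc tU (h := g)) => //; first exact: ss.
  - by apply: smooth_bil => //; exact: sV.
  - exact: (rep2_g r).
  - by move=> q gq; exact: (rep2_eq r gq (t _ vV q) (t _ vW q)).
have L U V W : vfield U -> vfield V -> vfield W -> s p (lie U V p) (W p) =
    bil (fun i j => a i j p) (fun i => U p (fun q => V q (x i))) (fun i => W p (x i)) -
    bil (fun i j => a i j p) (fun i => V p (fun q => U q (x i))) (fun i => W p (x i)).
  move=> vU vV vW; rewrite (rep2_eq r gp); [|exact: t _ (vfield_lie dM vU vV) _|exact: t].
  exact: bilB.
rewrite /d2 !D // !L //.
have anti := rep2_anti r p.
have sw u v := bil_swap (a := fun i j => a i j p) u v anti.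
rewrite (sw (fun i => Y p (x i)) (fun i => X p (fun q => Z q (x i)))).
rewrite (sw (fun i => X p (x i)) (fun i => Y p (fun q => Z q (x i)))).
rewrite (sw (fun i => X p (x i)) (fun i => Z p (fun q => Y q (x i)))).
ring.
Qed.

Lemma rep3_d3 n M (x : 'I_n -> M -> R) a g h X Y Z W p : dspace M -> rep3 x a g h ->
  g p <> 0 -> vfield X -> vfield Y -> vfield Z -> vfield W ->
  (forall T U V, vfield T -> vfield U -> vfield V -> smooth (fun q => h q (T q) (U q) (V q))) ->
  d3 h X Y Z W p =
    tri (fun i j k => X p (a i j k)) (fun i => Y p (x i)) (fun i => Z p (x i)) (fun i => W p (x i))
  - tri (fun i j k => Y p (a i j k)) (fun i => X p (x i)) (fun i => Z p (x i)) (fun i => W p (x i))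
  + tri (fun i j k => Z p (a i j k)) (fun i => X p (x i)) (fun i => Y p (x i)) (fun i => W p (x i))
  - tri (fun i j k => W p (a i j k)) (fun i => X p (x i)) (fun i => Y p (x i)) (fun i => Z p (x i)).
Proof.
move=> dM r gp vX vY vZ vW ss.
have t (V : M -> vec M) : vfield V -> forall q, tangent q (V q) := fun vV q => vfield_tangent vV q.
have sx i := rep3_x r i; have sa i j k := rep3_a r i j k.
have sV V : vfield V -> forall i, smooth (fun q => V q (x i)) :=
  fun vV i => vfield_smooth vV (sx i).
pose b := fun i j k => a i j k p.
pose v1 V := fun i => (V : M -> vec M) p (x i).
pose v2 U V := fun i => (U : M -> vec M) p (fun q => (V : M -> vec M) q (x i)).
have D T U V W' : vfield T -> vfield U -> vfield V -> vfield W' ->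
    T p (fun q => h q (U q) (V q) (W' q)) =
    tri (fun i j k => T p (a i j k)) (v1 U) (v1 V) (v1 W') +
    tri b (v2 T U) (v1 V) (v1 W') + tri b (v1 U) (v2 T V) (v1 W') +
    tri b (v1 U) (v1 V) (v2 T W').
  move=> vT vU vV vW'; have tT := t T vT p.
  rewrite /v1 /v2 /b -(tangent_tri dM tT sa (sV U vU) (sV V vV) (sV W' vW')).
  apply: (tangent_loc tT (h := g)) => //; first exact: ss.
  - by apply: smooth_tri => //; exact: sV.
  - exact: (rep3_g r).
  - by move=> q gq; exact: (rep3_eq r gq (t _ vU q) (t _ vV q) (t _ vW' q)).
have L T U V W' : vfield T -> vfield U -> vfield V -> vfield W' ->
    h p (lie T U p) (V p) (W' p) =
    tri b (v2 T U) (v1 V) (v1 W') - tri b (v2 U T) (v1 V) (v1 W').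
  move=> vT vU vV vW'; rewrite (rep3_eq r gp); [|exact: t _ (vfield_lie dM vT vU) _|exact: t..].
  exact: triB.
rewrite /d3 !D // !L //.
have s12 u v w := tri_swap12 (a := b) u v w (rep3_anti12 r p).
have s23 u v w := tri_swap23 (a := b) u v w (rep3_anti23 r p).
rewrite (s12 (v1 Y) (v2 X Z)) (s23 (v1 Y) (v1 Z) (v2 X W)) (s12 (v1 Y) (v2 X W)).
rewrite (s12 (v1 X) (v2 Y Z)) (s23 (v1 X) (v1 Z) (v2 Y W)) (s12 (v1 X) (v2 Y W)).
rewrite (s12 (v1 X) (v2 Z Y)) (s23 (v1 X) (v1 Y) (v2 Z W)) (s12 (v1 X) (v2 Z W)).
rewrite (s12 (v1 X) (v2 W Y)) (s23 (v1 X) (v1 Y) (v2 W Z)) (s12 (v1 X) (v2 W Z)).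
rewrite /v1; ring.
Qed.

Section Map.
Variables (n : nat) (M N : space) (f : M -> N).
Hypotheses (dM : dspace M) (dN : dspace N) (frN : forall p : N, has_frame n p)
  (sf : smooth_map f).

Lemma form2_pull s : form2 s -> alt2 s -> form2 (pull2 f s) /\ alt2 (pull2 f s).
Proof.
move=> fs as_; have tp u q : tangent q u -> tangent (f q) (push f u) := push_tangent dN sf.
split; last by move=> p u v tu tv; apply: as_; exact: tp.
split.
- by move=> p c u v w tu tv tw; rewrite /pull2 push_comb (form2_lin fs) //; exact: tp.
- by move=> p u tu; rewrite /pull2 (form2_alt fs) //; exact: tp.
- move=> X Y vX vY; apply: smooth_loc => // p.
  have [x [E [g [F gp]]]] := frN (f p).
  have r := rep2_pull dN sf (form2_rep F fs as_).
  exists (fun q => g (f q)), (fun q => bil (fun i j => s (f q) (E i (f q)) (E j (f q)))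
     (fun i => X q (fun z => x i (f z))) (fun i => Y q (fun z => x i (f z)))); split=> //.
  + exact: sf (frame_h F).
  + apply: (smooth_bil (a := fun i j q => s (f q) (E i (f q)) (E j (f q)))) => //.
    * exact: (rep2_a r).
    * by move=> i; exact: (vfield_smooth vX (rep2_x r i)).
    * by move=> i; exact: (vfield_smooth vY (rep2_x r i)).
  + by move=> q gq; exact: (rep2_eq r gq (vfield_tangent vX q) (vfield_tangent vY q)).
Qed.

Lemma form3_pull h : form3 h -> alt3 h -> form3 (pull3 f h) /\ alt3 (pull3 f h).
Proof.
move=> fh ah; have tp u q : tangent q u -> tangent (f q) (push f u) := push_tangent dN sf.
split; last by move=> p u v w tu tv tw; apply: ah; exact: tp.
split.
- by move=> p c u v w z tu tv tw tz; rewrite /pull3 push_comb (form3_lin fh) //; exact: tp.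
- by move=> p u v tu tv; rewrite /pull3 (form3_altl fh) //; exact: tp.
- by move=> p u v tu tv; rewrite /pull3 (form3_altr fh) //; exact: tp.
- move=> X Y Z vX vY vZ; apply: smooth_loc => // p.
  have [x [E [g [F gp]]]] := frN (f p).
  have r := rep3_pull dN sf (form3_rep F fh ah).
  exists (fun q => g (f q)), (fun q => tri (fun i j k => h (f q) (E i (f q)) (E j (f q)) (E k (f q)))
     (fun i => X q (fun z => x i (f z))) (fun i => Y q (fun z => x i (f z)))
     (fun i => Z q (fun z => x i (f z)))); split=> //.
  + exact: sf (frame_h F).
  + apply: (smooth_tri (a := fun i j k q => h (f q) (E i (f q)) (E j (f q)) (E k (f q)))) => //.
    * exact: (rep3_a r).
    * by move=> i; exact: (vfield_smooth vX (rep3_x r i)).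
    * by move=> i; exact: (vfield_smooth vY (rep3_x r i)).
    * by move=> i; exact: (vfield_smooth vZ (rep3_x r i)).
  + move=> q gq.
    exact: (rep3_eq r gq (vfield_tangent vX q) (vfield_tangent vY q) (vfield_tangent vZ q)).
Qed.

(** Matching the fields at the single point f(p) suffices, because the local formula [rep2_d2]
    involves values only; for a general map f a field on M has no projection to N. *)
Lemma d2_pull s X Y Z X' Y' Z' p : form2 s -> alt2 s ->
  vfield X -> vfield Y -> vfield Z -> vfield X' -> vfield Y' -> vfield Z' ->
  X' (f p) = push f (X p) -> Y' (f p) = push f (Y p) -> Z' (f p) = push f (Z p) ->
  d2 (pull2 f s) X Y Z p = d2 s X' Y' Z' (f p).
Proof.
move=> fs as_ vX vY vZ vX' vY' vZ' eX eY eZ.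
have [fp ap] := form2_pull fs as_.
have [x [E [g [F gp]]]] := frN (f p).
have r := form2_rep F fs as_; have r' := rep2_pull dN sf r.
rewrite (rep2_d2 dM r' gp vX vY vZ (@form2_smooth _ _ _ fp)).
rewrite (rep2_d2 dN r gp vX' vY' vZ' (@form2_smooth _ _ _ fs)).
have e V i : push f V (x i) = V (fun q => x i (f q)) by rewrite push_smooth //; exact: (rep2_x r).
have e2 V i j : push f V (fun q => s q (E i q) (E j q)) =
    V (fun q => s (f q) (E i (f q)) (E j (f q))).
  by rewrite push_smooth //; exact: (rep2_a r).
rewrite eX eY eZ; congr (_ - _ + _); congr bil; apply: funext => i; rewrite ?e //;
  apply: funext => j; by rewrite e2.
Qed.

Lemma d3_pull h X Y Z W X' Y' Z' W' p : form3 h -> alt3 h ->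
  vfield X -> vfield Y -> vfield Z -> vfield W ->
  vfield X' -> vfield Y' -> vfield Z' -> vfield W' ->
  X' (f p) = push f (X p) -> Y' (f p) = push f (Y p) -> Z' (f p) = push f (Z p) ->
  W' (f p) = push f (W p) ->
  d3 (pull3 f h) X Y Z W p = d3 h X' Y' Z' W' (f p).
Proof.
move=> fh ah vX vY vZ vW vX' vY' vZ' vW' eX eY eZ eW.
have [fp ap] := form3_pull fh ah.
have [x [E [g [F gp]]]] := frN (f p).
have r := form3_rep F fh ah; have r' := rep3_pull dN sf r.
rewrite (rep3_d3 dM r' gp vX vY vZ vW (@form3_smooth _ _ _ fp)).
rewrite (rep3_d3 dN r gp vX' vY' vZ' vW' (@form3_smooth _ _ _ fh)).
have e V i : push f V (x i) = V (fun q => x i (f q)) by rewrite push_smooth //; exact: (rep3_x r).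
have e2 V i j k : push f V (fun q => h q (E i q) (E j q) (E k q)) =
    V (fun q => h (f q) (E i (f q)) (E j (f q)) (E k (f q))).
  by rewrite push_smooth //; exact: (rep3_a r).
rewrite eX eY eZ eW; congr (_ - _ + _ - _); congr tri; apply: funext => i; rewrite ?e //;
  apply: funext => j; apply: funext => k; by rewrite e2.
Qed.

Lemma closed_form3_pull h : closed_form3 h -> closed_form3 (pull3 f h).
Proof.
move=> ch; have ah := closed_form3_alt3 dN frN ch; have [fh dh] := ch.
have [fp ap] := form3_pull fh ah.
split=> // X Y Z W vX vY vZ vW p.
have ex V : vfield V -> exists2 V', vfield V' & V' (f p) = push f (V p).
  move=> vV; apply: (vfield_extend dN (frN (f p))).
  by apply: push_tangent => //; exact: (vfield_tangent vV).
have [X' vX' eX] := ex X vX; have [Y' vY' eY] := ex Y vY.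
have [Z' vZ' eZ] := ex Z vZ; have [W' vW' eW] := ex W vW.
by rewrite (d3_pull fh ah vX vY vZ vW vX' vY' vZ' vW' eX eY eZ eW) dh.
Qed.

End Map.

Lemma form2B M s s' : dspace M -> @form2 R M s -> form2 s' ->
  form2 (fun p u v => s p u v - s' p u v).
Proof.
move=> dM fs fs'; split.
- by move=> p c u v w tu tv tw; rewrite (form2_lin fs) // (form2_lin fs') //; ring.
- by move=> p u tu; rewrite (form2_alt fs) // (form2_alt fs') // subrr.
- by move=> X Y vX vY; apply: smoothB => //; [exact: (form2_smooth fs)|exact: (form2_smooth fs')].
Qed.

Lemma d2B M s s' X Y Z p : dspace M -> @form2 R M s -> form2 s' ->
  vfield X -> vfield Y -> vfield Z ->
  d2 (fun p u v => s p u v - s' p u v) X Y Z p = d2 s X Y Z p - d2 s' X Y Z p.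
Proof.
move=> dM fs fs' vX vY vZ; rewrite /d2.
rewrite !(tangentB dM (vfield_tangent _ p)) //;
  try exact: (form2_smooth fs); try exact: (form2_smooth fs'); ring.
Qed.

Lemma closed_form3B M h h' : dspace M -> @closed_form3 R M h -> closed_form3 h' ->
  closed_form3 (fun p u v w => h p u v w - h' p u v w).
Proof.
move=> dM [fh dh] [fh' dh']; split; first split.
- by move=> p c u v w z tu tv tw tz; rewrite (form3_lin fh) // (form3_lin fh') //; ring.
- by move=> p u v tu tv; rewrite (form3_altl fh) // (form3_altl fh') // subrr.
- by move=> p u v tu tv; rewrite (form3_altr fh) // (form3_altr fh') // subrr.
- by move=> X Y Z vX vY vZ; apply: smoothB => //; [exact: (form3_smooth fh)|exact: (form3_smooth fh')].
move=> X Y Z W vX vY vZ vW p.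
have := congr2 (fun a b => a - b) (dh X Y Z W vX vY vZ vW p) (dh' X Y Z W vX vY vZ vW p).
rewrite subrr => <-; rewrite /d3.
rewrite !(tangentB dM (vfield_tangent _ p)) //;
  try exact: (form3_smooth fh); try exact: (form3_smooth fh'); ring.
Qed.

End Pullback.

(** * Vector fields along maps and submersions *)

Section FieldsAlongMaps.
Variable R : realType.
Local Notation space := (space R).

Lemma smooth_inv_germ (M : space) (f : M -> R) p : dspace M -> smooth f -> f p <> 0 ->
  exists r b : M -> R, [/\ smooth r, smooth b, b p <> 0 &
    forall q, b q <> 0 -> r q * f q = 1].
Proof.
move=> dM sf fp.
have oV : open [set y : 'rV[R]_1 | setT y /\ y 0 0 <> 0].
  by apply: open_neq0; [exact: openT | apply: Ck_coord; exact: openT].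
have Vp : [set y : 'rV[R]_1 | setT y /\ y 0 0 <> 0] (\row_(i < 1) f p).
  by split=> //=; rewrite mxE.
have [chi [b [r [[sc sb] [bp r0] rV [cr c1] ex]]]] := rV_bump oV Vp.
have sV : smooth_on [set y : 'rV[R]_1 | setT y /\ y 0 0 <> 0] (fun y => (y 0 0)^-1).
  move=> k; apply: (CkV oV); first by move=> y [_ /eqP].
  exact: Ck_coord.
exists (fun q => chi (\row_(i < 1) f q) * ((\row_(i < 1) f q : 'rV[R]_1) 0 0)^-1),
  (fun q => b (\row_(i < 1) f q)); split => //.
- exact: (smooth_compT (f := fun=> f) dM (fun=> sf) (ex _ sV)).
- exact: (smooth_compT (f := fun=> f) dM (fun=> sf) sb).
- move=> q bq; rewrite c1 // mul1r mxE mulVf //; apply/eqP => f0.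
  have Vq : [set y : 'rV[R]_1 | setT y /\ y 0 0 <> 0] (\row_(i < 1) f q).
    by apply/rV/ltW/cr; rewrite c1 //; apply/eqP/oner_neq0.
  by case: Vq => _ /=; rewrite mxE f0.
Qed.

Lemma smooth_quot_loc (M : space) (g : M -> R) : dspace M ->
  (forall p, exists (h g' : M -> R), [/\ smooth h, smooth g', h p <> 0 &
     forall q, h q <> 0 -> h q * g q = g' q]) -> smooth g.
Proof.
move=> dM loc; apply: (smooth_loc dM) => p; have [h [g' [sh sg hp E]]] := loc p.
have [r [b [sr sb bp rh]]] := smooth_inv_germ dM sh hp.
exists b, (fun q => r q * g' q); split=> //; first exact: smoothM.
move=> q bq; rewrite -E ?mulrA ?rh ?mul1r // => h0.
by have := rh _ bq; rewrite h0 mulr0 => /eqP; rewrite eq_sym oner_eq0.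
Qed.

(** A smooth section of the pullback of the tangent bundle of N by f. *)
Record along (M N : space) (f : M -> N) (X : M -> vec N) : Prop := Along {
  along_tangent : forall p, tangent (f p) (X p);
  along_smooth : forall g, smooth g -> smooth (fun p => X p g) }.

Lemma along_vfield (M : space) (X : M -> vec M) : vfield X <-> along (fun x => x) X.
Proof. by split=> -[tX sX]; split. Qed.

Lemma along_push (M N P : space) (f : M -> N) (F : N -> P) X : dspace P -> smooth_map F ->
  along f X -> along (fun p => F (f p)) (fun p => push F (X p)).
Proof.
move=> dP sF [tX sX]; split=> [p|g sg]; first exact: (push_tangent dP sF (tX p)).
rewrite (_ : (fun p => _) = fun p => X p (fun q => g (F q))); first exact/sX/sF.
by apply: funext => p; rewrite push_smooth.
Qed.

Lemma along_comp (M N P : space) (f : M -> N) (F : P -> M) X : smooth_map F ->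
  along f X -> along (fun p => f (F p)) (fun p => X (F p)).
Proof. by move=> sF [tX sX]; split=> [p|g sg]; [exact: tX | exact: (sF _ (sX _ sg))]. Qed.

(** By the chain rule the vectors act on any smooth function through their values on generators,
    with coefficients that are smooth in the point. *)
Lemma along_gen (M : space) X (G : set (X -> R)) (f : M -> X) (V : M -> vec (Space (gen_smooth G))) :
  dspace M -> smooth_map (f : M -> Space (gen_smooth G)) ->
  (forall p, tangent (f p : Space (gen_smooth G)) (V p)) ->
  (forall g, G g -> smooth (fun p => V p g)) ->
  along (f : M -> Space (gen_smooth G)) V.
Proof.
move=> dM sf tV sV; split=> // g sg.
have dG := @dspace_gen R X G.
apply: (smooth_loc dM) => p.
have [k [a [W [F [Ga oW Wp sF gF]]]]] := sg (f p).
have sa i : @smooth R (Space (gen_smooth G)) (a i) by exact: sub_gen_smooth.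
have [chi [b [r [[sc sb] [bp r0] rV [cr c1] ex]]]] := rV_bump oW Wp.
have sD i : smooth_on W (fun y => 'D_(delta_mx 0 i) F y).
  by move=> m; have [_ /(_ i) []] := sF m.+1.
have sr i : smooth (fun q => a i (f q)) by exact: (sf _ (sa i)).
exists (fun q => b (\row_i a i (f q))),
  (fun q => \sum_i chi (\row_i a i (f q)) * 'D_(delta_mx 0 i) F (\row_i a i (f q)) * V q (a i)).
split=> //.
- exact: (smooth_compT dM sr sb).
- apply: (smooth_sum (f := fun i q => chi (\row_i a i (f q)) *
    'D_(delta_mx 0 i) F (\row_i a i (f q)) * V q (a i)) _ dM) => i.
  apply: (smoothM dM); last exact: (sV _ (Ga i)).
  exact: (smooth_compT dM sr (ex _ (sD i))).
- move=> q bq; have Wq : W (\row_i a i (f q)).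
    by apply/rV/ltW/cr; rewrite c1 //; apply/eqP/oner_neq0.
  rewrite (tangent_chain dG (tV q) sa sg oW Wq sF gF).
  by apply: eq_bigr => i _; rewrite c1 // mul1r.
Qed.

Lemma along_sub (M N : space) (Q : N -> Prop) (f : M -> sub_space Q) V : dspace M -> smooth_map f ->
  (forall p, tangent (f p) (V p)) ->
  (forall g, smooth g -> smooth (fun p => pushv Q (V p) g)) -> along f V.
Proof.
move=> dM sf tV sV; apply: along_gen => // g [g' sg' ->].
by move: (sV _ sg'); congr smooth; apply: funext => p; rewrite push_smooth.
Qed.

Lemma along_prod (M N1 N2 : space) (f : M -> prod_space N1 N2) V : dspace M -> smooth_map f ->
  (forall p, tangent (f p) (V p)) ->
  (forall g, smooth g -> smooth (fun p => push1 (V p) g)) ->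
  (forall g, smooth g -> smooth (fun p => push2 (V p) g)) -> along f V.
Proof.
move=> dM sf tV s1 s2; apply: along_gen => // g [] [g' sg' ->].
  by move: (s1 _ sg'); congr smooth; apply: funext => p; rewrite push_smooth.
by move: (s2 _ sg'); congr smooth; apply: funext => p; rewrite push_smooth.
Qed.

Lemma form2_along n (M N : space) (f : M -> N) s U V : dspace M -> (forall p : N, has_frame n p) ->
  form2 s -> alt2 s -> smooth_map f -> along f U -> along f V ->
  smooth (fun p => s (f p) (U p) (V p)).
Proof.
move=> dM fr fs as_ sf [tU sU] [tV sV]; apply: (smooth_loc dM) => p.
have [x [E [g [F gp]]]] := fr (f p).
have rp := form2_rep F fs as_.
exists (fun q => g (f q)), (fun q => bil (fun i j => s (f q) (E i (f q)) (E j (f q)))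
  (fun i => U q (x i)) (fun i => V q (x i))).
split=> //; first exact/sf/(frame_h F).
- apply: (smooth_bil dM (a := fun i j q => s (f q) (E i (f q)) (E j (f q)))) => [i j|i|i].
  + exact: (sf _ (form2_smooth fs (frame_E F i) (frame_E F j))).
  + exact/sU/(frame_x F).
  + exact/sV/(frame_x F).
- by move=> q gq; rewrite (rep2_eq rp gq (tU q) (tV q)).
Qed.

End FieldsAlongMaps.

(** * Frames adapted to a submersion, and smooth linear systems *)

Section SubmersionFrame.
Variable R : realType.
Local Notation space := (space R).

Lemma lincomb_frame n (M : space) x E h (q : M) u : @frame R n M x E h -> h q <> 0 ->
  tangent q u -> u = lincomb (fun i => u (x i)) (E ^~ q).
Proof. by move=> F hq tu; exact: (frame_span F hq tu). Qed.

Lemma frame_eq n (M : space) x E h (q : M) u v : @frame R n M x E h -> h q <> 0 ->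
  tangent q u -> tangent q v -> (forall i, u (x i) = v (x i)) -> u = v.
Proof.
move=> F hq tu tv e; rewrite (lincomb_frame F hq tu) (lincomb_frame F hq tv).
by apply: funext => f; apply: eq_bigr => i _; rewrite e.
Qed.

(** In frames the differential of f is a matrix S of rank n at p. Complete it to T = [S | C]; the
    rows of the adjugate of T define global fields which near p are mapped either to [det T] times a
    frame field of N or to zero. The latter span the kernel, and the former, divided by [det T],
    lift the fields of N. *)
Lemma submersion_frame d n (M N : space) (f : M -> N) (p : M) : dspace M -> dspace N ->
  smooth_map f -> has_frame (n + d) p -> has_frame n (f p) ->
  (forall w, tangent (f p) w -> exists2 u, tangent p u & push f u = w) ->
  exists (U : 'I_d -> M -> vec M) (h : M -> R),
  [/\ smooth h /\ h p <> 0, forall j, vfield (U j), forall j q, push f (U j q) = @vec0 R N,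
    forall q, h q <> 0 ->
      (forall c, lincomb c (U ^~ q) = @vec0 R M -> forall j, c j = 0) /\
      (forall v, tangent q v -> push f v = @vec0 R N -> exists c, v = lincomb c (U ^~ q)) &
    forall Z, vfield Z -> exists2 W, vfield W &
      forall q, h q <> 0 -> push f (W q) = Z (f q)].
Proof.
move=> dM dN sf [x [E [h [F hp]]]] [z [D [k [G kp]]]] sub.
have sz l : smooth (fun q => z l (f q)) by exact: (sf _ (frame_x G l)).
have tE i q : tangent q (E i q) := vfield_tangent (frame_E F i) q.
pose S q : 'M[R]_(n + d, n) := \matrix_(i, l) E i q (fun q => z l (f q)).
have mulS q v : h q <> 0 -> tangent q v ->
    (\row_i v (x i)) *m S q = \row_l v (fun q => z l (f q)).
  move=> hq tv; apply/rowP => l; rewrite !mxE {2}(lincomb_frame F hq tv).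
  by apply: eq_bigr => i _; rewrite !mxE.
have rS : \rank (S p) = n.
  apply/eqP; rewrite -[_ == _]/(row_full _) -sub1mx; apply/row_subP => l.
  have tD i : tangent (f p) (D i (f p)) := vfield_tangent (frame_E G i) (f p).
  have [u tu eu] := sub _ (tD l).
  apply/submxP; exists (\row_i u (x i)); rewrite mulS //; apply/rowP => j; rewrite !mxE.
  by rewrite -(frame_delta G kp) -eu push_smooth //; exact: (frame_x G).
have [C uC] := complete_unitmx rS.
pose T q := row_mx (S q) C.
have sS i l : smooth (fun q => S q i l).
  rewrite (_ : (fun q => _) = fun q => E i q (fun q => z l (f q))).
    exact: (vfield_smooth (frame_E F i) (sz l)).
  by apply: funext => q; rewrite mxE.
have sT i j : smooth (fun q => T q i j).
  case: (split_ordP j) => l ->.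
    by move: (sS i l); congr smooth; apply: funext => q; rewrite row_mxEl.
  move: (smoothC (C i l) dM); congr smooth; apply: funext => q.
  by rewrite row_mxEr.
have detp : \det (T p) <> 0 by apply/eqP; rewrite -unitfE -unitmxE.
have [r [b [sr sb bp rT]]] := smooth_inv_germ dM (smooth_det dM sT) detp.
pose V i' q := lincomb (fun i => (\adj (T q)) i' i) (E ^~ q).
have vV i' : vfield (V i').
  apply: (vfield_lincomb (c := fun i q => (\adj (T q)) i' i) dM) => i; last exact: frame_E F i.
  exact: smooth_adj.
have Vz i' q l : V i' q (fun q => z l (f q)) = \det (T q) * (i' == lshift d l)%:R.
  have := congr1 (fun A : 'M_(n + d) => A i' (lshift d l)) (mul_adj_mx (T q)).
  rewrite [in X in _ = X -> _]mxE -[X in _ = X -> _]mulr_natr => <-; rewrite mxE; apply: eq_bigr => i _.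
  by congr (_ * _); rewrite /T row_mxEl mxE.
have tV i' q : tangent q (V i' q) by exact: tangent_lincomb.
have t0 q : tangent q (@vec0 R M) := tangent_vec0 q.
have V0 i' : vfield (fun=> @vec0 R M) by split=> // g _; exact: smoothC.
(* The fields V are known to be vertical only where the frame of N is valid; the factor [k (f q)]
   makes U vertical on all of M. *)
pose U j q := comb (k (f q)) (V (rshift n j) q) (@vec0 R M).
have sk : smooth (fun q => k (f q)) := sf _ (frame_h G).
have tU j q : tangent q (U j q) by exact: tangent_comb.
have Ux c q i : lincomb c (U ^~ q) i = (k (f q)) * \sum_j c j * V (rshift n j) q i.
  by rewrite mulr_sumr; apply: eq_bigr => j _; rewrite /U /comb /vec0 addr0; ring.
have Vx i' q i : h q <> 0 -> V i' q (x i) = (\adj (T q)) i' i.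
  move=> hq; rewrite /V /lincomb (bigD1 i) //= (frame_delta F hq) eqxx mulr1 big1 ?addr0 //.
  by move=> l li; rewrite (frame_delta F hq) (negbTE li) mulr0.
have VxE c q : h q <> 0 -> \row_i (\sum_j c j * V (rshift n j) q (x i)) =
    row_mx 0 (\row_j c j) *m \adj (T q).
  move=> hq; apply/rowP => i; rewrite mxE [in RHS]mxE big_split_ord /=.
  rewrite [X in _ = X + _]big1 ?add0r => [|l _]; last by rewrite row_mxEl mxE mul0r.
  by apply: eq_bigr => j _; rewrite row_mxEr mxE Vx.
exists U, (fun q => h q * (k (f q) * b q)).
split.
- split; first by do 2?[apply: (smoothM dM) => //]; exact: (frame_h F).
  by apply/eqP; rewrite !mulf_neq0 //; exact/eqP.
- move=> j; split=> [q|g sg]; first exact: tU.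
  rewrite /U /comb /vec0; apply: (smoothD dM _ (smoothC 0 dM)).
  exact: (smoothM dM sk (vfield_smooth (vV _) sg)).
- move=> j q; have [k0|kq] := pselect (k (f q) = 0).
    by rewrite /U k0 push_comb push_vec0; apply: funext => g; rewrite /comb /vec0 mul0r addr0.
  have tp : tangent (f q) (push f (U j q)) := push_tangent dN sf (tU j q).
  apply: (frame_eq G kq tp (tangent_vec0 _)) => l.
  rewrite push_smooth; last exact: (frame_x G).
  by rewrite /U /comb Vz eq_rlshift mulr0 mulr0 addr0.
- move=> q hh; have hq : h q <> 0 by move=> e; apply: hh; rewrite e mul0r.
  have kq : k (f q) <> 0 by move=> e; apply: hh; rewrite e mul0r mulr0.
  have bq : b q <> 0 by move=> e; apply: hh; rewrite e !mulr0.
  have rq := rT _ bq.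
  split=> [c c0 j|v tv pv].
    have e : row_mx 0 (\row_j c j) *m \adj (T q) = 0.
      rewrite -VxE //; apply/rowP => i; rewrite !mxE.
      have := congr1 (fun u => u (x i)) c0; rewrite /= Ux /vec0 => /eqP.
      by rewrite mulf_eq0 => /orP [/eqP //|/eqP].
    have := congr1 (mulmx^~ (T q)) e; rewrite /= -mulmxA mul_adj_mx mul0mx.
    rewrite mul_mx_scalar => /(congr1 (fun A : 'rV_(n + d) => r q * A 0 (rshift n j))).
    by rewrite [in LHS]mxE mulrA rq mul1r row_mxEr !mxE mulr0.
  pose vr := \row_i v (x i).
  have vS : vr *m S q = 0.
    rewrite mulS //; apply/rowP => l; rewrite !mxE.
    have := congr1 (fun u => u (z l)) pv; rewrite /= push_smooth //; exact: (frame_x G).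
  pose c j := (k (f q))^-1 * (r q * (vr *m C) 0 j).
  exists c; apply: (frame_eq F hq tv); first exact: tangent_lincomb.
  move=> i; rewrite Ux; have -> : v (x i) = (r q *: (vr *m T q *m \adj (T q))) 0 i.
    by rewrite -mulmxA mul_mx_adj mul_mx_scalar scalerA rq scale1r mxE.
  have := congr1 (fun A : 'rV_(n + d) => A 0 i) (VxE c q hq); rewrite mxE => ->.
  have -> : row_mx 0 (\row_j c j) = ((k (f q))^-1 * r q) *: (vr *m T q).
    rewrite mul_mx_row vS scale_row_mx scaler0; congr row_mx.
    by apply/rowP => j; rewrite !mxE /c mxE mulrA.
  by rewrite -!scalemxAl !mxE mulrA mulrA mulfV ?mul1r //; exact/eqP.
- move=> Z vZ; pose a l q := r q * Z (f q) (z l).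
  have sa l : smooth (a l).
    apply: (smoothM dM sr); exact: (sf _ (vfield_smooth vZ (frame_x G l))).
  exists (fun q => lincomb (a ^~ q) (fun l => V (lshift d l) q)).
    by apply: (vfield_lincomb (c := a) dM) => // l; exact: vV.
  move=> q hh; have kq : k (f q) <> 0 by move=> e; apply: hh; rewrite e mul0r mulr0.
  have bq : b q <> 0 by move=> e; apply: hh; rewrite e !mulr0.
  have tW : tangent q (lincomb (a ^~ q) (fun l => V (lshift d l) q)).
    by apply: tangent_lincomb.
  apply: (frame_eq G kq (push_tangent dN sf tW) (vfield_tangent vZ _)) => i.
  rewrite push_smooth; last exact: (frame_x G).
  rewrite /lincomb (bigD1 i) //= Vz eqxx mulr1 big1 ?addr0 => [|l li].
    by rewrite /a mulrAC rT // mul1r.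
  by rewrite Vz (inj_eq (@lshift_inj _ _)) (negbTE li) !mulr0.
Qed.

(** Complete the transpose of B to a square matrix D. The transpose of [c B] is D applied to the
    transpose of c padded by zeros, so the adjugate of D recovers [det D] times c from the smooth
    row [c B]. *)
Lemma smooth_solve r d (M : space) (B : M -> 'M[R]_(r, r + d)) (c : M -> 'rV[R]_r) (p : M) :
  dspace M -> (forall i j, smooth (fun q => B q i j)) ->
  (forall j, smooth (fun q => (c q *m B q) 0 j)) -> \rank (B p) = r ->
  exists k, [/\ smooth k, k p <> 0 & forall j, smooth (fun q => k q * c q 0 j)].
Proof.
move=> dM sB sc rB; have rJ : \rank (B p)^T = r by rewrite mxrank_tr.
have [C uC] := complete_unitmx rJ.
pose D q := row_mx (B q)^T C.
have sD i j : smooth (fun q => D q i j).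
  case: (split_ordP j) => l ->.
    by move: (sB l i); congr smooth; apply: funext => q; rewrite row_mxEl mxE.
  by move: (smoothC (C i l) dM); congr smooth; apply: funext => q; rewrite row_mxEr.
exists (fun q => \det (D q)); split; first exact: smooth_det.
  by apply/eqP; rewrite -unitfE -unitmxE.
move=> j; rewrite (_ : (fun q => _) = fun q => \sum_i (\adj (D q)) (lshift d j) i * (c q *m B q) 0 i).
  apply: (smooth_sum (f := fun i q => (\adj (D q)) (lshift d j) i * (c q *m B q) 0 i) _ dM) => i.
  exact: (smoothM dM (smooth_adj _ _ dM sD) (sc i)).
apply: funext => q.
have e : (c q *m B q)^T = D q *m col_mx (c q)^T 0.
  by rewrite mul_row_col mulmx0 addr0 trmx_mul.
have := congr1 (fun A : 'cV_(r + d) => A (lshift d j) 0) (congr1 (mulmx (\adj (D q))) e).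
rewrite [in X in _ = X -> _]mulmxA mul_adj_mx mul_scalar_mx.
rewrite [in X in _ = X -> _]mxE col_mxEu [in X in _ = X -> _]mxE => <-.
by rewrite [LHS]mxE; apply: eq_bigr => i _; congr (_ * _); rewrite [LHS]mxE.
Qed.

Lemma mul_trmx_entry a b c (A : 'M[R]_(a, c)) (B : 'M[R]_(b, c)) i j :
  (A *m B^T) i j = (row i A *m (row j B)^T) 0 0.
Proof. by rewrite !mxE; apply: eq_bigr => l _; rewrite !mxE. Qed.

(** The row space of B is isotropic for the split form J and has half the total dimension, so it
    equals its own orthogonal space, to which xi belongs. *)
Lemma maximal_isotropic_row n (B : 'M[R]_(n, n + n)) (xi : 'rV[R]_(n + n)) :
  let J : 'M[R]_(n + n) := block_mx 0 1%:M 1%:M 0 in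
  \rank B = n -> B *m J *m B^T = 0 -> xi *m J *m B^T = 0 -> exists c, xi = c *m B.
Proof.
move=> J rB BB xB; apply/submxP.
have JJ : J *m J = 1%:M.
  by rewrite mulmx_block !mulmx0 !mul0mx !mulmx1 !addr0 !add0r -scalar_mx_block.
have uJ : J \in unitmx by case: (mulmx1_unit JJ).
have rk : \rank (kermx (J *m B^T)) = n.
  by rewrite mxrank_ker eqmxMfull ?row_full_unit // mxrank_tr rB addnK.
have BK : (B <= kermx (J *m B^T))%MS by apply/sub_kermxP; rewrite mulmxA.
have : (kermx (J *m B^T) <= B)%MS by rewrite -(mxrank_leqif_sup BK).2 rk rB.
by apply: submx_trans; apply/sub_kermxP; rewrite mulmxA.
Qed.

End SubmersionFrame.

(** * Lie groupoids *)

Section LieGroupoids.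
Variable R : realType.
Local Notation space := (space R).
Variables (m n : nat) (G : groupoid R).
Hypothesis L : lie_groupoid m n G.

Lemma arr_dspace : dspace (arr G). Proof. exact: (manifold_dspace (lie_arr L)). Qed.
Lemma obj_dspace : dspace (obj G). Proof. exact: (manifold_dspace (lie_obj L)). Qed.
Lemma arr_frame (g : arr G) : has_frame m g. Proof. exact: (manifold_frame g (lie_arr L)). Qed.
Lemma obj_frame (x : obj G) : has_frame n x. Proof. exact: (manifold_frame x (lie_obj L)). Qed.

Lemma tangent_gs g u : tangent g u -> tangent (gs g) (push (@gs _ G) u).
Proof. exact: (push_tangent obj_dspace (lie_gs L)). Qed.
Lemma tangent_gt g u : tangent g u -> tangent (gt g) (push (@gt _ G) u).
Proof. exact: (push_tangent obj_dspace (lie_gt L)). Qed.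
Lemma tangent_gunit x u : tangent x u -> tangent (gunit x) (push (@gunit _ G) u).
Proof. exact: (push_tangent arr_dspace (lie_gunit L)). Qed.

Lemma tangent_gs_unit x u : tangent (gunit x) u -> tangent x (push (@gs _ G) u).
Proof. by move=> tu; move: (tangent_gs tu); rewrite gs_unit. Qed.
Lemma tangent_gt_unit x u : tangent (gunit x) u -> tangent x (push (@gt _ G) u).
Proof. by move=> tu; move: (tangent_gt tu); rewrite gt_unit. Qed.

Lemma push_gs_unit x u : tangent x u -> push (@gs _ G) (push (@gunit _ G) u) = u.
Proof.
move=> tu; rewrite (push_comp _ _ (lie_gs L)) (_ : (fun y => _) = fun y => y).
  exact: (push_id tu).
by apply: funext => y; rewrite gs_unit.
Qed.

Lemma unit_split x v : tangent (gunit x) v ->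
  algebroid x (comb (-1) (push (@gunit _ G) (push (@gs _ G) v)) v).
Proof.
move=> tv; have ts : tangent x (push (@gs _ G) v) by exact: tangent_gs_unit.
split; first exact: (tangent_comb _ (tangent_gunit ts) tv).
rewrite push_comb (push_gs_unit ts); apply: funext => f.
by rewrite /comb mulN1r addNr.
Qed.

Lemma smooth_comp_pr1 : smooth_map (@comp_pr1 _ G). Proof. exact: smooth_fibre_fst. Qed.
Lemma smooth_comp_pr2 : smooth_map (@comp_pr2 _ G). Proof. exact: smooth_fibre_snd. Qed.

Lemma comp_eq (p q : comp_space G) : comp_pr1 p = comp_pr1 q -> comp_pr2 p = comp_pr2 q -> p = q.
Proof.
move=> e1 e2; apply: eq_sig_hprop => [? ? ?|]; first exact: Prop_irrelevance.
by move: e1 e2; rewrite /comp_pr1 /comp_pr2; case: (sval p) (sval q) => [? ?] [? ?] /= -> ->.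
Qed.

(** The source is a submersion, hence transverse to the target. *)
Lemma comp_lift (p : comp_space G) u1 u2 : tangent (comp_pr1 p) u1 -> tangent (comp_pr2 p) u2 ->
  push (@gs _ G) u1 = push (@gt _ G) u2 ->
  exists u, [/\ tangent p u, push (@comp_pr1 _ G) u = u1 & push (@comp_pr2 _ G) u = u2].
Proof.
have tr : transverse_at (@gs _ G) (@gt _ G) (fibre_fst p) (fibre_snd p).
  move=> w tw; have [u tu uw] := lie_gs_subm L tw.
  exists u, (@vec0 R _); split=> //; first exact: tangent_vec0.
  by rewrite uw push_vec0; apply: funext => f; rewrite /comb mul1r addr0.
exact: (fibre_product (lie_gs L) (lie_gt L) (lie_arr L) (lie_arr L) (lie_obj L) tr).2.
Qed.

Definition unit_left (h : arr G) : comp_space G := exist _ (gunit (gt h), h) (gs_unit (gt h)).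

Definition unit_right (g : arr G) : comp_space G :=
  exist (fun x : prod_space (arr G) (arr G) => gs x.1 = gt x.2) (g, gunit (gs g))
    (esym (gt_unit (gs g))).

Lemma smooth_unit_left : smooth_map unit_left.
Proof.
apply: (smooth_into_fibre arr_dspace); last exact: smooth_map_id.
exact: (smooth_map_comp (lie_gt L) (lie_gunit L)).
Qed.

Lemma smooth_unit_right : smooth_map unit_right.
Proof.
apply: (smooth_into_fibre arr_dspace); first exact: smooth_map_id.
exact: (smooth_map_comp (lie_gs L) (lie_gunit L)).
Qed.

Lemma mul_unit_left h : comp_mul (unit_left h) = h. Proof. exact: gmul1. Qed.
Lemma mul_unit_right h : comp_mul (unit_right h) = h. Proof. exact: gmulr1. Qed.

(** The vector (u, 0) at the composable pair (1, h). The choice is harmless: tangent vectors of the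
    space of composable pairs are determined by their two projections, and [comp_lift] provides one
    when u lies in the Lie algebroid at the target of h. *)
Definition rlift (h : arr G) (u : vec (arr G)) : vec (comp_space G) :=
  xget (@vec0 R _) [set U | [/\ tangent (unit_left h) U, push (@comp_pr1 _ G) U = u &
    push (@comp_pr2 _ G) U = @vec0 R _]].

(* The differential at the unit of right translation by h. *)
Definition rtrans (h : arr G) (u : vec (arr G)) : vec (arr G) := push (@comp_mul _ G) (rlift h u).

Lemma rliftP h u : algebroid (gt h) u ->
  [/\ tangent (unit_left h) (rlift h u), push (@comp_pr1 _ G) (rlift h u) = u &
    push (@comp_pr2 _ G) (rlift h u) = @vec0 R _].
Proof.
move=> [tu su]; apply: (xgetPex (@vec0 R _) (P := [set U | [/\ tangent (unit_left h) U,
  push (@comp_pr1 _ G) U = u & push (@comp_pr2 _ G) U = @vec0 R _]])).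
by apply: comp_lift => //; [exact: tangent_vec0 | rewrite su push_vec0].
Qed.

Lemma rtrans_tangent h u : algebroid (gt h) u -> tangent h (rtrans h u).
Proof.
move=> au; have [tU _ _] := rliftP au.
by have := push_tangent arr_dspace (lie_gmul L) tU; rewrite mul_unit_left.
Qed.

Lemma rtrans_gs h u : algebroid (gt h) u -> push (@gs _ G) (rtrans h u) = @vec0 R _.
Proof.
move=> au; have [tU _ U2] := rliftP au; rewrite /rtrans (push_comp _ _ (lie_gs L)).
rewrite (_ : (fun x => _) = fun x => gs (comp_pr2 x)).
  by rewrite -(push_comp _ _ (lie_gs L)) U2 push_vec0.
by apply: funext => x; rewrite gs_mul.
Qed.

Lemma rtrans_gt h u : algebroid (gt h) u -> push (@gt _ G) (rtrans h u) = push (@gt _ G) u.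
Proof.
move=> au; have [tU U1 _] := rliftP au; rewrite /rtrans (push_comp _ _ (lie_gt L)).
rewrite (_ : (fun x => _) = fun x => gt (comp_pr1 x)).
  by rewrite -(push_comp _ _ (lie_gt L)) U1.
by apply: funext => x; rewrite gt_mul.
Qed.

(** At a unit the pair (1, 1) is also of the form (g, 1). The tangent map of g |-> (g, 1) sends u to
    (u, 0), as u is killed by the source, and the right unit law then returns u. *)
Lemma rtrans_unit x u : algebroid x u -> rtrans (gunit x) u = u.
Proof.
move=> au; have au' : algebroid (gt (gunit x)) u by rewrite gt_unit.
have [tU U1 U2] := rliftP au'.
have e : unit_left (gunit x) = unit_right (gunit x).
  by apply: comp_eq; rewrite /comp_pr1 /comp_pr2 /= ?gt_unit ?gs_unit.
rewrite e in tU.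
have tV : tangent (unit_right (gunit x)) (push unit_right u).
  exact: (push_tangent (@dspace_sub R _ _) smooth_unit_right (algebroid_tangent au)).
have EU : rlift (gunit x) u = push unit_right u.
  apply: (fibre_tangent_eq tU tV).
    transitivity u; first exact: U1.
    change (u = push (@comp_pr1 _ G) (push unit_right u)).
    by rewrite (push_comp _ _ smooth_comp_pr1) (push_id (algebroid_tangent au)).
  transitivity (@vec0 R (arr G)); first exact: U2.
  change (@vec0 R (arr G) = push (@comp_pr2 _ G) (push unit_right u)).
  rewrite (push_comp _ _ smooth_comp_pr2) -(push_comp (fun g => gs g) _ (lie_gunit L)).
  by rewrite (algebroid_ker au) push_vec0.
rewrite /rtrans EU (push_comp _ _ (lie_gmul L)) (_ : (fun y => _) = fun y => y).
  exact: (push_id (algebroid_tangent au)).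
by apply: funext => g; rewrite mul_unit_right.
Qed.

(** The defect of multiplicativity is kept as a parenthesis, so that one identity serves both
    multiplicative forms, where it is zero, and the forms of lagrangian morphisms, where it is the
    pullback of [Omega]. *)
Lemma rtrans_form s h u v : form2 s -> algebroid (gt h) u -> tangent h v ->
  let V := push unit_left v in
  [/\ tangent (unit_left h) V, push (@comp_pr1 _ G) V = push (@gunit _ G) (push (@gt _ G) v),
    push (@comp_pr2 _ G) V = v &
  s h (rtrans h u) v = lambda s (gt h) u (push (@gt _ G) v) -
    (pull2 (@comp_pr1 _ G) s (unit_left h) (rlift h u) V +
     pull2 (@comp_pr2 _ G) s (unit_left h) (rlift h u) V -
     pull2 (@comp_mul _ G) s (unit_left h) (rlift h u) V)].
Proof.
move=> fs au tv V; have [tU U1 U2] := rliftP au.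
have V1 : push (@comp_pr1 _ G) V = push (@gunit _ G) (push (@gt _ G) v).
  by rewrite (push_comp _ _ (lie_gunit L)) /V (push_comp _ _ smooth_comp_pr1).
have V2 : push (@comp_pr2 _ G) V = v.
  by rewrite /V (push_comp _ _ smooth_comp_pr2); exact: (push_id tv).
have V3 : push (@comp_mul _ G) V = v.
  rewrite /V (push_comp _ _ (lie_gmul L)) (_ : (fun y => _) = fun y => y).
    exact: (push_id tv).
  by apply: funext => g; rewrite mul_unit_left.
split=> //.
  exact: (push_tangent (@dspace_sub R _ _) smooth_unit_left tv).
rewrite /pull2 V1 V2 V3 U1 U2 mul_unit_left /lambda.
have -> : s (comp_pr2 (unit_left h)) (@vec0 R _) v = 0.
  exact: (covector0 (form2_covl fs (tv : tangent (comp_pr2 (unit_left h)) v))).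
rewrite addr0 -[comp_pr1 _]/(gunit (gt h)) -/(rtrans h u).
by rewrite opprB addrCA subrr addr0.
Qed.

Lemma covector_lambda (s : arr G -> vec (arr G) -> vec (arr G) -> R) x u : form2 s -> alt2 s -> tangent (gunit x) u ->
  covector x (lambda s x u).
Proof.
move=> fs as_ tu c v1 v2 t1 t2; rewrite /lambda push_comb.
exact: (form2_covr fs as_ tu _ (tangent_gunit t1) (tangent_gunit t2)).
Qed.

(** Smoothness is tested on the lift to composable pairs, whose two components are u at the target
    of h, and zero. *)
Lemma right_invariant_vfield (u : obj G -> vec (arr G)) : along (@gunit _ G) u ->
  (forall x, algebroid x (u x)) -> vfield (fun h => rtrans h (u (gt h))).
Proof.
move=> [tu su] au; apply/along_vfield.
have aP h := rliftP (au (gt h)).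
have aU : along unit_left (fun h => rlift h (u (gt h))).
  apply: (along_sub arr_dspace smooth_unit_left) => [h|]; first by case: (aP h).
  apply: along_smooth; apply: (along_prod arr_dspace (f := fun h => sval (unit_left h))).
  - exact: (smooth_map_comp smooth_unit_left (@smooth_sval R _ _)).
  - move=> h; have [tU _ _] := aP h.
    exact: (push_tangent (@dspace_prod R _ _) (@smooth_sval R _ _) tU).
  - move=> g sg; rewrite (_ : (fun h => _) = fun h => u (gt h) g).
      exact: (lie_gt L (su _ sg)).
    apply: funext => h; have [_ U1 _] := aP h.
    by rewrite (push_comp _ _ (@smooth_fst R _ _)) -[in RHS]U1.
  - move=> g sg; rewrite (_ : (fun h => _) = fun h => 0); first exact: (smoothC _ arr_dspace).
    apply: funext => h; have [_ _ U2] := aP h.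
    by rewrite (push_comp _ _ (@smooth_snd R _ _)) -[RHS]/(@vec0 R (arr G) g) -[in RHS]U2.
have := along_push arr_dspace (lie_gmul L) aU.
by rewrite (_ : (fun p => comp_mul _) = fun p => p) // funeqE => p; rewrite mul_unit_left.
Qed.

Lemma ginvK (g : arr G) : ginv (ginv g) = g.
Proof.
have unl (y h : arr G) (ey : y = gunit (gt h)) (e : gs y = gt h) : gmul e = h.
  by move: e; rewrite ey => e; exact: gmul1.
have unr (y h : arr G) (ey : y = gunit (gs h)) (e : gs h = gt y) : gmul e = h.
  by move: e; rewrite ey => e; exact: gmulr1.
have e1 : gs (ginv g) = gt g by exact: gs_inv.
have e3 : gs (ginv (ginv g)) = gt (ginv g) by exact: gs_inv.
have e2 : gs (ginv (ginv g)) = gt (gmul e1) by rewrite gt_mul e3.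
have e4 : gs (gmul e3) = gt g by rewrite gs_mul e1.
have <- : gmul e2 = ginv (ginv g) by apply: unr; rewrite (gmulV e1) e3 gt_inv.
by rewrite (gmulA e2 e4); apply: unl; rewrite (gmulV e3) gs_inv.
Qed.

End LieGroupoids.

Section InverseMap.
Variable R : realType.

Lemma submersion_gt (G : groupoid R) : dspace (arr G) -> smooth_map (@ginv _ G) ->
  smooth_map (@gt _ G) -> submersion (@gs _ G) -> submersion (@gt _ G).
Proof.
move=> dA si st sub p w tw; rewrite -gs_inv in tw.
have [u tu uw] := sub _ _ tw; exists (push (@ginv _ G) u).
  by have := push_tangent dA si tu; rewrite ginvK.
rewrite (push_comp _ _ st) (_ : (fun x => _) = @gs _ G) //.
by apply: funext => x; rewrite gt_inv.
Qed.

End InverseMap.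

(** * The Dirac structure of a quasi-symplectic groupoid *)

Section QuasiSymplecticDirac.
Variable R : realType.
Local Notation space := (space R).

(** The fields are related on a neighbourhood {h <> 0} of q, since the bracket at q differentiates
    them once. *)
Lemma push_lie (M N : space) (f : M -> N) (h : M -> R) q X Y X' Y' : dspace M -> dspace N ->
  smooth_map f -> vfield X -> vfield Y -> vfield X' -> vfield Y' -> smooth h -> h q <> 0 ->
  (forall q, h q <> 0 -> push f (X q) = X' (f q)) ->
  (forall q, h q <> 0 -> push f (Y q) = Y' (f q)) ->
  push f (lie X Y q) = lie X' Y' (f q).
Proof.
move=> dM dN sf vX vY vX' vY' sh hq eX eY.
have tl := vfield_tangent (vfield_lie dM vX vY) q.
apply: (tangent_eq (push_tangent dN sf tl) (vfield_tangent (vfield_lie dN vX' vY') (f q))).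
move=> g sg; have sgf := sf _ sg.
rewrite push_smooth // /lie; congr (_ - _).
  rewrite -eX // push_smooth; last exact: (vfield_smooth vY' sg).
  apply: (tangent_loc (vfield_tangent vX q) (vfield_smooth vY sgf) _ sh hq).
    exact: (sf _ (vfield_smooth vY' sg)).
  by move=> r hr; rewrite -eY // push_smooth.
rewrite -eY // push_smooth; last exact: (vfield_smooth vX' sg).
apply: (tangent_loc (vfield_tangent vY q) (vfield_smooth vX sgf) _ sh hq).
  exact: (sf _ (vfield_smooth vX' sg)).
by move=> r hr; rewrite -eX // push_smooth.
Qed.

Lemma vfield0 (M : space) : dspace M -> vfield (fun _ : M => @vec0 R M).
Proof. by move=> dM; split=> [p|g _]; [exact: tangent_vec0 | exact: smoothC]. Qed.

Lemma lie_vec0 (M : space) (p : M) : dspace M ->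
  lie (fun _ : M => @vec0 R M) (fun _ => @vec0 R M) p = @vec0 R M.
Proof. by move=> dM; apply: funext => f; rewrite /lie /vec0 subrr. Qed.

Variables (n : nat) (G : groupoid R).
Variables (w : arr G -> vec (arr G) -> vec (arr G) -> R)
  (eta : obj G -> vec (obj G) -> vec (obj G) -> vec (obj G) -> R).
Hypothesis L : lie_groupoid (n + n) n G.
Hypothesis Q : quasi_symplectic w eta.
Let dA : dspace (arr G) := arr_dspace L.
Let dO : dspace (obj G) := obj_dspace L.
Let fw := qs_form Q.

Lemma qs_alt2 : alt2 w.
Proof.
apply: (form2_alt2 dA (arr_frame L) fw) => X Y Y' Z p vX vY vY' vZ e.
by rewrite !(qs_d Q) // /pull3 e.
Qed.

Lemma qs_rtrans h u v : algebroid (gt h) u -> tangent h v ->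
  w h (rtrans h u) v = lambda w (gt h) u (push (@gt _ G) v).
Proof.
move=> au tv; have [tV _ _ ->] := rtrans_form L fw au tv.
have [tU _ _] := rliftP L au.
have := qs_mul Q tU tV => /eqP; rewrite subr_eq0 => /eqP ->.
by rewrite subrr subr0.
Qed.

Lemma qs_unit x u v : algebroid x u -> tangent (gunit x) v ->
  w (gunit x) u v = lambda w x u (push (@gt _ G) v).
Proof.
move=> au tv; have au' : algebroid (gt (gunit x)) u by rewrite gt_unit.
by have := qs_rtrans au' tv; rewrite gt_unit (rtrans_unit L au).
Qed.

Lemma qs_isotropic x u v : algebroid x u -> algebroid x v ->
  lambda w x u (push (@gt _ G) v) + lambda w x v (push (@gt _ G) u) = 0.
Proof.
move=> au av; rewrite -!qs_unit //; try exact: algebroid_tangent.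
by rewrite (qs_alt2 (algebroid_tangent au) (algebroid_tangent av)) addNr.
Qed.

Lemma qs_nondegenerate x u : algebroid x u -> push (@gt _ G) u = @vec0 R _ ->
  (forall v, tangent x v -> lambda w x u v = 0) -> u = @vec0 R _.
Proof.
move=> au tu0 lu0; apply: (qs_ker Q (algebroid_tangent au) (algebroid_ker au)) => // v tv.
rewrite qs_unit //; apply: lu0; by move: (tangent_gt L tv); rewrite gt_unit.
Qed.

Lemma lambda_lincomb d x (c : 'I_d -> R) (U : 'I_d -> vec (arr G)) v :
  (forall i, tangent (gunit x) (U i)) -> tangent x v ->
  lambda w x (lincomb c U) v = \sum_i c i * lambda w x (U i) v.
Proof.
move=> tU tv; exact: (covector_lincomb _ (form2_covl fw (tangent_gunit L tv)) tU).
Qed.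

Lemma algebroid_lincomb d x (c : 'I_d -> R) (U : 'I_d -> vec (arr G)) :
  (forall i, algebroid x (U i)) -> algebroid x (lincomb c U).
Proof.
move=> aU; split; first by apply: tangent_lincomb => i; exact: algebroid_tangent.
rewrite push_lincomb; apply: funext => f; rewrite /lincomb big1 // => i _.
by rewrite (algebroid_ker (aU i)) /vec0 mulr0.
Qed.

Lemma form1_lambda u : along (@gunit _ G) u -> form1 (fun x => lambda w x (u x)).
Proof.
move=> au; split=> [p|Z vZ]; first exact: (covector_lambda L fw qs_alt2 (along_tangent au p)).
apply: (form2_along dO (arr_frame L) fw qs_alt2 (lie_gunit L) au).
exact: (along_push dA (lie_gunit L) ((along_vfield Z).1 vZ)).
Qed.

Lemma vfield_gt_unit u : along (@gunit _ G) u -> vfield (fun x => push (@gt _ G) (u x)).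
Proof.
move=> au; apply/along_vfield; have := along_push dO (lie_gt L) au.
by rewrite (_ : (fun p => gt (gunit p)) = fun p => p) // funeqE => p; rewrite gt_unit.
Qed.

(** The Lie algebroid is the kernel of the differential of the source along the units: restrict a
    vertical frame of the source to them. *)
Lemma algebroid_frame (p : obj G) : exists (U : 'I_n -> obj G -> vec (arr G)) (h : obj G -> R),
  [/\ smooth h, h p <> 0, forall j, along (@gunit _ G) (U j), forall j x, algebroid x (U j x) &
    forall x, h x <> 0 ->
      (forall c, lincomb c (U ^~ x) = @vec0 R (arr G) -> forall j, c j = 0) /\
      (forall v, algebroid x v -> exists c, v = lincomb c (U ^~ x))].
Proof.
have sub v : tangent (gs (gunit p)) v ->
    exists2 u, tangent (gunit p) u & push (@gs _ G) u = v by exact: (lie_gs_subm L).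
have [U [h [[sh hp] vU kU fU _]]] := submersion_frame dA dO (lie_gs L)
  (arr_frame L (gunit p)) (obj_frame L _) sub.
exists (fun j x => U j (gunit x)), (fun x => h (gunit x)); split=> //.
- exact: (lie_gunit L sh).
- move=> j; exact: (along_comp (lie_gunit L) ((along_vfield _).1 (vU j))).
- by move=> j x; split; [exact: (vfield_tangent (vU j)) | exact: kU].
- move=> x hx; have [ind spn] := fU _ hx; split=> // v [tv sv]; exact: spn.
Qed.

Section CoordinateRows.
Variables (x : obj G) (z : 'I_n -> obj G -> R) (F : 'I_n -> obj G -> vec (obj G)) (k : obj G -> R).
Hypotheses (FF : frame z F k) (kx : k x <> 0).
Let tF i : tangent x (F i x) := vfield_tangent (frame_E FF i) x.

Definition coord_row (X : vec (obj G)) (a : covec (obj G)) : 'rV[R]_(n + n) :=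
  row_mx (\row_l X (z l)) (\row_l a (F l x)).

Lemma coord_row_inj X a Y b : tangent x X -> covector x a -> tangent x Y -> covector x b ->
  coord_row X a = coord_row Y b -> X = Y /\ forall v, tangent x v -> a v = b v.
Proof.
move=> tX ca tY cb /eq_row_mx [/rowP eX /rowP ea]; split.
  by apply: (frame_eq FF kx tX tY) => i; move: (eX i); rewrite !mxE.
move=> v tv; rewrite (lincomb_frame FF kx tv) !(covector_lincomb _ _ tF) //.
by apply: eq_bigr => i _; move: (ea i); rewrite !mxE => ->.
Qed.

(** The block matrix is the Gram matrix of the Courant pairing in a frame and its dual. *)
Lemma coord_row_pairing X a Y b : tangent x X -> covector x a -> tangent x Y -> covector x b ->
  (coord_row X a *m block_mx 0 1%:M 1%:M 0 *m (coord_row Y b)^T) 0 0 = b X + a Y.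
Proof.
move=> tX ca tY cb; rewrite /coord_row mul_row_block !mulmx0 !mulmx1 add0r addr0.
rewrite tr_row_mx mul_row_col [LHS]mxE addrC.
rewrite {2}(lincomb_frame FF kx tX) {2}(lincomb_frame FF kx tY) !(covector_lincomb _ _ tF) //.
congr (_ + _); rewrite mxE; apply: eq_bigr => i _; rewrite !mxE //; exact: mulrC.
Qed.

Variable U : 'I_n -> vec (arr G).
Hypothesis aU : forall i, algebroid x (U i).
Hypothesis iU : forall c, lincomb c U = @vec0 R (arr G) -> forall j, c j = 0.

Definition frame_mx : 'M[R]_(n, n + n) :=
  \matrix_i coord_row (push (@gt _ G) (U i)) (lambda w x (U i)).

Lemma mul_frame_mx (c : 'rV[R]_n) : c *m frame_mx =
  coord_row (push (@gt _ G) (lincomb (c 0) U)) (lambda w x (lincomb (c 0) U)).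
Proof.
apply/rowP => j; rewrite mxE; case: (split_ordP j) => l ->.
  rewrite /coord_row row_mxEl mxE push_lincomb; apply: eq_bigr => i _.
  by rewrite /frame_mx mxE /coord_row row_mxEl mxE.
rewrite /coord_row row_mxEr mxE lambda_lincomb //; last by move=> i; exact: algebroid_tangent.
by apply: eq_bigr => i _; rewrite /frame_mx mxE /coord_row row_mxEr mxE.
Qed.

Lemma rank_frame_mx : \rank frame_mx = n.
Proof.
apply/eqP; rewrite -[_ == _]/(row_free _) -kermx_eq0; apply/rowV0P => c /sub_kermxP.
rewrite mul_frame_mx => e; have aL := algebroid_lincomb (c 0) aU.
have c0 : covector x (fun=> 0 : R) by move=> a u v _ _; rewrite mulr0 addr0.
have z0 : coord_row (@vec0 R _) (fun=> 0) = 0.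
  by apply/rowP => j; case: (split_ordP j) => l ->;
    rewrite /coord_row ?row_mxEl ?row_mxEr !mxE.
have [X0 a0] := coord_row_inj (tangent_gt_unit L (algebroid_tangent aL))
  (covector_lambda L fw qs_alt2 (algebroid_tangent aL)) (tangent_vec0 x) c0 (etrans e (esym z0)).
apply/rowP => j; rewrite mxE; exact: (iU (qs_nondegenerate aL X0 a0)).
Qed.

Lemma frame_mx_isotropic : frame_mx *m block_mx 0 1%:M 1%:M 0 *m frame_mx^T = 0.
Proof.
apply/matrixP => i j.
have tU i' := algebroid_tangent (aU i').
rewrite mul_trmx_entry row_mul.
rewrite !rowK coord_row_pairing ?[RHS]mxE //; try exact: (covector_lambda L fw qs_alt2);
  try exact: (tangent_gt_unit L).
by rewrite addrC; exact: qs_isotropic.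
Qed.

End CoordinateRows.

Variable E : obj G -> vec (obj G) -> covec (obj G) -> Prop.
Hypothesis iE : integrates w E.

Lemma image_subbundle : subbundle E.
Proof.
exists n => p; have [U [h [sh hp vU aU fU]]] := algebroid_frame p.
have tU j x := algebroid_tangent (aU j x).
exists h, (fun j x => push (@gt _ G) (U j x)), (fun j x => lambda w x (U j x)); split=> //.
  by move=> j; split; [exact: (vfield_gt_unit (vU j)) | exact: (form1_lambda (vU j))].
move=> q hq; have [ind spn] := fU q hq; split.
  move=> c X0 a0; apply: ind; have aL := algebroid_lincomb c (aU ^~ q).
  apply: (qs_nondegenerate aL).
    by rewrite push_lincomb; apply: funext => f; exact: X0.
  by move=> v tv; rewrite lambda_lincomb //; exact: a0.
move=> Y b; split=> [/iE [u au [-> bu]]|[c [-> bc]]].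
  have [c uc] := spn u au; exists c; split; first by rewrite uc push_lincomb.
  by move=> v tv; rewrite bu // uc lambda_lincomb.
apply/iE; exists (lincomb c (U ^~ q)); first exact: (algebroid_lincomb c (aU ^~ q)).
split; first by rewrite push_lincomb.
by move=> v tv; rewrite bc // lambda_lincomb.
Qed.

Lemma image_lagrangian : lagrangian E.
Proof.
move=> p X a; split.
  move=> /iE [u au [-> bu]]; have tu := algebroid_tangent au; split.
    split; first exact: (tangent_gt_unit L).
    move=> c v1 v2 t1 t2; rewrite !bu //; last exact: tangent_comb.
    exact: (covector_lambda L fw qs_alt2 tu).
  move=> Y b /iE [v av [-> bv]]; rewrite bu ?bv; first exact: qs_isotropic.
    exact: (tangent_gt_unit L).
  exact: (tangent_gt_unit L (algebroid_tangent av)).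
move=> [[tX ca] orth]; have [U [h [sh hp vU aU fU]]] := algebroid_frame p.
have [z [F [k [FF kp]]]] := obj_frame L p.
have [ind _] := fU p hp; have tU i := algebroid_tangent (aU i p).
have XB : coord_row p z F X a *m block_mx 0 1%:M 1%:M 0 *m (frame_mx p z F (U ^~ p))^T = 0.
  apply/rowP => j; rewrite mul_trmx_entry row_id rowK [RHS]mxE.
  have tUj := tangent_gt_unit L (tU j); have cUj := covector_lambda L fw qs_alt2 (tU j).
  rewrite (coord_row_pairing FF kp tX ca tUj cUj) addrC.
  by apply: orth; apply/iE; exists (U j p).
have [c] := maximal_isotropic_row (rank_frame_mx FF kp (aU ^~ p) ind)
  (frame_mx_isotropic FF kp (aU ^~ p)) XB.
have aL := algebroid_lincomb (c 0) (aU ^~ p).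
have tL := algebroid_tangent aL.
rewrite (mul_frame_mx FF (aU ^~ p)) => Xc.
have [eX ea] := coord_row_inj FF kp tX ca (tangent_gt_unit L tL) (covector_lambda L fw qs_alt2 tL) Xc.
by apply/iE; exists (lincomb (c 0) (U ^~ p)).
Qed.

Definition algebroid_section (X : obj G -> vec (obj G)) (a : obj G -> covec (obj G))
    (u : obj G -> vec (arr G)) :=
  [/\ along (@gunit _ G) u, forall x, algebroid x (u x),
    forall x, X x = push (@gt _ G) (u x) &
    forall x v, tangent x v -> a x v = lambda w x (u x) v].

(** Every X + a in E lifts to the Lie algebroid, uniquely by nondegeneracy, but the fibrewise lift
    has to be proved smooth. Its coefficients in a local frame solve c B = (coordinates of X + a)
    with B smooth and of full rank at p, so they are smooth near p. *)
Lemma image_section X a : bigsection X a -> (forall x, E x (X x) (a x)) ->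
  exists u, algebroid_section X a u.
Proof.
move=> [vX fa] EX.
have [u uP] : exists u : obj G -> vec (arr G), forall x, [/\ algebroid x (u x),
    X x = push (@gt _ G) (u x) & forall v, tangent x v -> a x v = lambda w x (u x) v].
  have H x : exists u, [/\ algebroid x u, X x = push (@gt _ G) u &
      forall v, tangent x v -> a x v = lambda w x u v].
    by have [u au [e1 e2]] := (iE x (X x) (a x)).1 (EX x); exists u.
  by exists (fun x => sval (cid (H x))) => x; exact: (svalP (cid (H x))).
have au x : algebroid x (u x) by case: (uP x).
exists u; split=> //; [|by move=> x; case: (uP x)..].
split=> [x|f sf]; first exact: algebroid_tangent.
apply: (smooth_quot_loc dO) => p.
have [U [h [sh hp vU aU fU]]] := algebroid_frame p.
have tU i x := algebroid_tangent (aU i x).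
have [z [F [k [FF kp]]]] := obj_frame L p.
have [ind _] := fU p hp.
pose B x := frame_mx x z F (U ^~ x).
pose c x : 'rV[R]_n := xget (0 : 'rV[R]_n) [set c : 'rV[R]_n | u x = lincomb (c 0) (U ^~ x)].
have uc x : h x <> 0 -> u x = lincomb (c x 0) (U ^~ x).
  move=> hx; have [_ /(_ _ (au x)) [c' e]] := fU x hx.
  apply: (xgetPex (0 : 'rV[R]_n) (P := [set c : 'rV[R]_n | u x = lincomb (c 0) (U ^~ x)])).
  exists (\row_i c' i); rewrite /= e; congr lincomb.
  by apply: funext => i; rewrite mxE.
have sB i j : smooth (fun x => B x i j).
  case: (split_ordP j) => l ->.
    rewrite (_ : (fun x => _) = fun x => push (@gt _ G) (U i x) (z l)).
      exact: (vfield_smooth (vfield_gt_unit (vU i)) (frame_x FF l)).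
    by apply: funext => x; rewrite /B /frame_mx mxE /coord_row row_mxEl mxE.
  rewrite (_ : (fun x => _) = fun x => lambda w x (U i x) (F l x)).
    exact: (form1_smooth (form1_lambda (vU i)) (frame_E FF l)).
  by apply: funext => x; rewrite /B /frame_mx mxE /coord_row row_mxEr mxE.
(* The factor h discards the points where the frame need not span and the chosen coefficients mean
   nothing. *)
have hcB x : h x *: c x *m B x = h x *: coord_row x z F (X x) (a x).
  have [->|hx] := pselect (h x = 0); first by rewrite !scale0r mul0mx.
  rewrite -scalemxAl (mul_frame_mx FF (aU ^~ x)) -uc //; congr (_ *: _).
  have [_ eX ea] := uP x; rewrite -eX /coord_row; congr row_mx.
  apply/rowP => j; rewrite !mxE ea //; exact: (vfield_tangent (frame_E FF j)).
have shc j : smooth (fun x => (h x *: c x *m B x) 0 j).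
  case: (split_ordP j) => l ->.
    rewrite (_ : (fun x => _) = fun x => h x * X x (z l)).
      exact: (smoothM dO sh (vfield_smooth vX (frame_x FF l))).
    by apply: funext => x; rewrite hcB mxE /coord_row row_mxEl mxE.
  rewrite (_ : (fun x => _) = fun x => h x * a x (F l x)).
    exact: (smoothM dO sh (form1_smooth fa (frame_E FF l))).
  by apply: funext => x; rewrite hcB mxE /coord_row row_mxEr mxE.
have [r [sr rp src]] := smooth_solve dO sB shc (rank_frame_mx FF kp (aU ^~ p) ind).
exists (fun x => r x * h x), (fun x => \sum_j (r x * (h x *: c x) 0 j) * U j x f); split.
- exact: (smoothM dO sr sh).
- apply: (smooth_sum (f := fun j x => (r x * (h x *: c x) 0 j) * U j x f) _ dO) => j.
  exact: (smoothM dO (src j) (along_smooth (vU j) sf)).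
- by apply/eqP; rewrite mulf_neq0 //; exact/eqP.
- move=> q rhq; rewrite uc; last by move=> h0; apply: rhq; rewrite h0 mulr0.
  by rewrite /lincomb mulr_sumr; apply: eq_bigr => j _; rewrite mxE; ring.
Qed.

(* The right-invariant vector fields of sections u1, u2 of the algebroid satisfy
   w(R_i, v) = a_i(t_* v), so that evaluating dw = s^* eta - t^* eta on R_1, R_2 and
   a t-projectable field computes the Courant bracket. *)
Lemma image_involutive X a Y b : bigsection X a -> bigsection Y b ->
  (forall p, E p (X p) (a p)) -> (forall p, E p (Y p) (b p)) ->
  exists2 g, courant_form eta X a Y b g & forall p, E p (lie X Y p) (g p).
Proof.
move=> sXa sYb EX EY; have [vX fa] := sXa; have [vY fb] := sYb.
have [u1 [v1 a1 X1 l1]] := image_section sXa EX.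
have [u2 [v2 a2 Y2 l2]] := image_section sYb EY.
pose R1 h := rtrans h (u1 (gt h)); pose R2 h := rtrans h (u2 (gt h)).
have vR1 : vfield R1 := right_invariant_vfield L v1 a1.
have vR2 : vfield R2 := right_invariant_vfield L v2 a2.
have R1t q : push (@gt _ G) (R1 q) = X (gt q) by rewrite X1; exact: (rtrans_gt L (a1 _)).
have R2t q : push (@gt _ G) (R2 q) = Y (gt q) by rewrite Y2; exact: (rtrans_gt L (a2 _)).
have R1s q : push (@gs _ G) (R1 q) = @vec0 R _ by exact: (rtrans_gs L (a1 _)).
have R2s q : push (@gs _ G) (R2 q) = @vec0 R _ by exact: (rtrans_gs L (a2 _)).
have w1 q v : tangent q v -> w q (R1 q) v = a (gt q) (push (@gt _ G) v).
  by move=> tv; rewrite (qs_rtrans (a1 _) tv) l1 //; exact: (tangent_gt L tv).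
have w2 q v : tangent q v -> w q (R2 q) v = b (gt q) (push (@gt _ G) v).
  by move=> tv; rewrite (qs_rtrans (a2 _) tv) l2 //; exact: (tangent_gt L tv).
have s1 : smooth (fun _ : arr G => 1 : R) := smoothC 1 dA.
have n1 : (1 : R) <> 0 by apply/eqP/oner_neq0.
have vR : vfield (lie R1 R2) := vfield_lie dA vR1 vR2.
(* Both fields are related by the source to the zero field, and hence so is their bracket. *)
have aR x : algebroid x (lie R1 R2 (gunit x)).
  split; first exact: (vfield_tangent vR).
  rewrite (push_lie (q := gunit x) dA dO (lie_gs L) vR1 vR2 (vfield0 dO) (vfield0 dO) s1 n1) //.
  exact: lie_vec0.
have vRu : along (@gunit _ G) (fun x => lie R1 R2 (gunit x)) :=
  along_comp (lie_gunit L) ((along_vfield _).1 vR).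
have tR x : push (@gt _ G) (lie R1 R2 (gunit x)) = lie X Y x.
  by rewrite (push_lie (q := gunit x) dA dO (lie_gt L) vR1 vR2 vX vY s1 n1) // gt_unit.
exists (fun x => lambda w x (lie R1 R2 (gunit x))); last first.
  by move=> p; apply/iE; exists (lie R1 R2 (gunit p)).
split; first exact: form1_lambda.
move=> Z vZ p.
have sub v : tangent (gt (gunit p)) v ->
    exists2 u, tangent (gunit p) u & push (@gt _ G) u = v by exact: (lie_gt_subm L).
have [_ [hh [[sh hp] _ _ _ lft]]] := submersion_frame dA dO (lie_gt L)
  (arr_frame L (gunit p)) (obj_frame L _) sub.
(* A lift of Z along the target, valid near the unit at p; it serves as the third argument of dw. *)
have [W vW Wt] := lft Z vZ.
have := qs_d Q vR1 vR2 vW (gunit p); rewrite {1}/pull3 R1s.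
have tgs u : tangent (gunit p) u -> tangent (gs (gunit p)) (push (@gs _ G) u) by exact: (tangent_gs L).
(* [R1] is killed by the source, so the pullback of [eta] by the source contributes zero. *)
rewrite (covector0 (form3_cov1 (qs_closed Q).1 (tgs _ (vfield_tangent vR2 _))
  (tgs _ (vfield_tangent vW _)))) /pull3 R1t R2t Wt // gt_unit sub0r /d2.
have tW := vfield_tangent vW; have tR1 := vfield_tangent vR1; have tR2 := vfield_tangent vR2.
have sbZ := form1_smooth fb vZ; have saZ := form1_smooth fa vZ; have saY := form1_smooth fa vY.
have -> : R1 (gunit p) (fun q => w q (R2 q) (W q)) = X p (fun q => b q (Z q)).
  have := R1t (gunit p); rewrite gt_unit => <-; rewrite push_smooth //.
  apply: (tangent_loc (tR1 _) (form2_smooth fw vR2 vW) (lie_gt L sbZ) sh hp) => q hq.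
  by rewrite w2 // Wt.
have -> : R2 (gunit p) (fun q => w q (R1 q) (W q)) = Y p (fun q => a q (Z q)).
  have := R2t (gunit p); rewrite gt_unit => <-; rewrite push_smooth //.
  apply: (tangent_loc (tR2 _) (form2_smooth fw vR1 vW) (lie_gt L saZ) sh hp) => q hq.
  by rewrite w1 // Wt.
have -> : W (gunit p) (fun q => w q (R1 q) (R2 q)) = Z p (fun q => a q (Y q)).
  have := Wt _ hp; rewrite gt_unit => <-; rewrite push_smooth //; congr (W _ _).
  by apply: funext => q; rewrite w1 // R2t.
have -> : w (gunit p) (lie R1 R2 (gunit p)) (W (gunit p)) =
    lambda w p (lie R1 R2 (gunit p)) (Z p).
  by rewrite (qs_unit (aR p) (tW _)) Wt // gt_unit.
have tl1 := vfield_tangent (vfield_lie dA vR1 vW) (gunit p).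
have tl2 := vfield_tangent (vfield_lie dA vR2 vW) (gunit p).
rewrite (qs_alt2 tl1 (tR2 _)) (qs_alt2 tl2 (tR1 _)) w1 // w2 //.
rewrite (push_lie dA dO (lie_gt L) vR1 vW vX vZ sh hp) //.
rewrite (push_lie dA dO (lie_gt L) vR2 vW vY vZ sh hp) // gt_unit /d1 => e.
lra.
Qed.

Lemma image_dirac : dirac eta E.
Proof.
split; [exact: (qs_closed Q) | exact: image_subbundle | exact: image_lagrangian |].
exact: image_involutive.
Qed.

End QuasiSymplecticDirac.

(** * The fibre groupoid *)

Section LagrangianMorphisms.
Variable R : realType.
Local Notation space := (space R).
Variables (K : sgroup R) (k : nat).
Local Notation K1 := (sgs K).
Local Notation K2 := (prod_space K1 K1).
Variables (Omega : K2 -> vec K2 -> vec K2 -> R)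
  (Theta : K1 -> vec K1 -> vec K1 -> vec K1 -> R).
Hypothesis HK : two_shifted Omega Theta k.

Lemma sgs_manifold : manifold k K1. Proof. by case: (ts_lie HK). Qed.
Lemma sgs_dspace : dspace K1. Proof. exact: (manifold_dspace sgs_manifold). Qed.
Lemma smooth_mul_K : smooth_map (@mul_K R K). Proof. by case: (ts_lie HK). Qed.

Lemma smooth_right (b : K1) : smooth_map (fun a : K1 => (a, b) : K2).
Proof.
apply: (smooth_pair sgs_dspace); first exact: smooth_map_id.
exact: (smooth_mapC _ sgs_dspace).
Qed.

Lemma smooth_left (b : K1) : smooth_map (fun a : K1 => (b, a) : K2).
Proof.
apply: (smooth_pair sgs_dspace); last exact: smooth_map_id.
exact: (smooth_mapC _ sgs_dspace).
Qed.

(** By [ts_delta_Theta] the derivative of [Omega] is a combination of pullbacks of [Theta], hence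
    depends only on values at the point. *)
Lemma Omega_alt2 : alt2 Omega.
Proof.
have m2 := prod_manifold sgs_manifold sgs_manifold.
apply: (form2_alt2 (manifold_dspace m2) (fun p => manifold_frame p m2) (ts_Omega HK)).
move=> X Y Y' Z p vX vY vY' vZ e; apply: oppr_inj.
by rewrite -!(ts_delta_Theta HK) // /pull3 e.
Qed.

Lemma pairing_combr a u v v' : tangent (@one_K R K) u -> tangent (@one_K R K) v ->
  tangent (@one_K R K) v' ->
  pairing Omega u (comb a v v') = a * pairing Omega u v + pairing Omega u v'.
Proof.
move=> tu tv tv'; rewrite /pairing !push_comb.
have d2 := @dspace_prod R K1 K1.
have tl w : tangent (@one_K R K) w -> tangent ((one_K K, one_K K) : K2) (push (@inl_K R K) w).
  exact: (push_tangent d2 (smooth_right (one_K K))).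
have tr w : tangent (@one_K R K) w -> tangent ((one_K K, one_K K) : K2) (push (@inr_K R K) w).
  exact: (push_tangent d2 (smooth_left (one_K K))).
rewrite (form2_covr (ts_Omega HK) Omega_alt2 (tl _ tu) _ (tr _ tv) (tr _ tv')).
rewrite (form2_covr (ts_Omega HK) Omega_alt2 (tr _ tu) _ (tl _ tv) (tl _ tv')).
ring.
Qed.

Variables (H : groupoid R) (m n : nat) (Phi : arr H -> K1)
  (s : arr H -> vec (arr H) -> vec (arr H) -> R)
  (eta : obj H -> vec (obj H) -> vec (obj H) -> vec (obj H) -> R).
Hypothesis LM : lagrangian_morphism Omega Theta k m n Phi s eta.
Let L := lag_lie LM.
Let sP : smooth_map Phi := lag_smooth LM.
Let fs := lag_form LM.

Lemma lag_alt2 : alt2 s.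
Proof.
apply: (form2_alt2 (arr_dspace L) (arr_frame L) fs) => X Y Y' Z p vX vY vY' vZ e.
have := lag_d LM vX vY vZ p; have := lag_d LM vX vY' vZ p.
by rewrite /pull3 e => <- /(addrI) /oppr_inj.
Qed.

Lemma Phi_unit x : Phi (gunit x) = one_K K.
Proof. exact: functor_unit (lag_functor LM). Qed.

Lemma tangent_Phi g u : tangent g u -> tangent (Phi g) (push Phi u).
Proof. exact: (push_tangent sgs_dspace sP). Qed.

Lemma tangent_Phi_unit x u : tangent (gunit x) u -> tangent (one_K K) (push Phi u).
Proof. by move=> tu; rewrite -(Phi_unit x); exact: tangent_Phi. Qed.

Lemma push_Phi_unit x u : tangent x u -> push Phi (push (@gunit _ H) u) = @vec0 R K1.
Proof.
move=> tu; rewrite (push_comp _ _ sP) (_ : (fun x => _) = fun=> one_K K).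
  exact: (push_cst _ (obj_dspace L) tu).
by apply: funext => y; exact: Phi_unit.
Qed.

Definition comp_Phi (y : comp_space H) : K2 := (Phi (comp_pr1 y), Phi (comp_pr2 y)).

Lemma smooth_comp_Phi : smooth_map comp_Phi.
Proof.
apply: (smooth_pair (@dspace_sub R _ _)).
  exact: (smooth_map_comp (@smooth_comp_pr1 R H) sP).
exact: (smooth_map_comp (@smooth_comp_pr2 R H) sP).
Qed.

Lemma push_comp_Phi (p : comp_space H) (W : vec (comp_space H)) : tangent p W ->
  [/\ tangent ((Phi (comp_pr1 p), Phi (comp_pr2 p)) : K2) (push comp_Phi W),
   push1 (push comp_Phi W) = push Phi (push (@comp_pr1 _ H) W) &
   push2 (push comp_Phi W) = push Phi (push (@comp_pr2 _ H) W)].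
Proof.
move=> tW; split; first exact: (push_tangent (@dspace_prod R _ _) smooth_comp_Phi tW).
  by rewrite !(push_comp _ _ (@smooth_fst R _ _)) !(push_comp _ _ sP).
by rewrite !(push_comp _ _ (@smooth_snd R _ _)) !(push_comp _ _ sP).
Qed.

Lemma push_comp_Phi_rlift h u : algebroid (gt h) u ->
  push comp_Phi (rlift h u) = push (fun a : K1 => (a, Phi h) : K2) (push Phi u).
Proof.
move=> au; have [tU U1 U2] := rliftP L au.
have tPu := tangent_Phi_unit (algebroid_tangent au).
have [tW W1 W2] := push_comp_Phi tU.
rewrite /= Phi_unit in tW.
apply: (tangent_prod_eq tW (push_tangent (@dspace_prod R _ _) (smooth_right (Phi h)) tPu)).
  by rewrite W1 U1 (push_comp _ _ (@smooth_fst R _ _)) /= (push_id tPu).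
by rewrite W2 U2 push_vec0 (push_comp _ _ (@smooth_snd R _ _)) (push_cst _ sgs_dspace tPu).
Qed.

Lemma push_Phi_rtrans h u : algebroid (gt h) u ->
  push Phi (rtrans h u) = push (fun a : K1 => mul_K (a, Phi h)) (push Phi u).
Proof.
move=> au; rewrite /rtrans (push_comp _ _ sP).
rewrite (_ : (fun x => _) = fun x => mul_K (comp_Phi x)).
  by rewrite -(push_comp _ _ smooth_mul_K) push_comp_Phi_rlift // (push_comp _ _ smooth_mul_K).
by apply: funext => x; exact: (lag_functor LM).
Qed.

Lemma lag_unit_form x u v : algebroid x u -> tangent (gunit x) v ->
  s (gunit x) u v = lambda s x u (push (@gt _ H) v) -
    Omega (one_K K, one_K K) (push (@inl_K R K) (push Phi u)) (push (@inr_K R K) (push Phi v)).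
Proof.
move=> au tv; have au' : algebroid (gt (gunit x)) u by rewrite gt_unit.
have [tV V1 V2] := rtrans_form L fs au' tv; have [tU U1 U2] := rliftP L au'.
rewrite (rtrans_unit L au) gt_unit => ->; congr (_ - _).
rewrite (lag_mul LM tU tV) /pull2 -/comp_Phi /= !Phi_unit (push_comp_Phi_rlift au') Phi_unit.
have tPv := tangent_Phi_unit tv.
have [tW W1 W2] := push_comp_Phi tV; rewrite /= !Phi_unit in tW.
congr (Omega _ _ _).
apply: (tangent_prod_eq tW (push_tangent (@dspace_prod R _ _) (smooth_left (one_K K)) tPv)).
  rewrite W1 V1 (push_Phi_unit (tangent_gt L tv)) (push_comp _ _ (@smooth_fst R _ _)).
  by rewrite (push_cst _ sgs_dspace tPv).
by rewrite W2 V2 (push_comp _ _ (@smooth_snd R _ _)) /= (push_id tPv).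
Qed.

Lemma lag_isotropic x u v : algebroid x u -> algebroid x v ->
  lambda s x u (push (@gt _ H) v) + lambda s x v (push (@gt _ H) u) =
  - pairing Omega (push Phi u) (push Phi v).
Proof.
move=> au av; have tu := algebroid_tangent au; have tv := algebroid_tangent av.
have := lag_unit_form au tv; have := lag_unit_form av tu.
have d2 := @dspace_prod R K1 K1.
have tl := push_tangent d2 (smooth_right (one_K K)) (tangent_Phi_unit tv).
have tr := push_tangent d2 (smooth_left (one_K K)) (tangent_Phi_unit tu).
rewrite (lag_alt2 tu tv) /pairing.
have := Omega_alt2 tl tr; rewrite -[fun a => (a, one_K K)]/(@inl_K R K).
rewrite -[fun a => (one_K K, a)]/(@inr_K R K) -[(one_K K, one_K K)]/(_, _) => ->.
lra.
Qed.

(** Remove from v its component along the units; [Phi] is constant there, so the image of v does not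
    change. *)
Lemma unit_split_Phi x v : tangent (gunit x) v ->
  exists2 u, algebroid x u & push Phi u = push Phi v.
Proof.
move=> tv; exists (comb (-1) (push (@gunit _ H) (push (@gs _ H) v)) v).
  exact: (unit_split L tv).
rewrite push_comb (push_Phi_unit (tangent_gs L tv)); apply: funext => f.
by rewrite /comb /vec0 mulr0 add0r.
Qed.

End LagrangianMorphisms.

(** * The fibre product of two lagrangian morphisms *)

Section FibreGroupoid.
Variable R : realType.
Local Notation space := (space R).
Variables (K : sgroup R) (k : nat).
Local Notation K1 := (sgs K).
Local Notation K2 := (prod_space K1 K1).
Variables (Omega : K2 -> vec K2 -> vec K2 -> R)
  (Theta : K1 -> vec K1 -> vec K1 -> vec K1 -> R).
Hypothesis HK : two_shifted Omega Theta k.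
Variables (H1 H2 : groupoid R) (m1 n1 m2 n2 : nat)
  (Phi1 : arr H1 -> K1) (Phi2 : arr H2 -> K1)
  (s1 : arr H1 -> vec (arr H1) -> vec (arr H1) -> R)
  (s2 : arr H2 -> vec (arr H2) -> vec (arr H2) -> R)
  (eta1 : obj H1 -> vec (obj H1) -> vec (obj H1) -> vec (obj H1) -> R)
  (eta2 : obj H2 -> vec (obj H2) -> vec (obj H2) -> vec (obj H2) -> R).
Hypothesis L1 : lagrangian_morphism Omega Theta k m1 n1 Phi1 s1 eta1.
Hypothesis L2 : lagrangian_morphism Omega Theta k m2 n2 Phi2 s2 eta2.
Hypothesis Htr : transverse Phi1 Phi2.

Local Notation N := (prod_space (obj H1) (obj H2)).
Local Notation A := (fib_arr Phi1 Phi2).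
Local Notation G := (fibre_groupoid (lag_functor L1) (lag_functor L2)).
Local Notation pr1 := (@fib_pr1 R K H1 H2 Phi1 Phi2).
Local Notation pr2 := (@fib_pr2 R K H1 H2 Phi1 Phi2).
Let l1 := lag_lie L1.
Let l2 := lag_lie L2.
Let dH1 : dspace (arr H1) := arr_dspace l1.
Let dH2 : dspace (arr H2) := arr_dspace l2.
Let dN : dspace N := @dspace_prod R _ _.
Let dA : dspace A := @dspace_sub R _ _.
Let sP1 : smooth_map Phi1 := lag_smooth L1.
Let sP2 : smooth_map Phi2 := lag_smooth L2.

Lemma smooth_pr1 : smooth_map pr1. Proof. exact: smooth_fibre_fst. Qed.
Lemma smooth_pr2 : smooth_map pr2. Proof. exact: smooth_fibre_snd. Qed.

Lemma tangent_pr1 (p : A) u : tangent p u -> tangent (pr1 p) (push pr1 u).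
Proof. exact: (push_tangent dH1 smooth_pr1). Qed.
Lemma tangent_pr2 (p : A) u : tangent p u -> tangent (pr2 p) (push pr2 u).
Proof. exact: (push_tangent dH2 smooth_pr2). Qed.

Lemma fib_lift (p : A) u1 u2 : tangent (pr1 p) u1 -> tangent (pr2 p) u2 ->
  push Phi1 u1 = push Phi2 u2 ->
  exists u : vec A, [/\ tangent p u, push pr1 u = u1 & push pr2 u = u2].
Proof.
have tr : transverse_at Phi1 Phi2 (fibre_fst p) (fibre_snd p) by exact: (Htr (svalP p)).
exact: (fibre_product sP1 sP2 (lie_arr l1) (lie_arr l2) (sgs_manifold HK) tr).2.
Qed.

Lemma fib_tangent_eq (p : A) u v : tangent p u -> tangent p v ->
  push pr1 u = push pr1 v -> push pr2 u = push pr2 v -> u = v.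
Proof. exact: fibre_tangent_eq. Qed.

Lemma fib_dim : (m1 + m2 = k + ((n1 + n2) + (n1 + n2)))%N.
Proof.
apply/eqP; rewrite -(eqr_nat R); apply/eqP; rewrite !natrD.
have := lag_dim L1; have := lag_dim L2; lra.
Qed.

Lemma fib_arr_manifold : manifold ((n1 + n2) + (n1 + n2)) A.
Proof.
exact: (fibre_manifold sP1 sP2 (lie_arr l1) (lie_arr l2) (sgs_manifold HK) Htr fib_dim).
Qed.

Lemma fib_obj_manifold : manifold (n1 + n2) N.
Proof. exact: (prod_manifold (lie_obj l1) (lie_obj l2)). Qed.

Lemma smooth_into_fib (P : space) (f : P -> A) : dspace P ->
  smooth_map (fun x => pr1 (f x)) -> smooth_map (fun x => pr2 (f x)) -> smooth_map f.
Proof. exact: smooth_into_fibre. Qed.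

Lemma smooth_fib_gs : smooth_map (@gs _ G).
Proof.
apply: (smooth_pair dA).
  exact: (smooth_map_comp smooth_pr1 (lie_gs l1)).
exact: (smooth_map_comp smooth_pr2 (lie_gs l2)).
Qed.

Lemma smooth_fib_gt : smooth_map (@gt _ G).
Proof.
apply: (smooth_pair dA).
  exact: (smooth_map_comp smooth_pr1 (lie_gt l1)).
exact: (smooth_map_comp smooth_pr2 (lie_gt l2)).
Qed.

Lemma smooth_fib_gunit : smooth_map (@gunit _ G).
Proof.
apply: (smooth_into_fib dN).
  exact: (smooth_map_comp (@smooth_fst R _ _) (lie_gunit l1)).
exact: (smooth_map_comp (@smooth_snd R _ _) (lie_gunit l2)).
Qed.

Lemma smooth_fib_ginv : smooth_map (@ginv _ G).
Proof.
apply: (smooth_into_fib dA).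
  exact: (smooth_map_comp smooth_pr1 (lie_ginv l1)).
exact: (smooth_map_comp smooth_pr2 (lie_ginv l2)).
Qed.

Definition fib_comp1 (x : comp_space G) : comp_space H1 :=
  exist (fun x : prod_space (arr H1) (arr H1) => gs x.1 = gt x.2)
    (pr1 (comp_pr1 x), pr1 (comp_pr2 x)) (f_equal fst (svalP x)).

Definition fib_comp2 (x : comp_space G) : comp_space H2 :=
  exist (fun x : prod_space (arr H2) (arr H2) => gs x.1 = gt x.2)
    (pr2 (comp_pr1 x), pr2 (comp_pr2 x)) (f_equal snd (svalP x)).

Let dG2 : dspace (comp_space G) := @dspace_sub R _ _.

Lemma smooth_fib_comp1 : smooth_map fib_comp1.
Proof.
apply: (smooth_into_fibre dG2).
  exact: (smooth_map_comp (@smooth_comp_pr1 R G) smooth_pr1).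
exact: (smooth_map_comp (@smooth_comp_pr2 R G) smooth_pr1).
Qed.

Lemma smooth_fib_comp2 : smooth_map fib_comp2.
Proof.
apply: (smooth_into_fibre dG2).
  exact: (smooth_map_comp (@smooth_comp_pr1 R G) smooth_pr2).
exact: (smooth_map_comp (@smooth_comp_pr2 R G) smooth_pr2).
Qed.

Lemma fib_comp1_mul (x : comp_space G) : pr1 (@comp_mul R G x) = comp_mul (fib_comp1 x).
Proof. by rewrite /comp_mul; congr gmul; exact: Prop_irrelevance. Qed.

Lemma fib_comp2_mul (x : comp_space G) : pr2 (@comp_mul R G x) = comp_mul (fib_comp2 x).
Proof. by rewrite /comp_mul; congr gmul; exact: Prop_irrelevance. Qed.

Lemma smooth_fib_gmul : smooth_map (@comp_mul _ G).
Proof.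
apply: (smooth_into_fib dG2).
  by rewrite (funext fib_comp1_mul); exact: (smooth_map_comp smooth_fib_comp1 (lie_gmul l1)).
by rewrite (funext fib_comp2_mul); exact: (smooth_map_comp smooth_fib_comp2 (lie_gmul l2)).
Qed.

(* Vertical corrections are translated to the units, where transversality of the
   Phi_i can be tested on the Lie algebroids since Phi_i is constant on units. *)
Lemma fib_vertical (h1 : arr H1) (h2 : arr H2) d : Phi1 h1 = Phi2 h2 -> tangent (Phi1 h1) d ->
  exists v1 v2, [/\ tangent h1 v1, tangent h2 v2, push (@gs _ H1) v1 = @vec0 R _,
    push (@gs _ H2) v2 = @vec0 R _ & d = comb 1 (push Phi1 v1) (push Phi2 v2)].
Proof.
move=> e td.
have sR (b : K1) : smooth_map (fun a : K1 => mul_K (a, b)).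
  exact: (smooth_map_comp (smooth_right HK b) (smooth_mul_K HK)).
have dK := sgs_dspace HK.
(* Right translation by c carries d from [Phi1 h1] to the identity; translating back by [Phi1 h1] at
   the end recovers d. *)
pose c : K1 := ((Phi1 h1 : K)^-1)%g.
have txi := push_tangent dK (sR c) td; set xi := push _ d in txi.
have eu1 := Phi_unit L1 (gt h1); have eu2 := Phi_unit L2 (gt h2).
rewrite /mul_K /= mulgV -[1%g]/(one_K K) -eu1 in txi.
have [w1 [w2 [tw1 tw2 ew]]] := Htr (etrans eu1 (esym eu2)) txi.
have [u1 au1 eu1'] := unit_split_Phi L1 tw1; have [u2 au2 eu2'] := unit_split_Phi L2 tw2.
exists (rtrans h1 u1), (rtrans h2 u2); split.
- exact: (rtrans_tangent l1 au1).
- exact: (rtrans_tangent l2 au2).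
- exact: (rtrans_gs l1 au1).
- exact: (rtrans_gs l2 au2).
rewrite (push_Phi_rtrans HK L1 au1) (push_Phi_rtrans HK L2 au2) -e -push_comb eu1' eu2' -ew.
rewrite /xi (push_comp _ _ (sR _)) (_ : (fun x => _) = fun x => x) ?(push_id td) //.
by apply: funext => a; rewrite /mul_K /= -mulgA mulVg mulg1.
Qed.

(** Lift the two components of w separately to a1 and a2. The difference of their images in K is
    Phi1_* v1 + Phi2_* v2 with v1, v2 killed by the sources; then a1 - v1 and a2 + v2 have equal
    images and still lift w. *)
Lemma fib_gs_submersion : submersion (@gs _ G).
Proof.
move=> p w tw.
have tw1 := push_tangent (obj_dspace l1) (@smooth_fst R _ _) tw.
have tw2 := push_tangent (obj_dspace l2) (@smooth_snd R _ _) tw.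
have [a1 ta1 ea1] := lie_gs_subm l1 tw1; have [a2 ta2 ea2] := lie_gs_subm l2 tw2.
have e : Phi1 (pr1 p) = Phi2 (pr2 p) := svalP p.
have tP1 := tangent_Phi HK L1 ta1; have tP2 := tangent_Phi HK L2 ta2; rewrite -e in tP2.
have [v1 [v2 [tv1 tv2 sv1 sv2 ev]]] := fib_vertical e (tangent_comb (-1) tP2 tP1).
have tb1 := tangent_comb (-1) tv1 ta1; have tb2 := tangent_comb 1 tv2 ta2.
have eb : push Phi1 (comb (-1) v1 a1) = push Phi2 (comb 1 v2 a2).
  rewrite !push_comb; apply: funext => f; have := congr1 (fun u => u f) ev.
  rewrite /comb; lra.
have [u [tu u1 u2]] := fib_lift tb1 tb2 eb.
exists u => //.
apply: (tangent_prod_eq (push_tangent dN smooth_fib_gs tu) tw).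
  rewrite (push_comp _ _ (@smooth_fst R _ _)) -(push_comp pr1 _ (lie_gs l1)) u1 push_comb sv1 ea1.
  by apply: funext => f; rewrite /comb /vec0 mulr0 add0r.
rewrite (push_comp _ _ (@smooth_snd R _ _)) -(push_comp pr2 _ (lie_gs l2)) u2 push_comb sv2 ea2.
by apply: funext => f; rewrite /comb /vec0 mulr0 add0r.
Qed.

Lemma fib_lie_groupoid : lie_groupoid ((n1 + n2) + (n1 + n2)) (n1 + n2) G.
Proof.
split.
- exact: fib_arr_manifold.
- exact: fib_obj_manifold.
- exact: smooth_fib_gs.
- exact: smooth_fib_gt.
- exact: smooth_fib_gunit.
- exact: smooth_fib_ginv.
- exact: smooth_fib_gmul.
- exact: fib_gs_submersion.
- exact: (@submersion_gt R G dA smooth_fib_ginv smooth_fib_gt fib_gs_submersion).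
Qed.

Lemma fib_push_gs (u : vec A) : push1 (push (@gs _ G) u) = push (@gs _ H1) (push pr1 u) /\
  push2 (push (@gs _ G) u) = push (@gs _ H2) (push pr2 u).
Proof.
by rewrite !(push_comp _ _ (@smooth_fst R _ _)) !(push_comp _ _ (@smooth_snd R _ _))
  (push_comp _ _ (lie_gs l1)) (push_comp _ _ (lie_gs l2)).
Qed.

Lemma fib_push_gt (u : vec A) : push1 (push (@gt _ G) u) = push (@gt _ H1) (push pr1 u) /\
  push2 (push (@gt _ G) u) = push (@gt _ H2) (push pr2 u).
Proof.
by rewrite !(push_comp _ _ (@smooth_fst R _ _)) !(push_comp _ _ (@smooth_snd R _ _))
  (push_comp _ _ (lie_gt l1)) (push_comp _ _ (lie_gt l2)).
Qed.

Lemma fib_push_gunit (v : vec N) :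
  push pr1 (push (@gunit _ G) v) = push (@gunit _ H1) (push1 v) /\
  push pr2 (push (@gunit _ G) v) = push (@gunit _ H2) (push2 v).
Proof.
by rewrite !(push_comp _ _ smooth_pr1) !(push_comp _ _ smooth_pr2)
  (push_comp _ _ (lie_gunit l1)) (push_comp _ _ (lie_gunit l2)).
Qed.

Let eta := eta_diff eta1 eta2.
Let sigma : A -> vec A -> vec A -> R := sigma_diff s1 s2.

Let as1 := lag_alt2 L1.
Let as2 := lag_alt2 L2.

Lemma fib_pull1_form : form2 (pull2 pr1 s1).
Proof. exact: (form2_pull dA dH1 (arr_frame l1) smooth_pr1 (lag_form L1) as1).1. Qed.
Lemma fib_pull2_form : form2 (pull2 pr2 s2).
Proof. exact: (form2_pull dA dH2 (arr_frame l2) smooth_pr2 (lag_form L2) as2).1. Qed.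

Lemma fib_form : form2 sigma.
Proof. exact: (form2B dA fib_pull1_form fib_pull2_form). Qed.

Lemma fib_closed : closed_form3 eta.
Proof.
apply: (closed_form3B dN).
  exact: (closed_form3_pull dN (obj_dspace l1) (obj_frame l1) (@smooth_fst R _ _) (lag_closed L1)).
exact: (closed_form3_pull dN (obj_dspace l2) (obj_frame l2) (@smooth_snd R _ _) (lag_closed L2)).
Qed.

Lemma fib_mul_form : zero2 (fun (x : comp_space G) u v =>
  pull2 (@comp_mul _ G) sigma x u v -
  (pull2 (@comp_pr1 _ G) sigma x u v + pull2 (@comp_pr2 _ G) sigma x u v)).
Proof.
move=> x u v tu tv.
have t1 w : tangent x w -> tangent (fib_comp1 x) (push fib_comp1 w).
  exact: (push_tangent (@dspace_sub R _ _) smooth_fib_comp1).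
have t2 w : tangent x w -> tangent (fib_comp2 x) (push fib_comp2 w).
  exact: (push_tangent (@dspace_sub R _ _) smooth_fib_comp2).
have := lag_mul L1 (t1 _ tu) (t1 _ tv); have := lag_mul L2 (t2 _ tu) (t2 _ tv).
rewrite /sigma /sigma_diff /pull2.
have sF1 : smooth_map (fun y : comp_space H1 => (Phi1 (comp_pr1 y), Phi1 (comp_pr2 y)) : K2) :=
  smooth_comp_Phi L1.
have sF2 : smooth_map (fun y : comp_space H2 => (Phi2 (comp_pr1 y), Phi2 (comp_pr2 y)) : K2) :=
  smooth_comp_Phi L2.
rewrite !(push_comp _ _ (@smooth_comp_pr1 R H1)) !(push_comp _ _ (@smooth_comp_pr2 R H1)).
rewrite !(push_comp _ _ (@smooth_comp_pr1 R H2)) !(push_comp _ _ (@smooth_comp_pr2 R H2)).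
rewrite !(push_comp _ _ (lie_gmul l1)) !(push_comp _ _ (lie_gmul l2)).
rewrite !(push_comp _ _ smooth_pr1) !(push_comp _ _ smooth_pr2).
rewrite !(push_comp _ _ sF1) !(push_comp _ _ sF2).
rewrite !fib_comp1_mul !fib_comp2_mul !(funext fib_comp1_mul) !(funext fib_comp2_mul).
(* On the fibre product the two maps into K x K coincide, so the two [Omega]-terms are the same
   number, called o below, and drop out of the difference. *)
have eF (y : comp_space G) : (Phi2 (comp_pr1 (fib_comp2 y)), Phi2 (comp_pr2 (fib_comp2 y))) =
    (Phi1 (comp_pr1 (fib_comp1 y)), Phi1 (comp_pr2 (fib_comp1 y))).
  by congr pair; apply/esym; [exact: (svalP (comp_pr1 y)) | exact: (svalP (comp_pr2 y))].
rewrite !eF (funext eF).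
have aux (a1 b1 c1 a2 b2 c2 o : R) : a2 + b2 - c2 = o -> a1 + b1 - c1 = o ->
  c1 - c2 - (a1 - a2 + (b1 - b2)) = 0 by lra.
exact: aux.
Qed.

Lemma fib_d X Y Z : vfield X -> vfield Y -> vfield Z -> forall g : arr G,
  d2 sigma X Y Z g = pull3 (@gs _ G) eta g (X g) (Y g) (Z g) -
    pull3 (@gt _ G) eta g (X g) (Y g) (Z g).
Proof.
move=> vX vY vZ g; rewrite /sigma /sigma_diff.
rewrite (d2B g dA fib_pull1_form fib_pull2_form vX vY vZ).
(* [lag_d] concerns vector fields on the factors, whereas X, Y, Z live on the fibre product and may
   fail to project. Extending their projected values at g is enough because d is tensorial. *)
have ext1 (V : A -> vec A) : vfield V -> exists2 W, vfield W & W (pr1 g) = push pr1 (V g).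
  move=> vV; apply: (vfield_extend dH1 (arr_frame l1 _)).
  exact: (tangent_pr1 (vfield_tangent vV g)).
have ext2 (V : A -> vec A) : vfield V -> exists2 W, vfield W & W (pr2 g) = push pr2 (V g).
  move=> vV; apply: (vfield_extend dH2 (arr_frame l2 _)).
  exact: (tangent_pr2 (vfield_tangent vV g)).
have [X1 vX1 eX1] := ext1 X vX; have [Y1 vY1 eY1] := ext1 Y vY; have [Z1 vZ1 eZ1] := ext1 Z vZ.
have [X2 vX2 eX2] := ext2 X vX; have [Y2 vY2 eY2] := ext2 Y vY; have [Z2 vZ2 eZ2] := ext2 Z vZ.
rewrite (d2_pull dA dH1 (arr_frame l1) smooth_pr1 (lag_form L1) as1 vX vY vZ vX1 vY1 vZ1 eX1 eY1 eZ1).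
rewrite (d2_pull dA dH2 (arr_frame l2) smooth_pr2 (lag_form L2) as2 vX vY vZ vX2 vY2 vZ2 eX2 eY2 eZ2).
have := lag_d L1 vX1 vY1 vZ1 (pr1 g); have := lag_d L2 vX2 vY2 vZ2 (pr2 g).
rewrite /eta /eta_diff /pull3 !(fib_push_gs _).1 !(fib_push_gs _).2 !(fib_push_gt _).1
  !(fib_push_gt _).2 eX1 eY1 eZ1 eX2 eY2 eZ2.
have eP (x : A) : Phi2 (pr2 x) = Phi1 (pr1 x) := esym (svalP x).
rewrite !(push_comp _ _ sP1) !(push_comp _ _ sP2) (funext eP) eP.
have aux (a1 b1 c1 a2 b2 c2 o : R) : a2 - b2 - c2 = o -> a1 - b1 - c1 = o ->
  c1 - c2 = a1 - a2 - (b1 - b2) by lra.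
exact: aux.
Qed.

Lemma algebroid_pr (x : N) (u : vec A) : @algebroid R G x u ->
  [/\ algebroid x.1 (push pr1 u), algebroid x.2 (push pr2 u) &
    push Phi1 (push pr1 u) = push Phi2 (push pr2 u)].
Proof.
move=> [tu su]; split.
- split; first exact: (tangent_pr1 tu).
  by rewrite -(fib_push_gs u).1 su push_vec0.
- split; first exact: (tangent_pr2 tu).
  by rewrite -(fib_push_gs u).2 su push_vec0.
- rewrite !(push_comp _ _ sP1) !(push_comp _ _ sP2); congr (push _ u).
  by apply: funext => y; exact: (svalP y).
Qed.

Lemma fib_lambda (x : N) (u : vec A) v :
  @lambda R G sigma x u v = lambda s1 x.1 (push pr1 u) (push1 v) -
    lambda s2 x.2 (push pr2 u) (push2 v).
Proof.
by rewrite /lambda /sigma /sigma_diff /pull2 (fib_push_gunit v).1 (fib_push_gunit v).2.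
Qed.

Lemma fib_lambda0 (x : N) (u : vec A) : @algebroid R G x u ->
  (forall v, tangent x v -> @lambda R G sigma x u v = 0) ->
  (forall v, tangent x.1 v -> lambda s1 x.1 (push pr1 u) v = 0) /\
  (forall v, tangent x.2 v -> lambda s2 x.2 (push pr2 u) v = 0).
Proof.
move=> au u0; have [a1 a2 _] := algebroid_pr au.
have c1 := covector_lambda l1 (lag_form L1) as1 (algebroid_tangent a1).
have c2 := covector_lambda l2 (lag_form L2) as2 (algebroid_tangent a2).
have dO1 := obj_dspace l1; have dO2 := obj_dspace l2.
split=> v tv.
  have [tp p1 p2] := pair_vecP dO1 dO2 tv (tangent_vec0 x.2).
  by have := u0 _ tp; rewrite fib_lambda p1 p2 (covector0 c2) subr0.
have [tp p1 p2] := pair_vecP dO1 dO2 (tangent_vec0 x.1) tv.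
by have /eqP := u0 _ tp; rewrite fib_lambda p1 p2 (covector0 c1) sub0r oppr_eq0 => /eqP.
Qed.

Lemma fib_nondegenerate (x : N) (u : vec A) : @algebroid R G x u ->
  (forall v, tangent x v -> @lambda R G sigma x u v = 0) ->
  push (@gt _ G) u = @vec0 R N -> u = @vec0 R A.
Proof.
move=> au u0 tu0; have [a1 a2 eP] := algebroid_pr au.
have [z1 z2] := fib_lambda0 au u0.
have g1 : push (@gt _ H1) (push pr1 u) = @vec0 R _ by rewrite -(fib_push_gt u).1 tu0 push_vec0.
have g2 : push (@gt _ H2) (push pr2 u) = @vec0 R _ by rewrite -(fib_push_gt u).2 tu0 push_vec0.
have lam0 (H : groupoid R) m n (L : lie_groupoid m n H) s (fs : form2 s) (as_ : alt2 s) y v :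
    algebroid y v -> lambda s y v (@vec0 R (obj H)) = 0.
  move=> av; exact: (covector0 (covector_lambda L fs as_ (algebroid_tangent av))).
have Om0 v : tangent (one_K K) v ->
    Omega (one_K K, one_K K) (@vec0 R K2) (push (@inr_K R K) v) = 0.
  move=> tv; have tr := push_tangent (@dspace_prod R _ _) (smooth_left HK (one_K K)) tv.
  exact: (covector0 (form2_covl (ts_Omega HK) tr)).
pose ka := push Phi1 (push pr1 u).
have tka : tangent (one_K K) ka := tangent_Phi_unit HK L1 (algebroid_tangent a1).
have ka0 : ka = @vec0 R K1.
  apply: (ts_nondeg HK tka) => w tw.
  rewrite -(Phi_unit L1 x.1) in tw.
  have [w1 [w2 [tw1 tw2 ->]]] := Htr (etrans (Phi_unit L1 x.1) (esym (Phi_unit L2 x.2))) tw.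
  have [v1 b1 <-] := unit_split_Phi L1 tw1; have [v2 b2 <-] := unit_split_Phi L2 tw2.
  have tv1 := algebroid_tangent b1; have tv2 := algebroid_tangent b2.
  rewrite (pairing_combr HK 1 tka (tangent_Phi_unit HK L1 tv1) (tangent_Phi_unit HK L2 tv2)).
  have := lag_isotropic HK L1 a1 b1; have := lag_isotropic HK L2 a2 b2.
  rewrite g1 g2 (lam0 _ _ _ l1 _ (lag_form L1) as1 _ _ b1) (lam0 _ _ _ l2 _ (lag_form L2) as2 _ _ b2).
  rewrite z1 ?z2 -?eP -/ka; first lra.
  + exact: (tangent_gt_unit l2 tv2).
  + exact: (tangent_gt_unit l1 tv1).
apply: (fib_tangent_eq (algebroid_tangent au) (tangent_vec0 _)).
  rewrite push_vec0; apply: (lag_ker L1 (algebroid_tangent a1) _ ka0 (algebroid_ker a1) g1).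
  move=> v tv; rewrite (lag_unit_form HK L1 a1 tv) -/ka ka0 push_vec0 z1 ?Om0 ?subr0 //.
    exact: (tangent_Phi_unit HK L1 tv).
  exact: (tangent_gt_unit l1 tv).
rewrite push_vec0.
apply: (lag_ker L2 (algebroid_tangent a2) _ (etrans (esym eP) ka0) (algebroid_ker a2) g2).
move=> v tv; rewrite (lag_unit_form HK L2 a2 tv) -eP -/ka ka0 push_vec0 z2 ?Om0 ?subr0 //.
  exact: (tangent_Phi_unit HK L2 tv).
exact: (tangent_gt_unit l2 tv).
Qed.

Lemma fib_quasi_symplectic : @quasi_symplectic R G sigma eta.
Proof.
split.
- exists ((n1 + n2) + (n1 + n2))%N, (n1 + n2)%N; split; first exact: fib_lie_groupoid.
  by rewrite addnn mul2n.
- exact: fib_form.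
- exact: fib_closed.
- exact: fib_mul_form.
- exact: fib_d.
- move=> x u tu su su0 tu0; apply: (@fib_nondegenerate x u) => // v tv.
  exact: (su0 _ (push_tangent dA smooth_fib_gunit tv)).
Qed.

(** A common k is exactly the condition under which u1 and u2 combine into a tangent vector of the
    fibre product at the unit, and the minus sign in sigma accounts for the sign of the second
    covector. *)
Lemma fib_integrates : @integrates R G sigma
  (composed_dirac (morphism_dirac Phi1 s1) (morphism_dirac Phi2 s2)).
Proof.
move=> x X a; split.
  move=> [tX [a1 [a2 [_ _ ea [ka [tka [u1 au1 [e1 b1 k1]] [u2 au2 [e2 b2 k2]]]]]]]].
  have [u [tu pu1 pu2]] := @fib_lift (fib_unit (lag_functor L1) (lag_functor L2) x) u1 u2
    (algebroid_tangent au1) (algebroid_tangent au2) (etrans (esym k1) k2).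
  have tgu : tangent x (push (@gt _ G) u) := tangent_gt_unit fib_lie_groupoid tu.
  have tsu : tangent x (push (@gs _ G) u) := tangent_gs_unit fib_lie_groupoid tu.
  exists u.
    split=> //; apply: (tangent_prod_eq tsu (tangent_vec0 _)).
      by rewrite (fib_push_gs u).1 pu1 (algebroid_ker au1) push_vec0.
    by rewrite (fib_push_gs u).2 pu2 (algebroid_ker au2) push_vec0.
  split.
    apply: (tangent_prod_eq tX tgu).
      by rewrite (fib_push_gt u).1 pu1 e1.
    by rewrite (fib_push_gt u).2 pu2 e2.
  move=> v tv; rewrite fib_lambda pu1 pu2 ea //.
  have tv1 := push_tangent (obj_dspace l1) (@smooth_fst R _ _) tv.
  have tv2 := push_tangent (obj_dspace l2) (@smooth_snd R _ _) tv.
  by rewrite b1 // -b2 // opprK.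
move=> [u au [eX ea]]; have [a1 a2 eP] := algebroid_pr au.
have c1 := covector_lambda l1 (lag_form L1) as1 (algebroid_tangent a1).
have c2 := covector_lambda l2 (lag_form L2) as2 (algebroid_tangent a2).
split.
  by rewrite eX; exact: (tangent_gt_unit fib_lie_groupoid (algebroid_tangent au)).
exists (lambda s1 x.1 (push pr1 u)), (fun v => - lambda s2 x.2 (push pr2 u) v); split=> //.
- by move=> c v1 v2 t1 t2; rewrite c2 // opprD mulrN.
- by move=> v tv; rewrite ea // fib_lambda.
- exists (push Phi1 (push pr1 u)); split.
  + exact: (tangent_Phi_unit HK L1 (algebroid_tangent a1)).
  + by exists (push pr1 u) => //; split=> //; rewrite eX (fib_push_gt u).1.
  + exists (push pr2 u) => //; split=> //; first by rewrite eX (fib_push_gt u).2.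
    by move=> v tv; rewrite opprK.
Qed.

End FibreGroupoid.

Theorem corollary3p24 (R : realType) (K : sgroup R) (k : nat)
  (Omega : prod_space (sgs K) (sgs K) -> vec (prod_space (sgs K) (sgs K)) ->
           vec (prod_space (sgs K) (sgs K)) -> R)
  (Theta : sgs K -> vec (sgs K) -> vec (sgs K) -> vec (sgs K) -> R)
  (HK : two_shifted Omega Theta k)
  (H1 H2 : groupoid R) (m1 n1 m2 n2 : nat)
  (Phi1 : arr H1 -> sgs K) (Phi2 : arr H2 -> sgs K)
  (sigma1 : arr H1 -> vec (arr H1) -> vec (arr H1) -> R)
  (sigma2 : arr H2 -> vec (arr H2) -> vec (arr H2) -> R)
  (eta1 : obj H1 -> vec (obj H1) -> vec (obj H1) -> vec (obj H1) -> R)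
  (eta2 : obj H2 -> vec (obj H2) -> vec (obj H2) -> vec (obj H2) -> R)
  (L1 : lagrangian_morphism Omega Theta k m1 n1 Phi1 sigma1 eta1)
  (L2 : lagrangian_morphism Omega Theta k m2 n2 Phi2 sigma2 eta2)
  (Htr : transverse Phi1 Phi2) :
  let E := composed_dirac (morphism_dirac Phi1 sigma1)
                          (morphism_dirac Phi2 sigma2) in
  let eta := eta_diff eta1 eta2 in
  let G := fibre_groupoid (lag_functor L1) (lag_functor L2) in
  let sigma := sigma_diff sigma1 sigma2 in
  dirac eta E /\
  (@quasi_symplectic R G sigma eta /\ @integrates R G sigma E).
Proof.
move=> E eta G sigma.
have Q : @quasi_symplectic R G sigma eta := fib_quasi_symplectic HK L1 L2 Htr.
have I : @integrates R G sigma E := fib_integrates HK Htr (L1 := L1) (L2 := L2).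
split=> //; exact: (image_dirac (fib_lie_groupoid HK L1 L2 Htr) Q I).
Qed.
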